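(* Let $\mu$ be the normalized volume measure on the torus $\mathbb T^n$ and let $k,\ell\in\mathbb Z^n$ be generic, i.e. $k_p\ne\pm\ell_p$ and $k_p\ell_p\ne0$ for all $p=1,\dots,n$. Then $$\mathsf{Sec}_\mu(e_k,e_\ell)=\mathsf{Sec}^\uparrow_\mu(e_k,e_\ell)+\mathsf{Sec}^\nabla_\mu(e_k,e_\ell)=\frac1{2^n}\sum_{\sigma\in\{-1,1\}^n}S(k^\sigma,\ell),$$ where $k^\sigma=(\sigma_1k_1,\dots,\sigma_nk_n)$ and $$S(k,\ell)=\frac{1}{(4+|k|^2)(4+|\ell|^2)}\bigg(-|k|^2|\ell|^2+\langle k^2,\ell^2\rangle+\frac34\bigg[|k-\ell|^2-\frac{(|k|^2-|\ell|^2)^2}{4+|k+\ell|^2}\bigg]\langle k,\ell\rangle^2\bigg),$$ with $\langle k^2,\ell^2\rangle=\sum_{p=1}^n k_p^2\ell_p^2$.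
   Context: $M=\mathbb T^n=(\mathbb R/2\pi\mathbb Z)^n$ with the flat metric and distance $d$, $d\mu=(2\pi)^{-n}dx$. Fourier basis: $e_k(x)=\prod_{p=1}^n e_{k_p}(x_p)$ for $k\in\mathbb Z^n$, where for $j\in\mathbb Z$: $e_j(y)=\sqrt2\cos(jy)$ if $j>0$, $\sqrt2\sin(jy)$ if $j<0$, $1$ if $j=0$. $|k|$ and $\langle k,\ell\rangle$ are Euclidean. $\mathcal M_0(M)$ is the set of finite Borel measures on $M$. Cone: $C=(M\times[0,\infty))/\!\sim$, where $(x,r)\sim(x',r')$ iff they are equal or $r=r'=0$, with metric $d_C((x,r),(x',r'))^2=r^2+r'^2-2rr'\cos(\min(d(x,x'),\pi))$. $\mathcal M_2(C)$ (resp. $\mathcal M_2(C\times C)$) is the set of Borel measures integrating $1+$ squared distance to a fixed point. For $\nu\in\mathcal M_2(C)$: $\Pr(\nu)(A)=\int_{A\times[0,\infty)}r^2\,d\nu(x,r)$. With $\pi_0,\pi_1$ the projections of $C\times C$, $\mathsf{HK}(\mu_0,\mu_1)=\inf\{\int d_C^2\,dq: q\in\mathcal M_2(C\times C),\ \Pr((\pi_i)_*q)=\mu_i,\ i=0,1\}^{1/2}$. For $r>0$, $s>-r$, $|v|<(1+s/r)\pi/2$: $\exp^C_{(x,r)}(v,s)=\big(\exp^M_x(\arctan(\tfrac{r|v|}{r+s})\tfrac{v}{|v|}),\sqrt{(r+s)^2+r^2|v|^2}\big)$ (first component $x$ if $v=0$). $r_\mu=\sqrt{\mu(M)}$, $\hat\mu=\frac1{r_\mu^2}\mu\otimes\delta_{r_\mu}$,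 $\exp_\mu(\varphi)=\Pr(\exp^C((\nabla\varphi,2r\varphi))_*\hat\mu)$. $\|\varphi\|^2_{H^1(\mu)}=\int(|\nabla\varphi|^2+4\varphi^2)d\mu$ with corresponding inner product; $\Lambda=\|\varphi\|^2_{H^1(\mu)}\|\psi\|^2_{H^1(\mu)}-\langle\varphi,\psi\rangle^2_{H^1(\mu)}$. $\lim^{*}_{s,t\to0}G(s,t)=L$ means $G(s_j,t_j)\to L$ whenever $s_j,t_j\to0$ in $(0,\infty)$ with $\sup_j(s_j/t_j+t_j/s_j)<\infty$. Let $I(s,t)=\int_C d_C^2\big(\exp^C_{(x,r)}(s(\nabla\varphi,2r\varphi)),\exp^C_{(x,r)}(t(\nabla\psi,2r\psi))\big)d\hat\mu(x,r)$. Then $$\mathsf{Sec}_\mu(\varphi,\psi)=\lim^{*}_{s,t\to0}\tfrac{3}{\Lambda s^2t^2}\big[\|s\varphi-t\psi\|^2_{H^1(\mu)}-\mathsf{HK}^2(\exp_\mu(s\varphi),\exp_\mu(t\psi))\big],$$ $$\mathsf{Sec}^\uparrow_\mu(\varphi,\psi)=\lim^{*}_{s,t\to0}\tfrac{3}{\Lambda s^2t^2}\big[\|s\varphi-t\psi\|^2_{H^1(\mu)}-I(s,t)\big],\quad \mathsf{Sec}^\nabla_\mu(\varphi,\psi)=\lim^{*}_{s,t\to0}\tfrac{3}{\Lambda s^2t^2}\big[I(s,t)-\mathsf{HK}^2(\exp_\mu(s\varphi),\exp_\mu(t\psi))\big].$$ *)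

(* Defs.v *)
From HB Require Import structures.
From mathcomp Require Import all_boot all_order all_algebra generic_quotient.
From mathcomp Require Import all_classical all_reals all_analysis.
Set Implicit Arguments.
Unset Strict Implicit.
Unset Printing Implicit Defensive.
Import Order.TTheory GRing.Theory Num.Theory.
Import numFieldNormedType.Exports.
Local Open Scope classical_set_scope.
Local Open Scope quotient_scope.
Local Open Scope ring_scope.

Section Euclid.
Context {R : realType} {n : nat}.
Implicit Types u v : 'rV[R]_n.

(* The norm `|u| of the library on 'rV[R]_n is the sup norm. *)
Definition dot u v : R := \sum_(p < n) u 0 p * v 0 p.
Definition enorm u : R := Num.sqrt (dot u u).

End Euclid.

(* For a distance function [d] the Borel sigma-algebra of the metric space
   (T, d) is the one of [g_sigma_algebraType (dist_open d)]. *)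
Definition dist_open {R : realType} {T : Type} (d : T -> T -> R) : set (set T) :=
  [set U | forall x, U x -> exists2 e : R, 0 < e & forall y, d x y < e -> U y].

Section Torus.
Variables (R : realType) (n : nat).
Implicit Types u v : 'rV[R]_n.

Definition torus_rel : rel 'rV[R]_n := fun u v =>
  `[< exists z : 'rV[int]_n, u - v = (2 * pi) *: map_mx intr z >].

Fact torus_rel_refl : reflexive torus_rel.
Proof. by move=> u; apply/asboolP; exists 0; rewrite subrr map_mx0 scaler0. Qed.

Fact torus_rel_sym : symmetric torus_rel.
Proof.
move=> u v; apply/asboolP/asboolP => -[z uv]; exists (- z);
  by rewrite map_mxN scalerN -uv opprB.
Qed.

Fact torus_rel_trans : transitive torus_rel.
Proof.
move=> v u w /asboolP[z uv] /asboolP[z' vw]; apply/asboolP; exists (z + z').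
by rewrite map_mxD scalerDr -uv -vw addrA subrK.
Qed.

Canonical torus_equiv :=
  EquivRel torus_rel torus_rel_refl torus_rel_sym torus_rel_trans.

Definition torus_carrier := {eq_quot torus_equiv}.

HB.instance Definition _ := Choice.on torus_carrier.
HB.instance Definition _ :=
  isPointed.Build torus_carrier (\pi_{eq_quot torus_equiv} 0).

Definition torus_class (u : 'rV[R]_n) : torus_carrier :=
  \pi_{eq_quot torus_equiv} u.

Definition torus_dist (x y : torus_carrier) : R :=
  inf [set enorm (uv.1 - uv.2) | uv in
        [set uv : 'rV[R]_n * 'rV[R]_n |
          torus_class uv.1 = x /\ torus_class uv.2 = y]].

Definition torus := g_sigma_algebraType (dist_open torus_dist).
HB.instance Definition _ := Measurable.on torus.

Definition torus_pi (u : 'rV[R]_n) : torus := torus_class u.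
Definition torus_repr (x : torus) : 'rV[R]_n :=
  repr (x : {eq_quot torus_equiv}).

Definition torus_exp (x : torus) (v : 'rV[R]_n) : torus :=
  torus_pi (torus_repr x + v).

(* Partial derivatives of the periodic lift of [phi] to R^n. *)
Definition grad (phi : torus -> R) (x : torus) : 'rV[R]_n :=
  \row_p 'D_(delta_mx 0 p) (phi \o torus_pi) (torus_repr x).

End Torus.

Section TorusVolume.
Variable R : realType.

Fact twopi_gt0 : 0 < 2 * pi :> R.
Proof. by rewrite mulr_gt0 ?pi_gt0. Qed.

Definition cons_tup n (p : measurableTypeR R * n.-tuple (measurableTypeR R)) : n.+1.-tuple (measurableTypeR R) :=
  [tuple of p.1 :: p.2].

Fact measurable_cons_tup n : measurable_fun setT (@cons_tup n).
Proof. by apply: measurable_cons; [exact: measurable_fst|exact: measurable_snd]. Qed.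

HB.instance Definition _ n := isMeasurableFun.Build _ _ _ _ (@cons_tup n)
  (@measurable_cons_tup n).

(* (2 pi)^-n dx on the fundamental domain [0, 2 pi]^n *)
Fixpoint box_volume n : probability (n.-tuple (measurableTypeR R)) R :=
  match n with
  | 0 => \d_[tuple]
  | m.+1 => distribution (uniform_prob twopi_gt0 \x box_volume m)%E (@cons_tup m)
  end.

End TorusVolume.

Section TorusVolumeMeasure.
Variables (R : realType) (n : nat).

Definition torus_of_tuple (t : n.-tuple (measurableTypeR R)) : torus R n :=
  torus_pi (\row_p tnth t p).

Fact enorm_le (u : 'rV[R]_n) (e : R) : 0 <= e ->
  (forall p, `|u 0 p| <= e) -> enorm u <= Num.sqrt n%:R * e.
Proof.
move=> e0 ue; have -> : Num.sqrt n%:R * e = Num.sqrt (n%:R * e ^+ 2).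
  by rewrite sqrtrM ?ler0n// sqrtr_sqr ger0_norm.
apply: ler_wsqrtr; rewrite /dot mulr_natl -[n in leRHS]card_ord -sumr_const.
apply: ler_sum => p _; rewrite -expr2 -real_normK ?num_real//.
by rewrite lerXn2r ?nnegrE.
Qed.

Fact torus_dist_le (u v : 'rV[R]_n) :
  torus_dist (torus_class u) (torus_class v) <= enorm (u - v).
Proof.
apply: ge_inf; last by exists (u, v).
by exists 0 => _ [w _ <-]; exact: sqrtr_ge0.
Qed.

Fact countable_bigcup_meas d (T : sigmaRingType d) (I : countType)
    (D : set I) (F : I -> set T) :
  (forall i, measurable (F i)) -> measurable (\bigcup_(i in D) F i).
Proof.
move=> mF; rewrite bigcup_mkcond; apply: countable_bigcupT_measurable.
  exact: countableP.
by move=> i; case: ifP.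
Qed.

Fact measurable_torus_of_tuple : measurable_fun setT torus_of_tuple.
Proof.
apply: (@measurability _ _ _ (torus R n) setT torus_of_tuple (@dist_open R _ (@torus_dist R n))) => //.
move=> _ [U openU <-]; rewrite setTI.
pose e m : R := m.+1%:R^-1.
pose box (q : n.-tuple rat) m := [set t : n.-tuple (measurableTypeR R) |
  forall p, `|ratr (tnth q p) - (tnth t p : R)| < e m].
have e_gt0 m : 0 < e m by rewrite invr_gt0.
have mbox q m : measurable (box q m).
  have -> : box q m = \bigcap_(p in [set: 'I_n])
     ((fun t : n.-tuple (measurableTypeR R) => tnth t p) @^-1`
        [set` `](ratr (tnth q p) : R) - e m, ratr (tnth q p) + e m[]).
    by apply/seteqP; split=> t /= H p => [_|]; [have := H p|have := H p I];
      rewrite /= in_itv/= ltr_distlC.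
  apply: fin_bigcap_measurable => [|p _]; first exact: finite_finset.
  rewrite -[X in measurable X]setTI.
  apply: (@measurable_tnth _ (measurableTypeR R) n p measurableT).
  exact: measurable_itv.
have -> : torus_of_tuple @^-1` U = \bigcup_(qm in
    [set qm : n.-tuple rat * nat | box qm.1 qm.2 `<=` torus_of_tuple @^-1` U])
    box qm.1 qm.2.
  apply/seteqP; split; last by move=> t [qm /= + tqm]; exact.
  move=> t Ut; have [d d0 dU] := openU _ Ut.
  pose c : R := Num.sqrt n%:R + 1.
  have c0 : 0 < c by rewrite ltr_wpDl// sqrtr_ge0.
  pose m := Num.truncn (c * 2 / d).
  have em : c * (e m * 2) < d.
    have : c * 2 / d < m.+1%:R by exact: truncnS_gt.
    rewrite ltr_pdivrMr// => H.
    by rewrite (mulrC (e m)) mulrA ltr_pdivrMr// (mulrC d).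
  have /choice[q qt] : forall p, exists q : rat,
      `|ratr q - (tnth t p : R)| < e m.
    move=> p; have [q] := @rat_in_itvoo R (tnth t p) (tnth t p + e m) (ltr_pwDr (e_gt0 m) (lexx _)).
    rewrite in_itv/= => /andP[tq qe]; exists q.
    by rewrite gtr0_norm ?subr_gt0// ltrBlDl.
  exists ([tuple q p | p < n], m) => /=; last first.
    by move=> p /=; rewrite tnth_mktuple.
  move=> s /= boxs; apply: dU; apply: le_lt_trans (torus_dist_le _ _) _.
  apply: le_lt_trans em; apply: (@le_trans _ _ (Num.sqrt n%:R * (e m * 2))).
    apply: enorm_le => [|p]; first by rewrite mulr_ge0// ltW.
    rewrite !mxE -(subrKA (ratr (q p))) mulr_natr mulr2n.
    apply: le_trans (ler_normD _ _) _; apply: lerD; first by rewrite distrC ltW.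
    by have := boxs p; rewrite /= tnth_mktuple => /ltW.
  by rewrite ler_wpM2r ?mulr_ge0 ?ltW// ltrDl.
by apply: (@countable_bigcup_meas _ _ _ _ (fun qm => box qm.1 qm.2)) => -[].
Qed.

HB.instance Definition _ := isMeasurableFun.Build _ _ _ _ torus_of_tuple
  measurable_torus_of_tuple.

Definition torus_volume : probability (torus R n) R :=
  distribution (box_volume R n) torus_of_tuple.

End TorusVolumeMeasure.

Section Cone.
Variables (R : realType) (n : nat).
Local Notation M := (torus R n).
Local Notation MR := (torus R n * {nonneg R})%type.

Definition cone_rel : rel MR := fun p q =>
  (p == q) || ((p.2%:num == 0) && (q.2%:num == 0)).

Fact cone_rel_refl : reflexive cone_rel.
Proof. by move=> p; rewrite /cone_rel eqxx. Qed.

Fact cone_rel_sym : symmetric cone_rel.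
Proof. by move=> p q; rewrite /cone_rel eq_sym andbC. Qed.

Fact cone_rel_trans : transitive cone_rel.
Proof.
move=> q p r /orP[/eqP->//|/andP[p0 q0]] /orP[/eqP<-|/andP[_ r0]];
  by apply/orP; right; apply/andP.
Qed.

Canonical cone_equiv :=
  EquivRel cone_rel cone_rel_refl cone_rel_sym cone_rel_trans.

Definition cone_carrier := {eq_quot cone_equiv}.

HB.instance Definition _ := Choice.on cone_carrier.
HB.instance Definition _ :=
  isPointed.Build cone_carrier (\pi_{eq_quot cone_equiv} (point, 0%:nng)).

(* Radius and base point of a representative; the base point of the apex is
   arbitrary, and every use of it below is weighted by the radius. *)
Definition cone_rad (c : cone_carrier) : R :=
  (repr (c : {eq_quot cone_equiv})).2%:num.
Definition cone_base (c : cone_carrier) : M :=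
  (repr (c : {eq_quot cone_equiv})).1.

Definition cone_dist (c c' : cone_carrier) : R :=
  let r := cone_rad c in let r' := cone_rad c' in
  Num.sqrt (r ^+ 2 + r' ^+ 2 -
    2 * r * r' * cos (Num.min (torus_dist (cone_base c) (cone_base c')) pi)).

Definition cone := g_sigma_algebraType (dist_open cone_dist).
HB.instance Definition _ := Measurable.on cone.

Definition cone_pi (x : M) (r : {nonneg R}) : cone :=
  \pi_{eq_quot cone_equiv} (x, r).

(* Tangent vectors at (x, r) are pairs (v, s), with s the radial component. *)
Definition cone_exp (c : cone) (v : 'rV[R]_n) (s : R) : cone :=
  let x := cone_base c in let r := cone_rad c in
  cone_pi
    (if v == 0 then x else
     torus_exp x ((atan (r * enorm v / (r + s)) / enorm v) *: v))
    (NngNum (sqrtr_ge0 ((r + s) ^+ 2 + r ^+ 2 * enorm v ^+ 2))).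

Definition cone2_dist (p q : cone * cone) : R :=
  Num.sqrt (cone_dist p.1 q.1 ^+ 2 + cone_dist p.2 q.2 ^+ 2).

End Cone.

(* [mu] integrates 1 + d(o, .)^2 for a fixed point o. *)
Definition finite_second_moment {R : realType} {d} {T : measurableType d}
    (dist : T -> T -> R) (mu : set T -> \bar R) : Prop :=
  exists o : T, (\int[mu]_x (1 + dist o x ^+ 2)%:E < +oo)%E.

Section HellingerKantorovich.
Variables (R : realType) (n : nat).
Local Notation M := (torus R n).
Local Notation C := (cone R n).

(* Measures obtained as images or with densities are handled as plain set
   functions, to be evaluated on measurable sets. *)
Definition Pr (nu : set C -> \bar R) : set M -> \bar R := fun A =>
  (\int[nu]_(c in [set cone_pi xr.1 xr.2 | xr in A `*` setT])
     (cone_rad c ^+ 2)%:E)%E.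

(* The library equips C * C with the product sigma-algebra, which is the Borel
   one since C is separable. *)
Definition HK_plan (mu0 mu1 : set M -> \bar R)
    (q : {measure set (C * C) -> \bar R}) : Prop :=
  [/\ finite_second_moment (@cone2_dist R n) q,
      forall A, measurable A -> Pr (pushforward q fst) A = mu0 A &
      forall A, measurable A -> Pr (pushforward q snd) A = mu1 A].

Definition HK (mu0 mu1 : set M -> \bar R) : R :=
  Num.sqrt (fine (ereal_inf
    [set (\int[q]_p (cone_dist p.1 p.2 ^+ 2)%:E)%E | q in HK_plan mu0 mu1])).

Section AtMu.
Variable mu : {finite_measure set M -> \bar R}.
Implicit Types phi psi : M -> R.

Definition rmu : {nonneg R} := NngNum (sqrtr_ge0 (fine (mu setT))).

(* r_mu^-2 (mu \x delta_{r_mu}), seen on the cone *)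
Definition hat_mu : set C -> \bar R := fun B =>
  ((rmu%:num ^- 2)%:E * pushforward mu (fun x => cone_pi x rmu : C) B)%E.

(* [cone_flow s phi] is the map (x, r) |-> exp_(x, r) (s (grad phi, 2 r phi)) *)
Definition cone_flow (s : R) phi (c : C) : C :=
  let x := cone_base c in let r := cone_rad c in
  cone_exp c (s *: grad phi x) (s * (2 * r * phi x)).

Definition exp_mu phi : set M -> \bar R :=
  Pr (pushforward hat_mu (cone_flow 1 phi)).

Definition H1_dot phi psi : R :=
  \int[mu]_x (dot (grad phi x) (grad psi x) + 4 * phi x * psi x).

Definition H1_norm2 phi : R :=
  \int[mu]_x (enorm (grad phi x) ^+ 2 + 4 * phi x ^+ 2).

Definition Lambda phi psi : R :=
  H1_norm2 phi * H1_norm2 psi - H1_dot phi psi ^+ 2.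

Definition Icost phi psi (s t : R) : R :=
  fine (\int[hat_mu]_c (cone_dist (cone_flow s phi c) (cone_flow t psi c) ^+ 2)%:E)%E.

Definition HK2 phi psi (s t : R) : R :=
  HK (exp_mu (s \*o phi)) (exp_mu (t \*o psi)) ^+ 2.

Definition H1_gap2 phi psi (s t : R) : R :=
  H1_norm2 (s \*o phi \- t \*o psi).

End AtMu.
End HellingerKantorovich.

Definition lim_star {R : realType} (G : R -> R -> R) (L : R) : Prop :=
  forall s t : nat -> R,
    (forall j, 0 < s j) -> (forall j, 0 < t j) ->
    s @ \oo --> 0 -> t @ \oo --> 0 ->
    has_ubound (range (fun j => s j / t j + t j / s j)) ->
    (fun j => G (s j) (t j)) @ \oo --> L.

Section SectionalCurvature.
Context {R : realType} {n : nat}.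
Variables (mu : {finite_measure set (torus R n) -> \bar R})
  (phi psi : torus R n -> R).

Definition sec_coef (s t : R) : R :=
  3 / (Lambda mu phi psi * s ^+ 2 * t ^+ 2).

(* The curvatures are limits that need not exist: [is_Sec mu phi psi K] means
   that the limit exists and equals K. *)
Definition is_Sec (K : R) : Prop :=
  lim_star (fun s t =>
    sec_coef s t * (H1_gap2 mu phi psi s t - HK2 mu phi psi s t)) K.

Definition is_Sec_up (K : R) : Prop :=
  lim_star (fun s t =>
    sec_coef s t * (H1_gap2 mu phi psi s t - Icost mu phi psi s t)) K.

Definition is_Sec_nabla (K : R) : Prop :=
  lim_star (fun s t =>
    sec_coef s t * (Icost mu phi psi s t - HK2 mu phi psi s t)) K.

End SectionalCurvature.

Section FourierBasis.
Context {R : realType} {n : nat}.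
Implicit Types k l : 'rV[int]_n.

Definition fourier1 (j : int) (y : R) : R :=
  if 0 < j then Num.sqrt 2 * cos (j%:~R * y)
  else if j < 0 then Num.sqrt 2 * sin (j%:~R * y)
  else 1.

Definition fourier k (x : torus R n) : R :=
  \prod_(p < n) fourier1 (k 0 p) (torus_repr x 0 p).

Definition generic k l : Prop :=
  forall p, [/\ k 0 p <> l 0 p, k 0 p <> - l 0 p & k 0 p * l 0 p <> 0].

(* The sign sigma_p is (-1) ^+ sigma p. *)
Definition sign_flip (sigma : {ffun 'I_n -> bool}) k : 'rV[int]_n :=
  \row_p ((-1) ^+ sigma p * k 0 p).

Definition torus_S k l : R :=
  let K : 'rV[R]_n := map_mx intr k in
  let L : 'rV[R]_n := map_mx intr l in
  ((4 + enorm K ^+ 2) * (4 + enorm L ^+ 2))^-1 *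
  (- (enorm K ^+ 2 * enorm L ^+ 2) + (\sum_(p < n) K 0 p ^+ 2 * L 0 p ^+ 2)
   + 3 / 4 * (enorm (K - L) ^+ 2
              - (enorm K ^+ 2 - enorm L ^+ 2) ^+ 2 / (4 + enorm (K + L) ^+ 2))
           * dot K L ^+ 2).

End FourierBasis.

(* Main.v *)
(** Both exponentials are the images of the uniform measure under explicit maps of the cone,
    exp_mu (s phi) being carried by u + disp s phi u with radius [radius s phi u].  Precomposing the
    first map with S = id + s t Z + ..., a composition of shears whose Jacobian J adjusts the masses,
    gives a coupling, hence an upper bound for HK^2.  A lower bound is Kantorovich duality on the
    cone: weights a0, a1 with cos d(x, y) <= a0 x a1 y are e^{-f} and e^{f^c}, where f^c is a
    conjugate of f for the quartic Taylor polynomial of - ln cos.  If chi and Z satisfy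
    Z + grad chi = (Hess phi grad psi - Hess psi grad phi) / 2 and div Z = - 4 chi, then f can be
    taken to be a polynomial in (s, t) for which the two bounds differ by O((s + t)^5); only
    first-order optimality up to O((s + t)^3) is needed, since its defect enters the gap squared.
    Expanding the cost of the coupling to order four and dropping divergences gives
      Sec_up = - (1 / Lambda) E(|grad phi|^2 |grad psi|^2 - <grad phi, grad psi>^2),
      Sec_nabla = (3 / Lambda) E(|Z|^2 + 4 chi^2).
    For the Fourier basis the equation for chi is diagonal in the frequencies k^sigma + l^tau,
    which genericity makes nonzero and pairwise distinct, so that Parseval's identity evaluates
    both means. *)

From HB Require Import structures.
Require Import Defs.
From mathcomp Require Import all_boot all_order all_algebra.
From mathcomp Require Import all_classical all_reals all_analysis measurable_realfun.
From mathcomp Require Import ring lra zify.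
Set Implicit Arguments.
Unset Strict Implicit.
Unset Printing Implicit Defensive.
Import Order.TTheory GRing.Theory Num.Theory.
Import numFieldNormedType.Exports.
Local Open Scope classical_set_scope.
Local Open Scope quotient_scope.
Local Open Scope ring_scope.

(** * Real inequalities *)

(** A plan must have exactly the prescribed marginals, while the optimal one is needed only to
    finite order. Shears along the coordinates meet both needs: each transports the weighted uniform
    measure exactly, by a substitution in one variable, and a composition of n of them agrees with
    id + s t Z up to O((s t)^2). An error of order four in the map or in the mass is multiplied in
    the cost by a quantity of order one, such as s phi - t psi or its gradient, so that it costs
    only order five; and a bounded ratio of s and t makes (s + t)^5 negligible against s^2 t^2.

    The system for chi and Z expresses the two cases of equality in the duality. Equality in the
    constraint makes the gradient of the potential opposite to the displacement: its s t coefficient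
    is the equation for Z + grad chi, where - chi is what remains free in the s t coefficient of the
    potential. Equality in 2 a b <= a^2 + b^2 makes the radii weighted by a0 and a1 agree at coupled
    points: the s t coefficient of this balance is div Z = - 4 chi. *)

Section RealInequalities.
Context {R : realType}.
Implicit Types x y : R.

Lemma is_derive_addf (f g : R -> R) x (df dg : R) :
  is_derive x 1 f df -> is_derive x 1 g dg ->
  is_derive x 1 (fun y => f y + g y) (df + dg).
Proof. by move=> ? ?; exact: is_deriveD. Qed.

Lemma is_derive_scalef (f : R -> R) x (c df : R) :
  is_derive x 1 f df -> is_derive x 1 (fun y => c * f y) (c * df).
Proof. by move=> ?; exact: is_deriveZ. Qed.

Lemma is_derive_mulf (f g : R -> R) x (df dg : R) :
  is_derive x 1 f df -> is_derive x 1 g dg ->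
  is_derive x 1 (fun y => f y * g y) (df * g x + f x * dg).
Proof.
move=> ? ?; have H := @is_deriveM _ _ f g x 1 df dg _ _.
by apply: is_derive_eq; rewrite /GRing.scale/=; ring.
Qed.

Lemma is_derive_powf n x : is_derive x 1 (fun y : R => y ^+ n) (n%:R * x ^+ n.-1).
Proof.
have H := @is_deriveX _ _ (@id R) n x 1 1 _.
have -> : (fun y : R => y ^+ n) = (@id R) ^+ n by rewrite exprfctE.
by apply: is_derive_eq; rewrite /GRing.scale /= mulr1.
Qed.

Lemma is_derive_compf (f g : R -> R) x (df dg : R) :
  is_derive (g x) 1 f df -> is_derive x 1 g dg ->
  is_derive x 1 (fun y => f (g y)) (df * dg).
Proof. by move=> ? ?; apply: is_derive1_comp. Qed.

Ltac der_tac := repeat first [ apply: is_derive_addf | apply: is_derive_scalef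
  | exact: is_derive_powf | exact: is_derive_cst ].

Lemma is_derive_continuous (f : R -> R) x (df : R) :
  is_derive x 1 f df -> {for x, continuous f}.
Proof. by case=> df_ _; apply: differentiable_continuous; apply/derivable1_diffP. Qed.

Lemma is_derive_continuousT (f df : R -> R) :
  (forall x, is_derive x 1 f (df x)) -> continuous f.
Proof. by move=> fdf x; exact: is_derive_continuous (fdf x). Qed.

Lemma derive_ge0_ge0 (f df : R -> R) : (forall x, is_derive x 1 f (df x)) ->
  0 <= f 0 -> (forall x, 0 <= x -> 0 <= df x) -> forall x, 0 <= x -> 0 <= f x.
Proof.
move=> fdf f0 df0 x x0.
have [|c] := @MVT_segment R f df 0 x x0 (fun y _ => fdf y).
  exact/continuous_subspaceT/(is_derive_continuousT fdf).
rewrite in_itv/= => /andP[c0 _] fE.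
by rewrite -(subrK (f 0) (f x)) fE addr_ge0// subr0 mulr_ge0// df0.
Qed.

Lemma derive_dist_le (f df : R -> R) (C : R) : (forall x, is_derive x 1 f (df x)) ->
  (forall x, `|df x| <= C) -> forall x y, `|f x - f y| <= C * `|x - y|.
Proof.
move=> fdf dfC x y; wlog xy : x y / y <= x => [H|].
  by case/orP: (le_total x y) => [/H|/H//]; rewrite distrC [`|y - x|]distrC.
have [|c _ ->] := @MVT_segment R f df y x xy (fun z _ => fdf z).
  exact/continuous_subspaceT/(is_derive_continuousT fdf).
by rewrite normrM ler_wpM2r.
Qed.

(** The alternating Taylor bounds form a ladder that starts from cos <= 1: differentiating the bound
    of degree d gives the one of degree d - 1, so that [derive_ge0_ge0] climbs by one degree each
    time, up to [cos_ge6]. *)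
Lemma sin_le x : 0 <= x -> sin x <= x.
Proof.
move=> x0; rewrite -subr_ge0.
have := @derive_ge0_ge0 (fun x => x + -1 * sin x) (fun x => 1 + -1 * cos x) _ _ _ x x0.
rewrite /= ?sin0 => H; apply: le_trans (H _ _ _) _; [lra| |lra].
- by move=> z _; have := cos_le1 z; lra.
Qed.

Lemma cos_ge2 x : 1 - x ^+ 2 / 2 <= cos x.
Proof.
wlog x0 : x / 0 <= x => [H|].
  by case/orP: (le_total 0 x) => [/H//|?]; rewrite -cosN -sqrrN; apply: H; rewrite oppr_ge0.
rewrite -subr_ge0.
have := @derive_ge0_ge0 (fun x => (cos x + 2^-1 * x ^+ 2) + -1) (fun x => (- sin x + 2^-1 * (2 * x ^+ 1)) + 0) _ _ _ x x0.
rewrite /= ?cos0 => H; apply: le_trans (H _ _ _) _; [|lra| |lra].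
- move=> z; apply: is_derive_addf; apply: is_derive_addf => //; apply: is_derive_scalef.
  exact: is_derive_powf.
- by move=> z /sin_le; rewrite expr1; lra.
Qed.

Lemma sin_ge3 x : 0 <= x -> x - x ^+ 3 / 6 <= sin x.
Proof.
move=> x0; rewrite -subr_ge0.
have := @derive_ge0_ge0 (fun x => (sin x + 6^-1 * x ^+ 3) + -1 * x) (fun x => (cos x + 6^-1 * (3 * x ^+ 2)) + -1 * 1) _ _ _ x x0.
rewrite /= ?sin0 => H; apply: le_trans (H _ _ _) _; [|lra| |lra].
- move=> z; do 2! [apply: is_derive_addf => //; try apply: is_derive_scalef].
  exact: is_derive_powf.
- by move=> z _; have := cos_ge2 z; lra.
Qed.

Lemma cos_le4 x : cos x <= 1 - x ^+ 2 / 2 + x ^+ 4 / 24.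
Proof.
wlog x0 : x / 0 <= x => [H|].
  case/orP: (le_total 0 x) => [/H//|x0]; have := H (- x); rewrite cosN.
  have -> : (- x) ^+ 2 = x ^+ 2 by ring.
  have -> : (- x) ^+ 4 = x ^+ 4 by ring.
  by apply; rewrite oppr_ge0.
rewrite -subr_ge0.
have := @derive_ge0_ge0 (fun x => (24^-1 * x ^+ 4 + - 2^-1 * x ^+ 2) + (1 + -1 * cos x)) (fun x => (24^-1 * (4 * x ^+ 3) + - 2^-1 * (2 * x ^+ 1)) + (0 + -1 * - sin x)) _ _ _ x x0.
rewrite /= ?cos0 => H; apply: le_trans (H _ _ _) _; [|lra| |lra].
- move=> z; apply: is_derive_addf; apply: is_derive_addf => //; apply: is_derive_scalef; exact: is_derive_powf.
- by move=> z /sin_ge3; rewrite expr1; lra.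
Qed.

Lemma sin_le5 x : 0 <= x -> sin x <= x - x ^+ 3 / 6 + x ^+ 5 / 120.
Proof.
move=> x0; rewrite -subr_ge0.
have := @derive_ge0_ge0 (fun x => (120^-1 * x ^+ 5 + - 6^-1 * x ^+ 3) + (x + -1 * sin x)) (fun x => (120^-1 * (5 * x ^+ 4) + - 6^-1 * (3 * x ^+ 2)) + (1 + -1 * cos x)) _ _ _ x x0.
rewrite /= ?sin0 => H; apply: le_trans (H _ _ _) _; [|lra| |lra].
- move=> z; apply: is_derive_addf; apply: is_derive_addf => //; apply: is_derive_scalef; exact: is_derive_powf.
- by move=> z _; have := cos_le4 z; lra.
Qed.

Lemma cos_ge6 x : 1 - x ^+ 2 / 2 + x ^+ 4 / 24 - x ^+ 6 / 720 <= cos x.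
Proof.
wlog x0 : x / 0 <= x => [H|].
  case/orP: (le_total 0 x) => [/H//|x0]; have := H (- x); rewrite cosN.
  have -> : (- x) ^+ 2 = x ^+ 2 by ring.
  have -> : (- x) ^+ 4 = x ^+ 4 by ring.
  have -> : (- x) ^+ 6 = x ^+ 6 by ring.
  by apply; rewrite oppr_ge0.
rewrite -subr_ge0.
have := @derive_ge0_ge0 (fun x => (- 24^-1 * x ^+ 4 + 2^-1 * x ^+ 2) + ((-1 + 720^-1 * x ^+ 6) + cos x)) (fun x => (- 24^-1 * (4 * x ^+ 3) + 2^-1 * (2 * x ^+ 1)) + ((0 + 720^-1 * (6 * x ^+ 5)) + - sin x)) _ _ _ x x0.
rewrite /= ?cos0 => H; apply: le_trans (H _ _ _) _; [|lra| |lra].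
- by move=> z; der_tac.
- by move=> z /sin_le5; rewrite expr1; lra.
Qed.

Lemma cos_taylor6 x : `|cos x - (1 - x ^+ 2 / 2 + x ^+ 4 / 24)| <= x ^+ 6.
Proof.
have := cos_ge6 x; have := cos_le4 x; have : 0 <= x ^+ 6 by rewrite -[6%N]/(2 * 3)%N exprM exprn_ge0 ?sqr_ge0.
by move=> h0 h1 h2; rewrite ler_norml; apply/andP; split; lra.
Qed.

Lemma sin_taylor5 x : 0 <= x -> `|sin x - (x - x ^+ 3 / 6)| <= x ^+ 5.
Proof.
move=> x0; have := sin_ge3 x0; have := sin_le5 x0; have : 0 <= x ^+ 5 by rewrite exprn_ge0.
by move=> h0 h1 h2; rewrite ler_norml; apply/andP; split; lra.
Qed.

Lemma cosD_taylor2 x h : `|cos (x + h) - cos x + h * sin x| <= h ^+ 2.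
Proof.
have -> : cos (x + h) - cos x + h * sin x = cos x * (cos h - 1) + sin x * (h - sin h).
  by rewrite cosD; ring.
have h1 : `|cos h - 1| <= h ^+ 2 / 2.
  have := cos_ge2 h; have := cos_le1 h; have := sqr_ge0 h.
  by move=> ? ? ?; rewrite ler_norml; apply/andP; split; lra.
have h2 : `|h - sin h| <= h ^+ 2 / 2.
  wlog h0 : h {h1} / 0 <= h => [H|].
    case/orP: (le_total 0 h) => [/H//|h0]; rewrite -normrN opprB -sqrrN.
    by rewrite (_ : sin h - h = - h - sin (- h)) ?H ?oppr_ge0// sinN; ring.
  have := sin_le h0 => h3; rewrite ger0_norm; last lra.
  (* The cubic bound h - sin h <= h^3 / 6 is below h^2 / 2 only up to h = 3; from there on, sin h >=
     -1 is enough. *)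
  have := sin_ge3 h0; case: (lerP h 3) => [h4 h5|h4 _].
    have : h ^+ 3 <= h ^+ 2 * 3 by rewrite exprSr ler_wpM2l// sqr_ge0.
    lra.
  have := sin_geN1 h; have : h * 3 <= h ^+ 2 by rewrite expr2 ler_wpM2l// ltW.
  lra.
apply: le_trans (ler_normD _ _) _; rewrite !normrM.
have : `|cos x| * `|cos h - 1| <= 1 * (h ^+ 2 / 2) by rewrite ler_pM ?cos_max.
have : `|sin x| * `|h - sin h| <= 1 * (h ^+ 2 / 2) by rewrite ler_pM ?sin_max.
by move=> h3 h4; lra.
Qed.

Lemma cos_lipschitz x y : `|cos x - cos y| <= `|x - y|.
Proof.
rewrite -[leRHS]mul1r; apply: (@derive_dist_le _ (fun z => - sin z)) => z.
by rewrite normrN sin_max.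
Qed.

Lemma atan_taylor x : 0 <= x -> 0 <= x - atan x <= x ^+ 3.
Proof.
move=> x0; have [|c] := @MVT_segment R atan (fun y => (1 + y ^+ 2)^-1) 0 x x0 (fun y _ => is_derive1_atan y).
  by apply/continuous_subspaceT => y; exact: continuous_atan.
rewrite in_itv/= atan0 !subr0 => /andP[c0 cx] ->.
have c1 : 0 < 1 + c ^+ 2 by rewrite ltr_pwDl// sqr_ge0.
have -> : x - (1 + c ^+ 2)^-1 * x = x * (c ^+ 2 / (1 + c ^+ 2)) by field; rewrite gt_eqF.
have c2 : c ^+ 2 / (1 + c ^+ 2) <= x ^+ 2.
  rewrite ler_pdivrMr//; have : c ^+ 2 <= x ^+ 2 by rewrite lerXn2r// nnegrE.
  have : 0 <= x ^+ 2 * c ^+ 2 by rewrite mulr_ge0 ?sqr_ge0.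
  lra.
rewrite mulr_ge0//=; last by rewrite divr_ge0 ?sqr_ge0// ltW.
by rewrite exprS ler_wpM2l.
Qed.

Lemma derive_pow_le (f df : R -> R) (C : R) n :
  (forall x, is_derive x 1 f (df x)) -> f 0 = 0 ->
  (forall x, `|x| <= 1 -> `|df x| <= C * `|x| ^+ n) ->
  forall x, `|x| <= 1 -> `|f x| <= C * `|x| ^+ n.+1.
Proof.
move=> fdf f0 dfC x x1.
have C0 : 0 <= C.
  have := dfC 1; rewrite normr1 expr1n mulr1 => /(_ (lexx _)).
  exact: le_trans.
have cf := continuous_subspaceT (is_derive_continuousT fdf).
suff [c cx ->] : exists2 c, `|c| <= `|x| & f x = df c * x.
  rewrite normrM exprSr mulrA ler_wpM2r//.
  apply: le_trans (dfC _ (le_trans cx x1)) _.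
  by rewrite ler_wpM2l// lerXn2r// nnegrE.
case: (lerP 0 x) => x0.
  have [//|c] := @MVT_segment R f df 0 x x0 (fun y _ => fdf y).
  rewrite in_itv/= f0 !subr0 => /andP[c0 cx] ->; exists c => //.
  by rewrite !ger0_norm.
have [//|c] := @MVT_segment R f df x 0 (ltW x0) (fun y _ => fdf y).
rewrite in_itv/= f0 !sub0r => /andP[c0 cx] fE; exists c.
  by rewrite !ler0_norm ?lerN2// ltW.
by apply: oppr_inj; rewrite fE mulrN.
Qed.

(** Three integrations of e^z <= 4 on the unit ball, without the gain of the factorials; 4 bounds e
    because e^(-1/2) >= 1 / 2. *)
Lemma expR_taylor3 x : `|x| <= 1 -> `|expR x - (1 + x + x ^+ 2 / 2)| <= 4 * `|x| ^+ 3.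
Proof.
move=> x1.
have e4 (z : R) : `|z| <= 1 -> `|expR z| <= 4 * `|z| ^+ 0.
  move=> z1; rewrite mulr1 ger0_norm ?expR_ge0//.
  have h : expR z <= expR 1 by rewrite ler_expR; exact: ler_normlW.
  apply: le_trans h _; have := expR_ge1Dx (- 2^-1 : R).
  have <- : expR (2^-1) ^+ 2 = expR 1 :> R by rewrite -expRM_natl -mulr_natl; congr expR; field.
  have e2 := expR_gt0 (2^-1 : R); rewrite expRN => h.
  have : expR 2^-1 <= 2 :> R.
    have := ler_wpM2r (ltW e2) h; rewrite mulVf ?gt_eqF//; lra.
  by move=> {}h; rewrite (_ : 4 = 2 ^+ 2); [rewrite lerXn2r// nnegrE ltW|ring].
have e3 (z : R) : `|z| <= 1 -> `|expR z + -1| <= 4 * `|z| ^+ 1.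
  apply: (@derive_pow_le (fun z => expR z + -1) expR).
  - by move=> y; apply: is_derive_eq; rewrite ?subr0.
  - by rewrite expR0; lra.
  - exact: e4.
have e5 (z : R) : `|z| <= 1 -> `|expR z + - 1 + -1 * z| <= 4 * `|z| ^+ 2.
  apply: (@derive_pow_le (fun z => expR z + -1 + -1 * z) (fun z => expR z + -1)).
  - move=> y; apply: is_derive_eq; try by der_tac.
    by rewrite /GRing.scale /=; ring.
  - by rewrite expR0; lra.
  - exact: e3.
have -> : expR x - (1 + x + x ^+ 2 / 2) = expR x + - 1 + -1 * x + - 2^-1 * x ^+ 2 by field.
apply: (@derive_pow_le (fun x => expR x + - 1 + -1 * x + - 2^-1 * x ^+ 2) (fun z => expR z + -1 + -1 * z)) x1.
- move=> y; apply: is_derive_eq; try by der_tac.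
  by rewrite /GRing.scale /= ?expr1; field.
- by rewrite expR0; lra.
- exact: e5.
Qed.

Lemma expRN_le2 x : 0 <= x -> expR (- x) <= 1 - x + x ^+ 2 / 2.
Proof.
move=> x0; rewrite -subr_ge0.
have H (z : R) : is_derive z 1 (fun x : R => expR (- x)) (expR (- z) * -1).
  by apply: (@is_derive_compf expR (fun y => - y)).
have h (z : R) : 0 <= z -> 0 <= expR (- z) + (-1 + z).
  move=> z0; have K := @derive_ge0_ge0 (fun z => expR (- z) + (-1 + z)) (fun z => expR (- z) * -1 + (0 + 1)) _ _ _ z z0.
  apply: K => [|y y0]; try by move=> y; der_tac.
    by rewrite oppr0 expR0; lra.
  by have : expR (- y) <= 1; [rewrite -expR0 ler_expR oppr_le0|lra].
have := @derive_ge0_ge0 (fun x => (2^-1 * x ^+ 2 + -1 * x) + (1 + -1 * expR (- x))) (fun x => (2^-1 * (2 * x ^+ 1) + -1 * 1) + (0 + -1 * (expR (- x) * -1))) _ _ _ x x0.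
rewrite /= ?oppr0 ?expR0 => K; apply: le_trans (K _ _ _) _; [|lra| |lra].
- by move=> z; der_tac.
- by move=> z /h; rewrite expr1; lra.
Qed.

(* [- quartic x] is the fourth-order Taylor polynomial of [ln (cos x)]. *)
Definition quartic x := x ^+ 2 / 2 + x ^+ 4 / 12.

(** In 1 - q + q^2 / 2 with q = x^2 / 2 + x^4 / 12 the terms up to degree four are 1 - x^2 / 2 + x^4
    / 24, those of cos; only degrees six and eight remain. *)
Lemma expRN_quartic_le x : expR (- quartic x) <= cos x + x ^+ 6 + x ^+ 8.
Proof.
have x4 : 0 <= x ^+ 4 by rewrite -[4%N]/(2 * 2)%N exprM sqr_ge0.
have x6 : 0 <= x ^+ 6 by rewrite -[6%N]/(2 * 3)%N exprM exprn_ge0 ?sqr_ge0.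
have x8 : 0 <= x ^+ 8 by rewrite -[8%N]/(2 * 4)%N exprM exprn_ge0 ?sqr_ge0.
have q0 : 0 <= quartic x by rewrite /quartic; have := sqr_ge0 x; lra.
apply: le_trans (expRN_le2 q0) _; have := cos_ge6 x.
have -> : quartic x ^+ 2 = x ^+ 4 / 4 + x ^+ 6 / 12 + x ^+ 8 / 144 by rewrite /quartic; field.
by rewrite /quartic; lra.
Qed.

(** The product cos x e^(quartic x) equals 1 at 0 and decreases on [0, pi / 2]: its derivative has
    the sign of (x + x^3 / 3) cos x - sin x, which is nonpositive since x + x^3 / 3 is below tan.
    Beyond pi / 2 the cosine is nonpositive. *)
Lemma cos_le_quartic x : 0 <= x <= pi -> cos x <= expR (- quartic x).
Proof.
move=> /andP[x0 xpi]; case: (lerP x (pi / 2)) => xp; last first.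
  apply: le_trans (expR_ge0 _).
  have := @cos_ge0_pihalf R (pi - x); rewrite cosB cospi sinpi mul0r addr0 mulN1r oppr_ge0.
  by apply; apply/andP; split; have := pi_gt0 R; lra.
have q (z : R) : is_derive z 1 quartic (z + z ^+ 3 / 3).
  have -> : quartic = fun x => 2^-1 * x ^+ 2 + 12^-1 * x ^+ 4.
    by apply/funext => y; rewrite /quartic; ring.
  by apply: is_derive_eq; rewrite /GRing.scale /= ?expr1; field.
rewrite expRN -[leRHS]mul1r ler_pdivlMr ?expR_gt0//.
have H (z : R) : is_derive z 1 (fun z => cos z * expR (quartic z)) (- sin z * expR (quartic z) + cos z * (expR (quartic z) * (z + z ^+ 3 / 3))).
  by apply: is_derive_mulf; apply: (@is_derive_compf expR).
have [|c] := MVT_segment x0 (fun y _ => H y).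
  exact/continuous_subspaceT/(is_derive_continuousT H).
rewrite in_itv/= => /andP[c0 cx]; rewrite cos0 /quartic !expr0n/= !mul0r addr0 expR0 mulr1 subr0 -/(quartic x).
move=> /eqP; rewrite subr_eq => /eqP ->; rewrite gerDr.
rewrite mulr_le0_ge0//.
rewrite mulrCA mulrC -mulrDr mulr_ge0_le0 ?expR_ge0//.
(* With c^2 <= 4 the term c^7 / 72 is absorbed by - c^5 / 8, which leaves c - c^3 / 6 <= sin c. *)
have c3 : c <= 2 by have /andP[_] := (@pihalf_02_cos_pihalf R).1; lra.
have h1 := sin_ge3 c0; have h2 := cos_le4 c.
have h3 : cos c * (c + c ^+ 3 / 3) <= (1 - c ^+ 2 / 2 + c ^+ 4 / 24) * (c + c ^+ 3 / 3).
  by rewrite ler_wpM2r// addr_ge0// divr_ge0// exprn_ge0.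
have : (1 - c ^+ 2 / 2 + c ^+ 4 / 24) * (c + c ^+ 3 / 3) = c - c ^+ 3 / 6 - c ^+ 5 / 8 + c ^+ 5 * c ^+ 2 / 72.
  by field.
have : c ^+ 5 * c ^+ 2 <= c ^+ 5 * 4.
  rewrite ler_wpM2l ?exprn_ge0// (_ : 4 = 2 ^+ 2); last by ring.
  by rewrite lerXn2r// nnegrE.
have : 0 <= c ^+ 5 by rewrite exprn_ge0.
by lra.
Qed.

End RealInequalities.

(** * Torus and cone geometry *)

Section TorusGeometry.
Context {R : realType} {n : nat}.
Implicit Types (u v w : 'rV[R]_n) (x y : torus R n).

Lemma dot_ge0 u : 0 <= dot u u.
Proof. by apply: sumr_ge0 => p _; rewrite -expr2 sqr_ge0. Qed.

Lemma enorm_ge0 u : 0 <= enorm u.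
Proof. exact: sqrtr_ge0. Qed.

Lemma sqr_enorm u : enorm u ^+ 2 = \sum_p u 0 p ^+ 2.
Proof. by rewrite sqr_sqrtr ?dot_ge0//; apply: eq_bigr => p _; rewrite expr2. Qed.

Lemma ler_enorm u v : (forall p, `|u 0 p| <= `|v 0 p|) -> enorm u <= enorm v.
Proof.
move=> uv; apply: ler_wsqrtr; apply: ler_sum => p _.
by rewrite -!expr2 -[leLHS]real_normK ?num_real// -[leRHS]real_normK ?num_real// lerXn2r ?nnegrE.
Qed.

Lemma enormN u : enorm (- u) = enorm u.
Proof. by congr Num.sqrt; apply: eq_bigr => p _; rewrite !mxE mulrNN. Qed.

Lemma coord_le_enorm u p : `|u 0 p| <= enorm u.
Proof.
rewrite -sqrtr_sqr; apply: ler_wsqrtr; rewrite /dot (bigD1 p)//= -expr2 lerDl.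
by apply: sumr_ge0 => q _; rewrite -expr2 sqr_ge0.
Qed.

Lemma torus_piP u v :
  torus_pi u = torus_pi v <-> exists z : 'rV[int]_n, u - v = (2 * pi) *: map_mx intr z.
Proof.
split=> [/eqmodP/asboolP//|uv]; apply/eqmodP; exact/asboolP.
Qed.

Lemma torus_reprK x : torus_pi (torus_repr x) = x.
Proof. exact: reprK. Qed.

Lemma torus_pi_surj x : exists u, torus_pi u = x.
Proof. by exists (torus_repr x); rewrite torus_reprK. Qed.

Lemma torus_pi_shift u (z : 'rV[int]_n) : torus_pi (u + (2 * pi) *: map_mx intr z) = torus_pi u.
Proof. by apply/torus_piP; exists z; rewrite addrAC subrr add0r. Qed.

Lemma torus_repr_pi u :
  exists z : 'rV[int]_n, torus_repr (torus_pi u) = u + (2 * pi) *: map_mx intr z.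
Proof.
have /torus_piP[z zE] := torus_reprK (torus_pi u).
by exists z; rewrite -zE addrC subrK.
Qed.

Lemma normr_le_shift (a : R) (z : int) : `|a| <= pi -> `|a| <= `|a + 2 * pi * z%:~R|.
Proof.
move=> api; have [->|z0] := eqVneq z 0; first by rewrite mulr0 addr0.
have : 2 * pi <= `|2 * pi * z%:~R| :> R.
  rewrite normrM (gtr0_norm (twopi_gt0 R)) ler_peMr ?(ltW (twopi_gt0 R))//.
  by rewrite -intr_norm ler1z; lia.
have := ler_normB (a + 2 * pi * z%:~R) a.
have -> : a + 2 * pi * z%:~R - a = 2 * pi * z%:~R by ring.
by move=> h1 h2; lra.
Qed.

Lemma torus_dist_set_lb u v (d : R) :
  (forall z : 'rV[int]_n, d <= enorm (u - v + (2 * pi) *: map_mx intr z)) ->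
  lbound [set enorm (uv.1 - uv.2) | uv in
        [set uv : 'rV[R]_n * 'rV[R]_n |
          torus_class uv.1 = torus_pi u /\ torus_class uv.2 = torus_pi v]] d.
Proof.
move=> H _ [[u' v'] /= [/torus_piP[z1 uz] /torus_piP[z2 vz]] <-].
have -> : u' - v' = u - v + (2 * pi) *: map_mx intr (z1 - z2).
  rewrite map_mxB scalerBr -uz -vz.
  by apply/rowP => p; rewrite !mxE; ring.
exact: H.
Qed.

(** A difference with entries in [-pi, pi] minimises every coordinate separately over the lattice,
    hence also the norm. *)
Lemma torus_dist_pi u v : (forall p, `|(u - v) 0 p| <= pi) ->
  torus_dist (torus_pi u) (torus_pi v) = enorm (u - v).
Proof.
move=> uv; apply/le_anti/andP; split; first exact: torus_dist_le.
apply: lb_le_inf; first by exists (enorm (u - v)); exists (u, v).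
apply: torus_dist_set_lb => z; apply: ler_enorm => p.
by have := normr_le_shift (z 0 p) (uv p); rewrite !mxE.
Qed.

Lemma torus_dist_ge0 x y : 0 <= torus_dist x y.
Proof.
have [u <-] := torus_pi_surj x; have [v <-] := torus_pi_surj y.
apply: lb_le_inf; first by exists (enorm (u - v)); exists (u, v).
by apply: torus_dist_set_lb => z; exact: enorm_ge0.
Qed.

Lemma torus_nearest_lift u v : exists z : 'rV[int]_n,
  forall p, `|(u + (2 * pi) *: map_mx intr z - v) 0 p| <= pi.
Proof.
pose d p := (u - v) 0 p.
exists (\row_p (- Num.floor ((d p + pi) / (2 * pi)))) => p.
rewrite !mxE/=; have := floor_itv ((d p + pi) / (2 * pi)).
set z := Num.floor _; rewrite rmorphN rmorphD/=.
have pi2 := twopi_gt0 R.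
rewrite ler_pdivlMr// ltr_pdivrMr// /d !mxE => /andP[h1 h2].
by rewrite ler_norml; apply/andP; split; lra.
Qed.

Lemma torus_dist_lift u y (e : R) : torus_dist (torus_pi u) y < e ->
  exists2 v, torus_pi v = y & enorm (v - u) < e.
Proof.
have [v <-] := torus_pi_surj y; have [z vz] := torus_nearest_lift v u.
have := torus_dist_pi vz; rewrite torus_pi_shift => vuE duv.
exists (v + (2 * pi) *: map_mx intr z); first exact: torus_pi_shift.
rewrite -enormN opprB -torus_dist_pi ?torus_pi_shift// => p.
by rewrite -opprB mxE normrN.
Qed.

Lemma torus_dist_sym x y : torus_dist x y = torus_dist y x.
Proof.
have [u <-] := torus_pi_surj x; have [v <-] := torus_pi_surj y.
have [z vz] := torus_nearest_lift v u.
have E : torus_dist (torus_pi u) (torus_pi (v + (2 * pi) *: map_mx intr z)) =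
    enorm (u - (v + (2 * pi) *: map_mx intr z)).
  by apply: torus_dist_pi => p; rewrite -opprB mxE normrN.
by rewrite -(torus_pi_shift v z) (torus_dist_pi vz) E -enormN opprB.
Qed.

Lemma torus_dist_lift_attained u y :
  exists v, [/\ torus_pi v = y, torus_dist (torus_pi u) y = enorm (v - u) &
    forall p, `|(v - u) 0 p| <= pi].
Proof.
have [v <-] := torus_pi_surj y; have [z vz] := torus_nearest_lift v u.
exists (v + (2 * pi) *: map_mx intr z); split => //; first exact: torus_pi_shift.
by rewrite -(torus_pi_shift v z) torus_dist_sym torus_dist_pi.
Qed.

Lemma torus_exp_pi u w : torus_exp (torus_pi u) w = torus_pi (u + w).
Proof.
rewrite /torus_exp; have [z ->] := torus_repr_pi u.
by rewrite addrAC torus_pi_shift.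
Qed.

End TorusGeometry.

(** * Geometry of the cone *)

Section ConeGeometry.
Context {R : realType} {n : nat}.
Implicit Types (x y : torus R n) (c : cone R n) (r : {nonneg R}).

Lemma cone_piK c : cone_pi (cone_base c) (repr (c : {eq_quot (@cone_equiv R n)})).2 = c.
Proof.
rewrite /cone_pi /cone_base -[RHS](@reprK _ (cone_carrier R n) c).
by case: (repr _).
Qed.

Lemma cone_pi_surj c : exists x r, cone_pi x r = c.
Proof. by exists (cone_base c), (repr (c : {eq_quot (@cone_equiv R n)})).2; exact: cone_piK. Qed.

Lemma cone_repr_pi x r :
  let p := repr (cone_pi x r : {eq_quot (@cone_equiv R n)}) in
  p = (x, r) \/ p.2%:num = 0 /\ r%:num = 0.
Proof.
move=> p; have /eqmodP/= : \pi_({eq_quot (@cone_equiv R n)}) p = cone_pi x r.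
  exact: (@reprK _ (cone_carrier R n)).
by rewrite /cone_rel => /orP[/eqP->|/andP[/eqP ? /eqP ?]]; [left|right].
Qed.

Lemma cone_rad_pi x r : cone_rad (cone_pi x r) = r%:num.
Proof. by rewrite /cone_rad; have [->|[-> ->]] := cone_repr_pi x r. Qed.

Lemma cone_base_pi x r : 0 < r%:num -> cone_base (cone_pi x r) = x.
Proof.
by rewrite /cone_base; have [->|[_ ->]] := cone_repr_pi x r => //; rewrite ltxx.
Qed.

Lemma cone_rad_ge0 c : 0 <= cone_rad c.
Proof. by rewrite /cone_rad. Qed.

Definition cone_cost (x y : torus R n) (r r' : R) : R :=
  r ^+ 2 + r' ^+ 2 - 2 * r * r' * cos (Num.min (torus_dist x y) pi).

Lemma cone_costE x y (r r' : R) : cone_cost x y r r' =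
  (r - r') ^+ 2 + 2 * r * r' * (1 - cos (Num.min (torus_dist x y) pi)).
Proof. by rewrite /cone_cost; ring. Qed.

Lemma cone_cost_ge_sqr x y (r r' : R) : 0 <= r -> 0 <= r' -> (r - r') ^+ 2 <= cone_cost x y r r'.
Proof.
by move=> r0 r'0; rewrite cone_costE lerDl !mulr_ge0// subr_ge0 cos_le1.
Qed.

Lemma cone_dist_sqr c c' : cone_dist c c' ^+ 2 =
  cone_cost (cone_base c) (cone_base c') (cone_rad c) (cone_rad c').
Proof.
rewrite sqr_sqrtr//; apply: le_trans (sqr_ge0 _) (cone_cost_ge_sqr _ _ _ _);
  exact: cone_rad_ge0.
Qed.

(** The base point that [repr] chooses for the apex is arbitrary, but the cost forgets it as soon as
    one radius is zero. *)
Lemma cone_cost_pi x y r r' : cone_dist (cone_pi x r) (cone_pi y r') ^+ 2 =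
  cone_cost x y r%:num r'%:num.
Proof.
rewrite cone_dist_sqr !cone_rad_pi.
have [r0|r0] := ltrP 0 r%:num; last first.
  have -> : r%:num = 0 by apply/le_anti; rewrite r0/=.
  by rewrite /cone_cost mulr0 !mul0r.
have [r'0|r'0] := ltrP 0 r'%:num; last first.
  have -> : r'%:num = 0 by apply/le_anti; rewrite r'0/=.
  by rewrite /cone_cost mulr0 !mul0r.
by rewrite !cone_base_pi.
Qed.

Lemma cone_dist_ge0 c c' : 0 <= cone_dist c c'.
Proof. exact: sqrtr_ge0. Qed.

Lemma cone_rad_lipschitz c c' : `|cone_rad c - cone_rad c'| <= cone_dist c c'.
Proof.
rewrite -[leRHS]ger0_norm ?cone_dist_ge0// -ler_sqr ?nnegrE//.
rewrite !real_normK ?num_real// cone_dist_sqr.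
by apply: cone_cost_ge_sqr; exact: cone_rad_ge0.
Qed.

(** Continuity of the base point away from the apex. A close c' has radius r' > r / 2; if the base
    points were d apart, the angular part 2 r r' (1 - cos m) of the squared distance, with m the
    minimum of d and pi, would already exceed r^2 (1 - cos m). *)
Lemma cone_dist_base c (d : R) : 0 < cone_rad c -> 0 < d ->
  exists2 e : R, 0 < e & forall c', cone_dist c c' < e ->
    0 < cone_rad c' /\ torus_dist (cone_base c) (cone_base c') < d.
Proof.
move=> r0 d0; set r := cone_rad c in r0 *.
pose m := Num.min d pi.
have m0 : 0 < m by rewrite lt_min d0 pi_gt0.
have cm : 0 < 1 - cos m.
  rewrite subr_gt0 -[ltRHS](@cos0 R) ltr_cos ?in_itv/= ?lexx ?(ltW m0) ?pi_ge0//.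
  by rewrite ge_min lexx orbT.
exists (Num.min (r / 2) (r * Num.sqrt (1 - cos m))).
  by rewrite lt_min divr_gt0//= mulr_gt0// sqrtr_gt0.
move=> c'; rewrite lt_min => /andP[h1 h2].
have h3 := le_lt_trans (cone_rad_lipschitz c c') h1.
have r'h : r / 2 < cone_rad c'.
  by move: h3; rewrite -/r ltr_norml => /andP[_]; lra.
split; first by apply: lt_trans r'h; rewrite divr_gt0.
rewrite ltNge; apply/negP => dd.
have : cone_dist c c' ^+ 2 < r ^+ 2 * (1 - cos m).
  rewrite -(sqr_sqrtr (ltW cm)) -exprMn ltr_pXn2r ?nnegrE ?cone_dist_ge0//.
  by rewrite mulr_ge0 ?(ltW r0)// sqrtr_ge0.
rewrite cone_dist_sqr cone_costE -/r; apply/negP; rewrite -leNgt.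
rewrite -[leLHS]add0r lerD ?sqr_ge0//.
have cc : 1 - cos m <= 1 - cos (Num.min (torus_dist (cone_base c) (cone_base c')) pi).
  rewrite lerD2l lerN2; set t := Num.min _ _.
  have mt : m <= t by rewrite /m /t !le_min !ge_min dd lexx !orbT.
  have [->//|mt'] := eqVneq m t.
  have tpi : t <= pi by rewrite /t ge_min lexx orbT.
  have mlt : m < t by rewrite lt_neqAle mt' mt.
  by apply/ltW; rewrite ltr_cos// in_itv/= ?tpi ?(le_trans mt) ?(ltW m0)// (le_trans (ltW m0)).
apply: ler_pM => //; rewrite ?sqr_ge0 ?(ltW cm)//.
rewrite expr2; have := ler_wpM2l (ltW r0) (ltW r'h); lra.
Qed.

Lemma cone_base_ball_open (U : set (torus R n)) : dist_open (@torus_dist R n) U ->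
  dist_open (@cone_dist R n) [set c | 0 < cone_rad c /\ U (cone_base c)].
Proof.
move=> oU c [/= r0 Uc]; have [d d0 dU] := oU _ Uc.
have [e e0 eP] := cone_dist_base r0 d0; exists e => // c' /eP[? ?]; split => //.
exact: dU.
Qed.

Lemma cone_dist_pi_le x y r r' (d : R) : torus_dist x y <= d ->
  cone_dist (cone_pi x r) (cone_pi y r') ^+ 2 <= (r%:num - r'%:num) ^+ 2 + r%:num * r'%:num * d ^+ 2.
Proof.
move=> xyd; rewrite cone_cost_pi cone_costE lerD2l.
set m := Num.min _ _.
have m0 : 0 <= m by rewrite le_min torus_dist_ge0 pi_ge0.
have md : m <= d by rewrite ge_min xyd.
have := cos_ge2 m; have : m ^+ 2 <= d ^+ 2 by rewrite lerXn2r ?nnegrE// (le_trans m0).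
move=> h1 h2; rewrite (_ : 2 * _ * _ * _ = r%:num * r'%:num * (2 * (1 - cos m))); last by ring.
by apply: ler_wpM2l; [exact: mulr_ge0|lra].
Qed.

End ConeGeometry.

(** * Measures with a density and image measures *)

Section Density.
Local Open Scope ereal_scope.
Context {R : realType} d (T : measurableType d) (mu : {measure set T -> \bar R}).
Variables (w : T -> R) (mw : measurable_fun setT w) (w0 : forall x, (0 <= w x)%R).

Definition density_measure of measurable_fun setT w & (forall x, (0 <= w x)%R) :=
  fun A : set T => \int[mu]_(x in A) (w x)%:E.
Local Notation nu := (density_measure mw w0).

Let density0 : nu set0 = 0. Proof. by rewrite /density_measure integral_set0. Qed.

Let density_ge0 A : 0 <= nu A.
Proof. by apply: integral_ge0 => x _; rewrite lee_fin. Qed.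

Let density_sigma_additive : semi_sigma_additive nu.
Proof.
move=> /= F mF tF mUF; rewrite /density_measure; apply: cvg_toP.
  apply: ereal_nondecreasing_is_cvgn => m n mn.
  apply: lee_sum_nneg_natr => // k _ _.
  by apply: integral_ge0 => /= x Fkx; rewrite lee_fin.
rewrite ge0_integral_bigcup//=.
  by apply/measurable_EFinP; exact: measurable_funTS.
by move=> x _; rewrite lee_fin.
Qed.

HB.instance Definition _ := isMeasure.Build _ _ _ nu
  density0 density_ge0 density_sigma_additive.

Import HBNNSimple.

Lemma integral_density (f : T -> \bar R) : measurable_fun setT f ->
  (forall x, 0 <= f x) -> \int[nu]_x f x = \int[mu]_x ((w x)%:E * f x).
Proof.
move=> mf f0.
have mwE : measurable_fun setT (EFin \o w) by exact: measurableT_comp.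
pose f_ := nnsfun_approx measurableT mf.
transitivity (limn (fun n => \int[nu]_x (f_ n x)%:E)).
  rewrite -monotone_convergence//.
  - by apply: eq_integral => y /[!inE] yD; apply/esym/cvg_lim => //; exact: cvg_nnsfun_approx.
  - by move=> n; exact/measurable_EFinP/measurable_funP.
  - by move=> n y _; rewrite lee_fin.
  - by move=> y _ m n mn; rewrite lee_fin; exact/lefP/nd_nnsfun_approx.
rewrite [X in limn X](_ : _ = fun n => \int[mu]_x ((w x)%:E * (f_ n x)%:E)).
  rewrite -monotone_convergence//; last 3 first.
    - by move=> n /=; apply: emeasurable_funM => //; exact/measurable_EFinP/measurable_funP.
    - by move=> n x _ /=; rewrite mule_ge0// lee_fin.
    - move=> x _ m n mn; rewrite lee_wpmul2l ?lee_fin//; exact/lefP/nd_nnsfun_approx.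
  apply: eq_integral => x /[!inE] _ /=; apply/cvg_lim => //.
  by apply: cvgeZl => //; exact: cvg_nnsfun_approx.
apply/funext => n.
transitivity (\sum_(k \in range (f_ n))
    \int[mu]_x ((w x)%:E * (k * \1_(f_ n @^-1` [set k]) x)%:E)).
  under eq_integral do rewrite fimfunE -fsumEFin//.
  rewrite ge0_integral_fsum//; last 2 first.
  - by move=> y; exact/measurable_EFinP/measurable_funM.
  - by move=> y x _; rewrite nnfun_muleindic_ge0.
  apply: eq_fsbigr => r; rewrite inE => -[t _ rE].
  have r0 : (0 <= r)%R by rewrite -rE.
  rewrite integralZl_indic_nnsfun// integral_indic//= setIT /density_measure integral_mkcond.
  rewrite -ge0_integralZl_EFin//; last 2 first.
  - by move=> x _; rewrite patchE; case: ifP => _; rewrite ?lee_fin.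
  - by apply/(measurable_restrictT _ _).1 => //; exact: measurable_funTS.
  apply: eq_integral => x _; rewrite patchE indicE; case: (x \in _) => /=.
    by rewrite mulr1 muleC.
  by rewrite mulr0 !mule0.
rewrite -ge0_integral_fsum//.
- apply: eq_integral => x _; rewrite fimfunE -fsumEFin// ge0_mule_fsumr//.
  by move=> r; rewrite nnfun_muleindic_ge0.
- move=> r; apply: emeasurable_funM => //; exact/measurable_EFinP/measurable_funM.
- by move=> r x _; rewrite mule_ge0 ?lee_fin// -lee_fin nnfun_muleindic_ge0.
Qed.

End Density.

Section ImageMeasure.
Context {R : realType} d d' (T : measurableType d) (T' : measurableType d').
Variables (m : {measure set T -> \bar R}) (f : T -> T').

Definition image_measure (mf : measurable_fun setT f) : {measure set T' -> \bar R} :=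
  measure_function_pushforward__canonical__measure_function_Measure m mf.

Lemma integral_image_measure (mf : measurable_fun setT f) (g : T' -> \bar R) :
  measurable_fun setT g -> (forall y, 0 <= g y)%E ->
  (\int[image_measure mf]_y g y = \int[m]_x g (f x))%E.
Proof. by move=> mg g0; rewrite -[LHS]/(\int[pushforward m f]_y g y)%E ge0_integral_pushforward. Qed.
End ImageMeasure.

Section WeightedTransfer.
Local Open Scope ereal_scope.
Context {R : realType} {d1 d2 d} {T1 : measurableType d1} {T2 : measurableType d2}
  {U : measurableType d}.

(** The hypothesis on sets says that the measures of densities [w1] and [w2] have the same image
    under [X1] and [X2], so that they give the same integrals. *)
Lemma weighted_transfer (mu1 : {measure set T1 -> \bar R}) (mu2 : {measure set T2 -> \bar R})
    (w1 : T1 -> R) (w2 : T2 -> R) (X1 : T1 -> U) (X2 : T2 -> U) :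
  measurable_fun setT w1 -> measurable_fun setT w2 ->
  (forall x, (0 <= w1 x)%R) -> (forall x, (0 <= w2 x)%R) ->
  measurable_fun setT X1 -> measurable_fun setT X2 ->
  (forall A, measurable A -> \int[mu1]_x (w1 x * \1_A (X1 x))%:E =
                             \int[mu2]_x (w2 x * \1_A (X2 x))%:E) ->
  forall f : U -> \bar R, measurable_fun setT f -> (forall y, 0 <= f y) ->
  \int[mu1]_x ((w1 x)%:E * f (X1 x)) = \int[mu2]_x ((w2 x)%:E * f (X2 x)).
Proof.
move=> mw1 mw2 w10 w20 mX1 mX2 H f mf f0.
rewrite -(integral_density mu1 mw1 w10)//; last exact: measurableT_comp.
rewrite -(integral_density mu2 mw2 w20)//; last exact: measurableT_comp.
rewrite -[LHS](@ge0_integral_pushforward _ _ _ _ _ X1 mX1 _ setT f)//.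
rewrite -[RHS](@ge0_integral_pushforward _ _ _ _ _ X2 mX2 _ setT f)//.
apply: eq_measure_integral => A mA _.
have E d' (T : measurableType d') (mu : {measure set T -> \bar R}) (w : T -> R)
    (mw : measurable_fun setT w) w0 (X : T -> U) :
    density_measure mu mw w0 (X @^-1` A) = \int[mu]_x (w x * \1_A (X x))%:E.
  rewrite /density_measure integral_mkcond; apply: eq_integral => x _.
  rewrite patchE indicE; have -> : (x \in X @^-1` A) = (X x \in A) by [].
  by case: (X x \in A); rewrite ?mulr1 ?mulr0.
transitivity (density_measure mu1 mw1 w10 (X1 @^-1` A)); first by [].
by rewrite E H// -(E _ _ _ _ mw2 w20).
Qed.

End WeightedTransfer.

(** * Change of variables for shears, on the line and on the box *)

Section Shear1.
Context {R : realType}.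
Variables (a a' : R -> R) (K : R).
Hypotheses (da : forall y : R, is_derive y 1 a (a' y)) (ca' : continuous a')
  (a'1 : forall y, `|a' y| < 1) (aK : forall y, `|a y| <= K).
Local Notation lambda := (@lebesgue_measure R).

Let F y := y + a y.

Let dF (y : R) : is_derive y 1 F (1 + a' y).
Proof. exact: is_derive_addf. Qed.

Let F'gt0 y : 0 < 1 + a' y.
Proof. by have := a'1 y; rewrite ltr_norml => /andP[? _]; lra. Qed.

Let cF : continuous F.
Proof. exact: is_derive_continuousT dF. Qed.

Let cF' : continuous (fun y => 1 + a' y).
Proof. by move=> y; apply: cvgD; [exact: cvg_cst|exact: ca']. Qed.

Lemma shear1_lt x y : x < y -> F x < F y.
Proof.
move=> xy; have [|c cxy] := @MVT R F (fun y => 1 + a' y) x y xy (fun z _ => dF z).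
  exact: continuous_subspaceT.
by rewrite -subr_gt0 => ->; rewrite mulr_gt0// subr_gt0.
Qed.

Lemma shear1_le_mono : {mono F : x y / x <= y}.
Proof. by apply: le_mono => x y; exact: shear1_lt. Qed.

Lemma shear1_surj y : exists x, F x = y.
Proof.
have K0 : 0 <= K by exact: le_trans (aK 0).
have h : y - K <= y + K by lra.
have [||x _ xy] := @IVT R F (y - K) (y + K) y h; last by exists x.
  exact: continuous_subspaceT.
have := aK (y - K); have := aK (y + K); rewrite !ler_norml => /andP[h1 h2] /andP[h3 h4].
by rewrite ge_min le_max /F; apply/andP; split; apply/orP; [left|right]; lra.
Qed.

Let mF' : measurable_fun setT (fun y => 1 + a' y).
Proof. exact: continuous_measurable_fun. Qed.

Let mF : measurable_fun setT (F : measurableTypeR R -> measurableTypeR R).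
Proof. exact: continuous_measurable_fun. Qed.

Lemma integral_shear1_deriv x y : x < y ->
  (\int[lambda]_(z in `]x, y]) (1 + a' z)%:E = (F y - F x)%:E)%E.
Proof.
move=> xy; rewrite integral_itv_obnd_cbnd; last first.
  by apply/measurable_EFinP; exact: measurable_funTS.
rewrite (@continuous_FTC2 _ (fun z => 1 + a' z) F)// ?EFinB//.
- exact: continuous_subspaceT.
- split=> [z _||]; first by case: (dF z).
    by apply: cvg_at_right_filter; exact: cF.
  by apply: cvg_at_left_filter; exact: cF.
- by move=> z _; rewrite derive1E; case: (dF z).
Qed.

(** The image under F of the measure of density 1 + a' gives each interval its length, by the
    fundamental theorem of calculus, and Lebesgue measure is determined by its values on
    intervals. *)
Lemma integral_shear1 (f : R -> \bar R) : measurable_fun setT f -> (forall x, 0 <= f x)%E ->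
  (\int[lambda]_y ((1 + a' y)%:E * f (F y)) = \int[lambda]_y f y)%E.
Proof.
move=> mf f0.
have F'0 y : 0 <= 1 + a' y by exact/ltW.
pose nu := image_measure (density_measure lambda mF' F'0) mF.
have nuE A : measurable A -> lambda A = nu A.
  apply: (@lebesgue_measure_unique _ (image_measure (density_measure lambda mF' F'0) mF)) => _ [[c d] _ <-] /=.
  rewrite lebesgue_measure_itv/= lte_fin.
  have [c' c'E] := shear1_surj c; have [d' d'E] := shear1_surj d.
  rewrite -c'E -d'E /pushforward.
  have -> : F @^-1` `]F c', F d'] = `]c', d']%classic.
    by apply/seteqP; split => z /=; rewrite !in_itv/= !(leW_mono shear1_le_mono) shear1_le_mono.
  rewrite (leW_mono shear1_le_mono); case: ltP => cd.
    by rewrite -EFinD -integral_shear1_deriv.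
  by rewrite set_itv_ge ?measure0// bnd_simp -leNgt.
transitivity (\int[nu]_y f y)%E; last by apply: eq_measure_integral => A mA _; exact/esym/nuE.
rewrite integral_image_measure// integral_density//.
exact: measurableT_comp.
Qed.


Lemma integral_shear1_itv (f : R -> \bar R) x y :
  measurable_fun setT f -> (forall x, 0 <= f x)%E ->
  (\int[lambda]_(z in `]x, y]) ((1 + a' z)%:E * f (F z)) = \int[lambda]_(z in `]F x, F y]) f z)%E.
Proof.
move=> mf f0; rewrite integral_mkcond [RHS]integral_mkcond -[RHS]integral_shear1.
- apply: eq_integral => z _; rewrite !patchE !mem_setE !in_itv/=.
  rewrite !(leW_mono shear1_le_mono) shear1_le_mono; case: ifP => _ //.
  exact/esym/mule0.
- by apply/(measurable_restrictT _ _).1 => //; exact: measurable_funTS.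
- by move=> z; rewrite patchE; case: ifP.
Qed.

End Shear1.

Section PeriodicIntegral.
Context {R : realType} (T : R).
Local Notation lambda := (@lebesgue_measure R).
Variable f : R -> \bar R.
Hypotheses (T0 : 0 < T) (mf : measurable_fun setT f) (f0 : forall x, (0 <= f x)%E).

Lemma integral_translate (c x y : R) :
  (\int[lambda]_(z in `]x, y]) f (z + c)%R = \int[lambda]_(z in `](x + c)%R, (y + c)%R]) f z)%E.
Proof.
rewrite -(@integral_shear1_itv _ (fun=> c) (fun=> 0) `|c|)//.
- by apply: eq_integral => z _; rewrite addr0 mul1e.
- by move=> z; exact: cvg_cst.
- by move=> z; rewrite normr0.
Qed.

Hypothesis fT : forall x, f (x + T) = f x.

Lemma integral_itv_split (x y z : R) : x <= y <= z ->
  (\int[lambda]_(t in `]x, z]) f t = \int[lambda]_(t in `]x, y]) f t + \int[lambda]_(t in `]y, z]) f t)%E.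
Proof.
move=> /andP[xy yz].
have E : `]x, z]%classic = `]x, y] `|` `]y, z] by rewrite -itv_bndbnd_setU// bnd_simp.
rewrite E ge0_integral_setU//; first by rewrite -E; exact: measurable_funTS.
apply/disj_set2P/seteqP; split => t //= -[]; rewrite !in_itv/= => /andP[_ ty] /andP[yt _].
by have := lt_le_trans yt ty; rewrite ltxx.
Qed.

Let integral_period_pos c : 0 <= c <= T ->
  (\int[lambda]_(t in `]c, (c + T)%R]) f t = \int[lambda]_(t in `]0%R, T]) f t)%E.
Proof.
move=> /andP[c0 cT]; rewrite (@integral_itv_split c T); last by rewrite cT lerDr.
rewrite [RHS](@integral_itv_split 0 c) ?c0// addeC; congr (_ + _)%E.
rewrite -{1}[T]add0r -integral_translate; apply: eq_integral => z _; exact: fT.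
Qed.

(** What exceeds one end of the period is translated to the other end. The range [|c| <= T] covers
    the displacements allowed in [box_shear]. *)
Lemma integral_period c : `|c| <= T ->
  (\int[lambda]_(t in `]c, (c + T)%R]) f t = \int[lambda]_(t in `]0%R, T]) f t)%E.
Proof.
rewrite ler_norml => /andP[Tc cT]; have [c0|c0] := lerP 0 c.
  by rewrite integral_period_pos// c0.
rewrite -(@integral_period_pos (c + T)); last by lra.
by rewrite -integral_translate; apply: eq_integral => z _; rewrite fT.
Qed.

End PeriodicIntegral.

Section BoxShear.
Context {R : realType}.
Local Notation rT := (measurableTypeR R).

Definition upd n (t : n.-tuple R) (p : 'I_n) (y : R) : n.-tuple R :=
  [tuple if q == p then y else tnth t q | q < n].

Lemma updE n (t : n.-tuple R) p y q : tnth (upd t p y) q = if q == p then y else tnth t q.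
Proof. by rewrite tnth_mktuple. Qed.

Lemma upd_cons0 n x (r : n.-tuple R) y : upd [tuple of x :: r] ord0 y = [tuple of y :: r].
Proof.
apply/eq_from_tnth => q; rewrite updE; case: (unliftP ord0 q) => [j ->|->]; last by rewrite eqxx.
by rewrite -(inj_eq val_inj)/= !tnthS.
Qed.

Lemma upd_consS n x (r : n.-tuple R) p y :
  upd [tuple of x :: r] (lift ord0 p) y = [tuple of x :: upd r p y].
Proof.
apply/eq_from_tnth => q; rewrite updE; case: (unliftP ord0 q) => [j ->|->].
  by rewrite !tnthS updE (inj_eq lift_inj).
by rewrite -(inj_eq val_inj).
Qed.

Lemma integral_box_cons n (h : n.+1.-tuple rT -> \bar R) :
  measurable_fun setT h -> (forall t, 0 <= h t)%E ->
  (\int[box_volume R n.+1]_t h t =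
   \int[uniform_prob (twopi_gt0 R)]_x \int[box_volume R n]_r h [tuple of x :: r])%E.
Proof.
move=> mh h0; rewrite [LHS]ge0_integral_distribution//.
have mhc : measurable_fun setT (h \o @cons_tup R n).
  by apply: measurableT_comp => //; exact: measurable_cons_tup.
exact: fubini_tonelli1 mhc (fun _ => h0 _).
Qed.

Lemma integral_box_cons' n (h : n.+1.-tuple rT -> \bar R) :
  measurable_fun setT h -> (forall t, 0 <= h t)%E ->
  (\int[box_volume R n.+1]_t h t =
   \int[box_volume R n]_r \int[uniform_prob (twopi_gt0 R)]_x h [tuple of x :: r])%E.
Proof.
move=> mh h0; rewrite [LHS]ge0_integral_distribution//.
have mhc : measurable_fun setT (h \o @cons_tup R n).
  by apply: measurableT_comp => //; exact: measurable_cons_tup.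
exact: fubini_tonelli2 mhc (fun _ => h0 _).
Qed.

Lemma measurable_consl n (x : rT) : measurable_fun setT (fun r : n.-tuple rT => [tuple of x :: r]).
Proof. by apply: measurable_cons. Qed.

Lemma measurable_consr n (r : n.-tuple rT) : measurable_fun setT (fun x : rT => [tuple of x :: r]).
Proof. by apply: measurable_cons. Qed.

(** Fubini reduces the claim to the coordinate p: the induction freezes the first coordinate as long
    as it is not p, and integrates it innermost when it is. There the shear is an increasing
    substitution onto an interval that is again one period long, as a is periodic, and h does not
    see which period it is integrated over. *)
Lemma box_shear n (p : 'I_n) (a a' : n.-tuple rT -> R) (h : n.-tuple rT -> \bar R) :
  measurable_fun setT a -> measurable_fun setT a' -> measurable_fun setT h ->
  (forall t, 0 <= h t)%E ->
  (forall t (y : R), is_derive y 1 (fun y => a (upd t p y)) (a' (upd t p y))) ->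
  (forall t, continuous (fun y : R => a' (upd t p y))) ->
  (forall t, `|a' t| < 1) -> (forall t, `|a t| <= 2 * pi) ->
  (forall t y, a (upd t p (y + 2 * pi)) = a (upd t p y)) ->
  (forall t y, h (upd t p (y + 2 * pi)) = h (upd t p y)) ->
  (\int[box_volume R n]_t ((1 + a' t)%:E * h (upd t p (tnth t p + a t)))
   = \int[box_volume R n]_t h t)%E.
Proof.
have mupd m (q : 'I_m) (b : m.-tuple rT -> R) : measurable_fun setT b ->
    measurable_fun setT (fun t : m.-tuple rT => upd t q (tnth t q + b t) : m.-tuple rT).
  move=> mb; apply/measurable_fun_tnthP => i /=.
  rewrite (_ : _ \o _ = fun t => if i == q then tnth t q + b t else tnth t i); last first.
    by apply/funext => t /=; rewrite updE.
  case: (i == q); last exact: measurable_tnth.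
  by apply: measurable_funD => //; exact: measurable_tnth.
elim: n p a a' h => [[]//|n IH p a a' h ma ma' mh h0 da ca' a'1 aK aT hT].
have a'0 t : 0 <= 1 + a' t.
  by have := a'1 t; rewrite ltr_norml => /andP[? _]; lra.
have mg : measurable_fun setT (fun t : n.+1.-tuple rT => ((1 + a' t)%:E * h (upd t p (tnth t p + a t)))%E).
  apply: emeasurable_funM; first by apply/measurable_EFinP; exact: measurable_funD.
  by apply: measurableT_comp => //; exact: mupd.
have g0 t : (0 <= (1 + a' t)%:E * h (upd t p (tnth t p + a t)))%E by rewrite mule_ge0// lee_fin.
case: (unliftP ord0 p) => [p' pE|pE]; subst p.
  rewrite !integral_box_cons//; apply: eq_integral => x _.
  have mc := @measurable_consl n x.
  transitivity (\int[box_volume R n]_r ((1 + a' [tuple of x :: r])%:E *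
      h [tuple of x :: upd r p' (tnth r p' + a [tuple of x :: r])]))%E.
    by apply: eq_integral => r _; rewrite upd_consS tnthS.
  apply: (IH p' (fun r => a [tuple of x :: r]) (fun r => a' [tuple of x :: r]) (fun r => h [tuple of x :: r])).
  - exact: measurableT_comp.
  - exact: measurableT_comp.
  - exact: measurableT_comp.
  - by [].
  - move=> r y; have := da [tuple of x :: r] y; rewrite upd_consS.
    by under eq_fun do rewrite upd_consS.
  - move=> r; have := ca' [tuple of x :: r].
    by under eq_fun do rewrite upd_consS.
  - by [].
  - by [].
  - by move=> r y; have := aT [tuple of x :: r] y; rewrite !upd_consS.
  - by move=> r y; have := hT [tuple of x :: r] y; rewrite !upd_consS.
rewrite !integral_box_cons'//; apply: eq_integral => r _.
have mc := @measurable_consr n r.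
have mhr : measurable_fun setT (fun x : rT => h [tuple of x :: r]) by exact: measurableT_comp.
rewrite !integral_uniform//; last first.
  exact: measurableT_comp mg mc.
congr (_ * _)%E.
have mix (f : R -> \bar R) : measurable_fun setT f ->
    (\int[lebesgue_measure]_(x in `[0%R, (2 * pi)%R]) f x = \int[lebesgue_measure]_(x in `]0%R, (2 * pi)%R]) f x)%E.
  by move=> mf; rewrite integral_itv_obnd_cbnd//; exact: measurable_funTS.
rewrite mix; last exact: measurableT_comp mg mc.
rewrite mix//.
pose b y := a [tuple of y :: r]; pose b' y := a' [tuple of y :: r].
transitivity (\int[lebesgue_measure]_(x in `]0%R, (2 * pi)%R])
    ((1 + b' x)%:E * (fun z => h [tuple of z :: r]) (x + b x)%R))%E.
  by apply: eq_integral => x _; rewrite upd_cons0 tnth0.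
have db (y : R) : is_derive y 1 b (b' y).
  have := da [tuple of 0 :: r] y; rewrite upd_cons0.
  by under eq_fun do rewrite upd_cons0.
have cb' : continuous b'.
  have := ca' [tuple of 0 :: r].
  by under eq_fun do rewrite upd_cons0.
transitivity (\int[lebesgue_measure]_(z in `](0 + b 0)%R, (2 * pi + b (2 * pi))%R]) h [tuple of z :: r])%E.
  apply: (@integral_shear1_itv _ b b' (2 * pi) db cb' _ _ (fun z => h [tuple of z :: r])) => // y; [exact: a'1|exact: aK].
(* Equal displacements at both ends: the image of one period is one period, translated by [b 0]. *)
have b2 : b (2 * pi) = b 0.
  by have := aT [tuple of 0 :: r] 0; rewrite !upd_cons0 add0r.
rewrite b2 add0r [(2 * pi + _)%R]addrC.
apply: (@integral_period _ (2 * pi) (fun z => h [tuple of z :: r])) => //.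
  by move=> z; have := hT [tuple of 0 :: r] z; rewrite !upd_cons0.
exact: aK.
Qed.

End BoxShear.

(** * Measurability for the Borel sigma-algebras of the torus and of the cone *)

Section BoxOpen.
Context {R : realType}.
Local Notation rT := (measurableTypeR R).

(** Open sets for the sup norm are countable unions of boxes with rational centres and radii 1 / (m
    + 1), which are measurable in the product sigma-algebra. *)
Lemma box_open_measurable n (B : set (n.-tuple rT)) :
  (forall t, B t -> exists2 e : R, 0 < e &
    forall s : n.-tuple rT, (forall p, `|(tnth s p : R) - tnth t p| < e) -> B s) ->
  measurable B.
Proof.
move=> oB; pose e m : R := m.+1%:R^-1.
have e_gt0 m : 0 < e m by rewrite invr_gt0.
pose box (q : n.-tuple rat) m := [set t : n.-tuple rT |
  forall p, `|ratr (tnth q p) - (tnth t p : R)| < e m].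
have mbox q m : measurable (box q m).
  have -> : box q m = \bigcap_(p in [set: 'I_n])
     ((fun t : n.-tuple rT => tnth t p) @^-1`
        [set` `](ratr (tnth q p) : R) - e m, ratr (tnth q p) + e m[]).
    by apply/seteqP; split=> t /= H p => [_|]; [have := H p|have := H p I];
      rewrite /= in_itv/= ltr_distlC.
  apply: fin_bigcap_measurable => [|p _]; first exact: finite_finset.
  rewrite -[X in measurable X]setTI.
  apply: (@measurable_tnth _ rT n p measurableT).
  exact: measurable_itv.
have -> : B = \bigcup_(qm in [set qm : n.-tuple rat * nat | box qm.1 qm.2 `<=` B]) box qm.1 qm.2.
  apply/seteqP; split; last by move=> t [qm /= + tqm]; exact.
  move=> t /oB[d d0 dB]; pose m := Num.truncn (2 / d).
  have em : e m * 2 < d.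
    have : 2 / d < m.+1%:R by exact: truncnS_gt.
    by rewrite ltr_pdivrMr// => H; rewrite mulrC ltr_pdivrMr// mulrC.
  have /choice[q qt] : forall p, exists q : rat, `|ratr q - (tnth t p : R)| < e m.
    move=> p; have [q] := @rat_in_itvoo R (tnth t p) (tnth t p + e m) (ltr_pwDr (e_gt0 m) (lexx _)).
    rewrite in_itv/= => /andP[tq qe]; exists q.
    by rewrite gtr0_norm ?subr_gt0// ltrBlDl.
  exists ([tuple q p | p < n], m) => /=; last first.
    by move=> p /=; rewrite tnth_mktuple.
  move=> s /= boxs; apply: dB => p; apply: lt_trans em.
  rewrite -(subrKA (ratr (q p))) mulr_natr mulr2n.
  apply: le_lt_trans (ler_normD _ _) _; apply: ltrD => //.
  by have := boxs p; rewrite /= tnth_mktuple distrC.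
by apply: (@countable_bigcup_meas _ _ _ _ (fun qm => box qm.1 qm.2)) => -[].
Qed.

Lemma measurable_dist_open (T : pointedType) (d : T -> T -> R) (U : set T) :
  dist_open d U -> measurable (U : set (g_sigma_algebraType (dist_open d))).
Proof. exact: sub_sigma_algebra. Qed.

Lemma measurable_to_dist_open d' (Y : measurableType d') (T : pointedType) (d : T -> T -> R)
    (f : Y -> g_sigma_algebraType (dist_open d)) :
  (forall U, dist_open d U -> measurable (f @^-1` U)) -> measurable_fun setT f.
Proof.
move=> H; apply: (@measurability _ _ _ (g_sigma_algebraType (dist_open d)) setT f (dist_open d)) => //.
by move=> _ [U oU <-]; rewrite setTI; exact: H.
Qed.

Lemma measurable_rays d' (Y : measurableType d') (f : Y -> R) :
  (forall c, measurable [set y | c < f y]) -> measurable_fun setT f.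
Proof.
move=> H; apply: (measurability _ (RGenOInfty.measurableE R)) => //.
move=> _ [_ [c ->] <-]; rewrite setTI.
have -> : f @^-1` `]c, +oo[ = [set y | c < f y].
  by apply/seteqP; split => y /=; rewrite in_itv/= andbT.
exact: H.
Qed.

Lemma measurable_dist_continuous (T : pointedType) (d : T -> T -> R) (f : T -> R) :
  (forall x c, c < f x -> exists2 e, 0 < e & forall y, d x y < e -> c < f y) ->
  measurable_fun setT (f : g_sigma_algebraType (dist_open d) -> R).
Proof. by move=> H; apply: measurable_rays => c; apply: measurable_dist_open => x /H. Qed.

End BoxOpen.

Section RowMeasurable.
Context {R : realType} {n : nat}.
Local Notation rT := (measurableTypeR R).

Definition row_of (t : n.-tuple R) : 'rV[R]_n := \row_p tnth t p.
Definition tup_of (u : 'rV[R]_n) : n.-tuple R := [tuple u 0 p | p < n].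

Lemma tup_ofK u : row_of (tup_of u) = u.
Proof. by apply/rowP => p; rewrite mxE tnth_mktuple. Qed.

Lemma torus_of_tupleE t : torus_of_tuple t = torus_pi (row_of t).
Proof. by []. Qed.

(* The library has a product sigma-algebra on tuples, not on row vectors. *)
Definition msr (f : 'rV[R]_n -> R) :=
  measurable_fun setT (fun t : n.-tuple rT => f (row_of t)).

Definition msr_map (S : 'rV[R]_n -> 'rV[R]_n) := forall p, msr (fun u => S u 0 p).

Lemma measurable_tup_of S : msr_map S ->
  measurable_fun setT (fun t : n.-tuple rT => tup_of (S (row_of t)) : n.-tuple rT).
Proof.
move=> mS; apply/measurable_fun_tnthP => p.
rewrite (_ : _ \o _ = fun t => S (row_of t) 0 p); first exact: mS.
by apply/funext => t /=; rewrite tnth_mktuple.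
Qed.

Lemma msr_comp f S : msr f -> msr_map S -> msr (fun u => f (S u)).
Proof.
move=> mf /measurable_tup_of mS.
rewrite /msr (_ : (fun _ => _) = (fun t : n.-tuple rT => f (row_of t)) \o (fun t => tup_of (S (row_of t)))).
  exact: measurableT_comp.
by apply/funext => t /=; rewrite tup_ofK.
Qed.

Lemma msr_cst c : msr (fun=> c).
Proof. exact: measurable_cst. Qed.

Lemma msr_coord p : msr (fun u => u 0 p).
Proof.
rewrite /msr (_ : (fun _ => _) = (fun t : n.-tuple rT => tnth t p)); first exact: measurable_tnth.
by apply/funext => t; rewrite mxE.
Qed.

Lemma msr_id : msr_map id.
Proof. exact: msr_coord. Qed.

Lemma msrD f g : msr f -> msr g -> msr (fun u => f u + g u).
Proof. exact: measurable_funD. Qed.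

Lemma msrM f g : msr f -> msr g -> msr (fun u => f u * g u).
Proof. exact: measurable_funM. Qed.

Lemma msrB f g : msr f -> msr g -> msr (fun u => f u - g u).
Proof. exact: measurable_funB. Qed.

Lemma msrX f k : msr f -> msr (fun u => f u ^+ k).
Proof. by move=> mf; exact: measurable_funX. Qed.

Lemma msr_sum (I : finType) (f : I -> 'rV[R]_n -> R) :
  (forall i, msr (f i)) -> msr (fun u => \sum_i f i u).
Proof. by move=> mf; apply: measurable_sum. Qed.

Lemma msr_dot (V W : 'rV[R]_n -> 'rV[R]_n) : msr_map V -> msr_map W ->
  msr (fun u => dot (V u) (W u)).
Proof. by move=> mV mW; apply: msr_sum => p; exact: msrM. Qed.

Lemma msr_continuous (h : R -> R) f : continuous h -> msr f -> msr (fun u => h (f u)).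
Proof. by move=> ch mf; apply: measurableT_comp mf; exact: continuous_measurable_fun. Qed.

Lemma msr_meas (h : R -> R) f : measurable_fun setT h -> msr f -> msr (fun u => h (f u)).
Proof. by move=> mh mf; exact: measurableT_comp. Qed.

Lemma msr_sqrt f : msr f -> msr (fun u => Num.sqrt (f u)).
Proof. by move=> mf; apply: msr_continuous mf; exact: sqrt_continuous. Qed.

Lemma measurable_invr : measurable_fun setT (fun x : R => x^-1).
Proof.
have -> : [set: R] = [set x | x != 0] `|` [set 0].
  by apply/seteqP; split => x //= _; have [->|] := eqVneq x 0; [right|left].
have o0 : open [set x : R | x != 0] by exact: open_neq.
apply/measurable_funU => //; first exact: open_measurable.
split; last exact: measurable_fun_set1.
by apply: open_continuous_measurable_fun => // x; rewrite inE/= => x0; exact: inv_continuous.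
Qed.

Lemma msr_inv f : msr f -> msr (fun u => (f u)^-1).
Proof. by move=> mf; apply: msr_meas mf; exact: measurable_invr. Qed.

Lemma msr_enorm V : msr_map V -> msr (fun u => enorm (V u)).
Proof. by move=> mV; apply: msr_sqrt; exact: msr_dot. Qed.

Lemma msr_lipschitz f (L : R) : (forall u v, `|f u - f v| <= L * enorm (u - v)) -> msr f.
Proof.
move=> fL; have L0 : 0 <= `|L| by [].
apply: measurable_rays => c; apply: box_open_measurable => t /= ct.
pose K := Num.sqrt n%:R * `|L| + 1; have K0 : 0 < K by rewrite ltr_wpDl// mulr_ge0// sqrtr_ge0.
exists ((f (row_of t) - c) / K); first by rewrite divr_gt0// subr_gt0.
move=> s st; rewrite -subr_gt0; set e := (f _ - c) / K in st.
have e0 : 0 <= e by rewrite divr_ge0 ?(ltW K0)// subr_ge0 ltW.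
have e0' : 0 < e by rewrite divr_gt0// subr_gt0.
have h1 : enorm (row_of t - row_of s) <= Num.sqrt n%:R * e.
  by apply: enorm_le => // p; rewrite !mxE distrC ltW.
have h2 : f (row_of t) - f (row_of s) <= `|L| * (Num.sqrt n%:R * e).
  apply: le_trans (ler_norm _) _; apply: le_trans (fL _ _) _.
  apply: le_trans (ler_wpM2r (enorm_ge0 _) (ler_norm L)) _.
  exact: ler_wpM2l.
have h3 : f (row_of t) - c = K * e by rewrite /e mulrCA divff ?mulr1// gt_eqF.
have -> : f (row_of s) - c = (f (row_of t) - c) - (f (row_of t) - f (row_of s)) by ring.
by rewrite h3 /K; lra.
Qed.

End RowMeasurable.

Section TorusLift.
Context {R : realType} {n : nat}.
Local Notation rT := (measurableTypeR R).

Definition wrap (a : R) : R := a - (Num.floor (a / (2 * pi)))%:~R * (2 * pi).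

Lemma wrap_itv a : 0 <= wrap a < 2 * pi.
Proof.
have p0 := twopi_gt0 R; rewrite /wrap; have := floor_itv (a / (2 * pi)).
by rewrite ler_pdivlMr// ltr_pdivrMr// rmorphD/= => /andP[h1 h2]; apply/andP; split; lra.
Qed.

Lemma wrapE (b : R) (z : int) : 0 <= b < 2 * pi -> wrap (b + z%:~R * (2 * pi)) = b.
Proof.
move=> /andP[b0 bp]; have p0 := twopi_gt0 R.
rewrite /wrap (@floor_def _ _ z) ?addrK//.
by rewrite ler_pdivlMr// ltr_pdivrMr// rmorphD/=; apply/andP; split; lra.
Qed.

Lemma wrap_shift (a : R) (z : int) : wrap (a + 2 * pi * z%:~R) = wrap a.
Proof.
rewrite -(@wrapE (wrap a) (Num.floor (a / (2 * pi)) + z) (wrap_itv a)); congr wrap.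
by rewrite rmorphD/= {1}/wrap; ring.
Qed.

Definition torus_lift (x : torus R n) : n.-tuple rT :=
  [tuple wrap (torus_repr x 0 p) | p < n].

Lemma torus_lift_pi u p : tnth (torus_lift (torus_pi u)) p = wrap (u 0 p).
Proof.
have [z zE] := torus_repr_pi u; rewrite tnth_mktuple zE !mxE; exact: wrap_shift.
Qed.

Lemma torus_liftK x : torus_of_tuple (torus_lift x) = x.
Proof.
rewrite torus_of_tupleE -[RHS]torus_reprK; apply/torus_piP.
exists (\row_p - Num.floor (torus_repr x 0 p / (2 * pi))).
by apply/rowP => p; rewrite !mxE tnth_mktuple /wrap rmorphN/=; ring.
Qed.

(** The function [wrap] is discontinuous only where its value is 0. For c >= 0 the set where it
    exceeds c avoids these points and is open; for c < 0 it is everything. *)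
Lemma measurable_torus_lift : measurable_fun setT torus_lift.
Proof.
apply/measurable_fun_tnthP => p; apply: measurable_rays => c.
have p0 := twopi_gt0 R.
have [c0|c0] := ltrP c 0.
  rewrite (_ : [set y | _] = setT)//; apply/seteqP; split => // x _ /=.
  rewrite tnth_mktuple; have /andP[h _] := wrap_itv (torus_repr x 0 p).
  exact: lt_le_trans h.
apply: measurable_dist_open => x /=; rewrite tnth_mktuple.
set a := torus_repr x 0 p; set b := wrap a => cb.
have /andP[b0 b2] := wrap_itv a.
exists (Num.min (b - c) (2 * pi - b)); first by rewrite lt_min !subr_gt0 cb.
move=> y; rewrite -{1}(torus_reprK x) => /torus_dist_lift[v <-] vu.
rewrite torus_lift_pi.
have : `|v 0 p - a| < Num.min (b - c) (2 * pi - b).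
  by apply: le_lt_trans vu; have := coord_le_enorm (v - torus_repr x) p; rewrite !mxE.
rewrite lt_min => /andP[]; rewrite !ltr_norml => /andP[h1 h2] /andP[h3 h4].
have -> : v 0 p = (b + (v 0 p - a)) + (Num.floor (a / (2 * pi)))%:~R * (2 * pi).
  by rewrite /b /wrap; ring.
by rewrite wrapE; [lra|apply/andP; split; rewrite -/b in b0 b2; lra].
Qed.

(** Since [torus_lift] is a measurable section of [torus_of_tuple], measurability on the torus can
    be tested on tuples. *)
Lemma measurable_on_torus d (Y : measurableType d) (f : torus R n -> Y) :
  measurable_fun setT (fun t : n.-tuple rT => f (torus_of_tuple t)) -> measurable_fun setT f.
Proof.
move=> mf; rewrite (_ : f = (fun t : n.-tuple rT => f (torus_of_tuple t)) \o torus_lift).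
  exact: measurableT_comp mf measurable_torus_lift.
by apply/funext => x /=; rewrite torus_liftK.
Qed.

End TorusLift.

Section ConeMeasurable.
Context {R : realType} {n : nat}.
Local Notation rT := (measurableTypeR R).
Local Notation M := (torus R n).
Local Notation C := (cone R n).

Definition nngabs (r : R) : {nonneg R} := NngNum (normr_ge0 r).

Let cone_of (s : n.+1.-tuple rT) : C :=
  cone_pi (torus_of_tuple [tuple tnth s (lift ord0 p) | p < n]) (nngabs (tnth s ord0)).

Let measurable_cone_of : measurable_fun setT cone_of.
Proof.
apply: measurable_to_dist_open => U oU; apply: box_open_measurable => t /= /oU[e e0 eU].
pose r := tnth t ord0.
(* By [cone_dist_pi_le], moving every coordinate by less than d <= 1 moves the point of the cone by
   a squared distance of at most K d^2: the new radius is at most |r| + 1, and the base point moves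
   by at most sqrt n d. *)
pose K : R := 1 + (`|r| + 1) ^+ 2 * n%:R.
have K0 : 0 < K by rewrite ltr_pwDl// mulr_ge0// sqr_ge0.
pose d := Num.min 1 (e / (2 * K)).
have d0 : 0 < d by rewrite lt_min ltr01 divr_gt0// mulr_gt0.
exists d => // s st; apply: eU; rewrite -ltr_sqr ?nnegrE ?cone_dist_ge0 ?(ltW e0)//.
have st0 : `|r - tnth s ord0| < d by rewrite distrC; exact: st.
apply: le_lt_trans (cone_dist_pi_le (d := Num.sqrt n%:R * d) _ _ _) _.
  apply: le_trans (torus_dist_le _ _) _; apply: enorm_le => [|p]; first exact: ltW.
  by rewrite !mxE !tnth_mktuple distrC ltW.
rewrite exprMn sqr_sqrtr ?ler0n//=.
have h1 : (`|r| - `|tnth s ord0|) ^+ 2 <= d ^+ 2.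
  rewrite -real_normK ?num_real// lerXn2r ?nnegrE ?(ltW d0)//.
  by apply: le_trans (ler_dist_dist _ _) _; exact: ltW.
have h2 : `|tnth s ord0| <= `|r| + 1.
  rewrite -lerBlDl; apply: le_trans (lerB_dist _ _) _.
  by rewrite distrC; apply: le_trans (ltW st0) _; rewrite /d ge_min lexx.
have h3 : `|r| * `|tnth s ord0| <= (`|r| + 1) ^+ 2.
  by rewrite expr2; apply: ler_pM => //; rewrite lerDl.
have h4 : `|r| * `|tnth s ord0| * (n%:R * d ^+ 2) <= (`|r| + 1) ^+ 2 * (n%:R * d ^+ 2).
  by rewrite ler_wpM2r// mulr_ge0// sqr_ge0.
have h5 : K * d ^+ 2 < e ^+ 2.
  have de : d <= e / (2 * K) by rewrite /d ge_min lexx orbT.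
  have d1 : d <= 1 by rewrite /d ge_min lexx.
  have h6 : 2 * K * d <= e by rewrite mulrC -ler_pdivlMr// mulr_gt0.
  have K1 : 1 <= K by rewrite lerDl mulr_ge0// sqr_ge0.
  have h7 : (2 * K * d) ^+ 2 <= e ^+ 2.
    by rewrite lerXn2r ?nnegrE ?(ltW e0)// !mulr_ge0// ltW.
  apply: lt_le_trans h7; rewrite !exprMn ltr_pM2r ?exprn_gt0//.
  have : K * 1 <= K * K by rewrite ler_pM2l.
  by rewrite expr2; lra.
by apply: le_lt_trans h5; rewrite /K; lra.
Qed.

Lemma measurable_cone_pi d (Y : measurableType d) (U : Y -> n.-tuple rT) (r : Y -> R) :
  measurable_fun setT U -> measurable_fun setT r ->
  measurable_fun setT (fun y => cone_pi (torus_of_tuple (U y)) (nngabs (r y)) : C).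
Proof.
move=> mU mr.
rewrite (_ : (fun y => _) = cone_of \o (fun y => [tuple of r y :: U y])).
  by apply: measurableT_comp => //; exact: measurable_cons.
apply/funext => y; rewrite /comp /cone_of.
have -> : [tuple tnth [tuple of r y :: U y] (lift ord0 p) | p < n] = U y.
  by apply: eq_from_tnth => p; rewrite tnth_mktuple (tnth_nth 0)/= (tnth_nth 0).
by have -> : tnth [tuple of r y :: U y] ord0 = r y by rewrite (tnth_nth 0).
Qed.

Lemma measurable_cone_rad : measurable_fun setT (@cone_rad R n : C -> R).
Proof.
apply: measurable_dist_continuous => x c cx; exists (cone_rad x - c); first by rewrite subr_gt0.
move=> y xy; have := le_lt_trans (cone_rad_lipschitz x y) xy.
by rewrite ltr_norml => /andP[_]; lra.
Qed.

(* [cone_base] made measurable by fixing its value at the apex *)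
Definition cone_base0 (c : C) : M := if 0 < cone_rad c then cone_base c else point.

Lemma measurable_cone_base0 : measurable_fun setT cone_base0.
Proof.
apply: measurable_to_dist_open => U oU.
have mV : measurable ([set c | 0 < cone_rad c /\ U (cone_base c)] : set C).
  by apply: measurable_dist_open; exact: cone_base_ball_open.
have mW : measurable ([set c | 0 < cone_rad c] : set C).
  by apply: measurable_dist_open => c /= c0; exists (cone_rad c) => // c' cc';
    have := le_lt_trans (cone_rad_lipschitz c c') cc'; rewrite ltr_norml => /andP[_]; lra.
have [Up|Up] := pselect (U point).
  rewrite (_ : _ @^-1` _ = [set c | 0 < cone_rad c /\ U (cone_base c)] `|` ~` [set c | 0 < cone_rad c]).
    by apply: measurableU => //; exact: measurableC.
  apply/seteqP; split => c /=; rewrite /cone_base0; case: ifPn => c0.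
  - by left.
  - by move=> _; right; exact/negP.
  - by case=> [[]//|]; move/(_ isT).
  - by [].
rewrite (_ : _ @^-1` _ = [set c | 0 < cone_rad c /\ U (cone_base c)])//.
apply/seteqP; split => c /=; rewrite /cone_base0; case: ifPn => c0 //.
  by case.
by case.
Qed.

Lemma cone_base0_pi x (r : {nonneg R}) : 0 < r%:num -> cone_base0 (cone_pi x r) = x.
Proof. by move=> r0; rewrite /cone_base0 cone_rad_pi r0 cone_base_pi. Qed.

Lemma rad_base0_pi (f : M -> R) x (r : {nonneg R}) :
  cone_rad (cone_pi x r) ^+ 2 * f (cone_base0 (cone_pi x r)) = r%:num ^+ 2 * f x.
Proof.
rewrite cone_rad_pi; have [r0|r0] := ltrP 0 r%:num; first by rewrite cone_base0_pi.
have -> : r%:num = 0 by apply/le_anti; rewrite r0/=.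
by rewrite expr0n !mul0r.
Qed.

Lemma integral_mkcondT d (T : measurableType d) (mu : set T -> \bar R) D (f : T -> \bar R) :
  (\int[mu]_(x in D) f x = \int[mu]_x (f \_ D) x)%E.
Proof. by rewrite /integral !patch_setT. Qed.

(** Away from the apex, lying over A is a condition on the base point. The apex lies over every
    nonempty A, but its weight r^2 is zero, so that the value given to its base point is
    harmless. *)
Lemma PrE (nu : set C -> \bar R) A :
  Pr nu A = (\int[nu]_c (cone_rad c ^+ 2 * \1_A (cone_base0 c))%:E)%E.
Proof.
rewrite /Pr integral_mkcondT; congr (integral _ _ _); apply/funext => c.
rewrite patchE; case: ifPn => [|/negP cA].
  rewrite inE/= => -[[x r] [/= Ax _] <-]; congr EFin.
  by rewrite rad_base0_pi indicE mem_set// mulr1 cone_rad_pi.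
have [x [r cE]] := cone_pi_surj c.
rewrite -cE rad_base0_pi indicE memNset ?mulr0// => Ax; apply: cA.
by rewrite inE; exists (x, r).
Qed.

Lemma Pr_eq_integral (nu nu' : {measure set C -> \bar R}) :
  (forall A, measurable A -> Pr nu A = Pr nu' A) ->
  forall f : M -> R, measurable_fun setT f -> (forall x, 0 <= f x) ->
  (\int[nu]_c (cone_rad c ^+ 2 * f (cone_base0 c))%:E =
   \int[nu']_c (cone_rad c ^+ 2 * f (cone_base0 c))%:E)%E.
Proof.
move=> H f mf f0; have mr := measurable_funX 2 measurable_cone_rad.
have mb := measurable_cone_base0.
have := @weighted_transfer R _ _ _ _ _ _ nu nu' _ _ _ _ mr mr (fun=> sqr_ge0 _) (fun=> sqr_ge0 _) mb mb.
move=> /(_ _ (EFin \o f)) K.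
under eq_integral do rewrite EFinM.
under [RHS]eq_integral do rewrite EFinM.
apply: K => [A mA||y]; [|exact: measurableT_comp|by rewrite lee_fin].
by rewrite -!PrE H.
Qed.

End ConeMeasurable.

(** * Bounds on the Hellinger-Kantorovich distance *)

Section Comparison.
Local Open Scope ereal_scope.
Context {R : realType}.

Import HBNNSimple.

(* The integral of a nonnegative function being a supremum over simple functions, the two
   comparisons below do not require the larger function to be measurable. *)
Lemma integral_le_nonmeasurable d (T : measurableType d) (mu : {measure set T -> \bar R})
    (f g : T -> \bar R) :
  (forall x, g x <= f x) -> (forall x, 0 <= f x) ->
  \int[mu]_x g x <= \int[mu]_x f x.
Proof.
move=> gf f0; rewrite integralE.
have g0 : 0 <= \int[mu]_x g^\- x by apply: integral_ge0 => x _; exact: funeneg_ge0.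
apply: (@le_trans _ _ (\int[mu]_x g^\+ x)); first by rewrite geeDl// leeNl oppe0.
rewrite (ge0_integralTE _ f0) (ge0_integralTE _ (fun x => funepos_ge0 g x)).
apply: le_ereal_sup => _ [h /= hg <-]; exists h => // x.
by apply: le_trans (hg x) _; rewrite funeposE ge_max gf f0.
Qed.

Lemma integral_image_le d d' (T : measurableType d) (T' : measurableType d')
    (mu : {measure set T -> \bar R}) (F : T -> T') (mF : measurable_fun setT F) (f : T' -> \bar R) :
  (forall x, 0 <= f x) -> measurable_fun setT (fun x => f (F x)) ->
  \int[image_measure mu mF]_y f y <= \int[mu]_x f (F x).
Proof.
move=> f0 mf; rewrite ge0_integralTE//; apply/ge_ereal_sup => _ [h /= hf <-].
have mh : measurable_fun setT (EFin \o h) by exact/measurable_EFinP.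
have -> : sintegral (image_measure mu mF) h = \int[image_measure mu mF]_y (h y)%:E.
  by rewrite integralT_nnsfun.
rewrite integral_image_measure//; last by move=> y; rewrite lee_fin.
apply: ge0_le_integral => //.
- by move=> x _; rewrite lee_fin.
- exact: (measurableT_comp mh mF).
Qed.

Lemma measurable_comp_fst d1 d2 d3 (T1 : measurableType d1) (T2 : measurableType d2)
    (T3 : measurableType d3) (f : T1 -> T3) :
  measurable_fun setT f -> measurable_fun setT (fun p : T1 * T2 => f p.1).
Proof. by move=> mf; exact: (measurableT_comp mf measurable_fst). Qed.

Lemma measurable_comp_snd d1 d2 d3 (T1 : measurableType d1) (T2 : measurableType d2)
    (T3 : measurableType d3) (f : T2 -> T3) :
  measurable_fun setT f -> measurable_fun setT (fun p : T1 * T2 => f p.2).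
Proof. by move=> mf; exact: (measurableT_comp mf measurable_snd). Qed.

Lemma integral_image_fst d1 d2 (T1 : measurableType d1) (T2 : measurableType d2)
    (q : {measure set (T1 * T2) -> \bar R}) (f : T1 -> R) :
  measurable_fun setT f -> (forall x, (0 <= f x)%R) ->
  \int[image_measure q measurable_fst]_y (f y)%:E = \int[q]_p (f p.1)%:E.
Proof.
move=> mf f0; rewrite integral_image_measure//; exact: measurableT_comp.
Qed.

Lemma integral_image_snd d1 d2 (T1 : measurableType d1) (T2 : measurableType d2)
    (q : {measure set (T1 * T2) -> \bar R}) (f : T2 -> R) :
  measurable_fun setT f -> (forall x, (0 <= f x)%R) ->
  \int[image_measure q measurable_snd]_y (f y)%:E = \int[q]_p (f p.2)%:E.
Proof.
move=> mf f0; rewrite integral_image_measure//; exact: measurableT_comp.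
Qed.

End Comparison.

(** * Means over the fundamental box *)

Section Mean.
Context {R : realType} {n : nat}.
Local Notation rT := (measurableTypeR R).
Implicit Types f g : 'rV[R]_n -> R.

Definition mean f : R := \int[box_volume R n]_t f (row_of t).

(** Bounded measurable functions form an algebra of integrable functions, so that linearity of the
    mean has no other side condition. *)
Definition bm f := msr f /\ exists C, forall u, `|f u| <= C.

Lemma bm_integrable f : bm f ->
  (box_volume R n).-integrable setT (EFin \o (fun t : n.-tuple rT => f (row_of t))).
Proof.
move=> [mf [C fC]]; apply: measurable_bounded_integrable => //.
  by rewrite [X in (X < _)%E]probability_setT ltry.
exists C; split; first exact: num_real.
by move=> x Cx t _ /=; apply: le_trans (fC _) (ltW Cx).
Qed.

Lemma mean_EFin f : bm f -> (\int[box_volume R n]_t (f (row_of t))%:E = (mean f)%:E)%E.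
Proof. by move=> /bm_integrable mf; rewrite /mean /Rintegral fineK//; exact: integrable_fin_num. Qed.

Lemma bm_cst c : bm (fun=> c).
Proof. by split; [exact: msr_cst|exists `|c|]. Qed.

Lemma bmD f g : bm f -> bm g -> bm (fun u => f u + g u).
Proof.
move=> [mf [C fC]] [mg [D gD]]; split; first exact: msrD.
by exists (C + D) => u; apply: le_trans (ler_normD _ _) _; exact: lerD.
Qed.

Lemma bmM f g : bm f -> bm g -> bm (fun u => f u * g u).
Proof.
move=> [mf [C fC]] [mg [D gD]]; split; first exact: msrM.
by exists (C * D) => u; rewrite normrM ler_pM.
Qed.

Lemma bmB f g : bm f -> bm g -> bm (fun u => f u - g u).
Proof.
move=> [mf [C fC]] [mg [D gD]]; split; first exact: msrB.
by exists (C + D) => u; apply: le_trans (ler_normB _ _) _; exact: lerD.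
Qed.

Lemma bmX f k : bm f -> bm (fun u => f u ^+ k).
Proof.
move=> [mf [C fC]]; split; first exact: msrX.
by exists (C ^+ k) => u; rewrite normrX lerXn2r// nnegrE// (le_trans _ (fC u)).
Qed.

Lemma bm_sum (I : finType) (f : I -> 'rV[R]_n -> R) : (forall i, bm (f i)) ->
  bm (fun u => \sum_i f i u).
Proof.
move=> bf; split; first by apply: msr_sum => i; case: (bf i).
have /choice[C fC] : forall i, exists C, forall u, `|f i u| <= C by move=> i; case: (bf i).
exists (\sum_i C i) => u; apply: le_trans (ler_norm_sum _ _ _) _.
by apply: ler_sum => i _.
Qed.

Lemma meanD f g : bm f -> bm g -> mean (fun u => f u + g u) = mean f + mean g.
Proof. by move=> /bm_integrable mf /bm_integrable mg; rewrite /mean RintegralD. Qed.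

Lemma meanB f g : bm f -> bm g -> mean (fun u => f u - g u) = mean f - mean g.
Proof. by move=> /bm_integrable mf /bm_integrable mg; rewrite /mean RintegralB. Qed.

Lemma meanZ c f : bm f -> mean (fun u => c * f u) = c * mean f.
Proof. by move=> /bm_integrable mf; rewrite /mean RintegralZl. Qed.

Lemma mean_cst c : mean (fun=> c) = c.
Proof.
by rewrite /mean Rintegral_cst// [X in fine X]probability_setT/= mulr1.
Qed.

Lemma eq_mean f g : f =1 g -> mean f = mean g.
Proof. by move=> fg; apply: eq_Rintegral => t _; exact: fg. Qed.

Lemma mean_sum (I : finType) (f : I -> 'rV[R]_n -> R) : (forall i, bm (f i)) ->
  mean (fun u => \sum_i f i u) = \sum_i mean (f i).
Proof.
move=> bf.
suff H (s : seq I) : bm (fun u => \sum_(i <- s) f i u) /\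
    mean (fun u => \sum_(i <- s) f i u) = \sum_(i <- s) mean (f i) by case: (H (index_enum I)).
elim: s => [|i s [IH1 IH2]].
  have -> : (fun u => \sum_(i <- [::]) f i u) = fun=> 0 by apply/funext => u; rewrite big_nil.
  by rewrite big_nil mean_cst; split => //; exact: bm_cst.
have -> : (fun u => \sum_(i0 <- i :: s) f i0 u) = fun u => f i u + \sum_(i <- s) f i u.
  by apply/funext => u; rewrite big_cons.
by rewrite big_cons meanD// IH2; split => //; exact: bmD.
Qed.

Lemma ler_mean f g : bm f -> bm g -> (forall u, f u <= g u) -> mean f <= mean g.
Proof. by move=> /bm_integrable mf /bm_integrable mg fg; apply: le_Rintegral => // t _; exact: fg. Qed.

Lemma ler_norm_mean f (C : R) : bm f -> (forall u, `|f u| <= C) -> `|mean f| <= C.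
Proof.
move=> bf fC; rewrite ler_norml; apply/andP; split.
  rewrite -(mean_cst (- C)); apply: ler_mean => //; first exact: bm_cst.
  by move=> u; have := fC u; rewrite ler_norml => /andP[].
rewrite -[leRHS](mean_cst C); apply: ler_mean => //; first exact: bm_cst.
by move=> u; have := fC u; rewrite ler_norml => /andP[].
Qed.

End Mean.

(** * Couplings and Kantorovich duality on the cone *)

Section ConeLaw.
Context {R : realType} {n : nat}.
Local Notation rT := (measurableTypeR R).
Local Notation M := (torus R n).
Local Notation C := (cone R n).
Local Notation P := (box_volume R n).
Implicit Types (X : 'rV[R]_n -> 'rV[R]_n) (r : 'rV[R]_n -> R).

Definition cone_map X r (t : n.-tuple rT) : C :=
  cone_pi (torus_pi (X (row_of t))) (nngabs (r (row_of t))).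

Lemma measurable_cone_map X r : msr_map X -> msr r -> measurable_fun setT (cone_map X r).
Proof.
move=> mX mr; have := measurable_cone_pi (measurable_tup_of mX) mr.
by under eq_fun do rewrite torus_of_tupleE tup_ofK.
Qed.

Lemma measurable_comp_torus_pi (f : M -> R) X : measurable_fun setT f -> msr_map X ->
  msr (fun u => f (torus_pi (X u))).
Proof.
move=> mf mX; rewrite /msr (_ : (fun _ => _) = fun t : n.-tuple rT => f (torus_of_tuple (tup_of (X (row_of t))))).
  apply: (@measurableT_comp _ _ _ _ _ _ f) => //.
  apply: (@measurableT_comp _ _ _ _ _ _ (@torus_of_tuple R n)); first exact: measurable_torus_of_tuple.
  exact: measurable_tup_of.
by apply/funext => t; rewrite torus_of_tupleE tup_ofK.
Qed.

Lemma measurable_rad_base0 (f : M -> R) : measurable_fun setT f ->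
  measurable_fun setT (fun c : C => cone_rad c ^+ 2 * f (cone_base0 c)).
Proof.
move=> mf; apply: measurable_funM; first exact: measurable_funX measurable_cone_rad.
exact: measurableT_comp mf measurable_cone_base0.
Qed.

Lemma integral_cone_law X r (mF : measurable_fun setT (cone_map X r)) (f : M -> R) :
  measurable_fun setT f -> (forall x, 0 <= f x) ->
  (\int[image_measure P mF]_c (cone_rad c ^+ 2 * f (cone_base0 c))%:E =
   \int[P]_t (r (row_of t) ^+ 2 * f (torus_pi (X (row_of t))))%:E)%E.
Proof.
move=> mf f0; rewrite integral_image_measure.
- by apply: eq_integral => t _; rewrite rad_base0_pi/= real_normK ?num_real.
- by apply/measurable_EFinP; exact: measurable_rad_base0.
- by move=> c; rewrite lee_fin mulr_ge0// sqr_ge0.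
Qed.

Lemma Pr_cone_law X r (mF : measurable_fun setT (cone_map X r)) A : measurable A ->
  Pr (image_measure P mF) A =
  (\int[P]_t (r (row_of t) ^+ 2 * \1_A (torus_pi (X (row_of t))))%:E)%E.
Proof.
by move=> mA; rewrite PrE integral_cone_law//; exact: measurable_indic.
Qed.

Section Bounds.
Variables (X0 X1 X0' : 'rV[R]_n -> 'rV[R]_n) (r0 r1 r0' : 'rV[R]_n -> R).
Hypotheses (mX0 : msr_map X0) (mX1 : msr_map X1) (mX0' : msr_map X0').
Hypotheses (br0 : bm r0) (br1 : bm r1) (br0' : bm r0').
Let mr0 := br0.1. Let mr1 := br1.1. Let mr0' := br0'.1.
Let mF0 := measurable_cone_map mX0 mr0.
Let mF1 := measurable_cone_map mX1 mr1.
Let mF0' := measurable_cone_map mX0' mr0'.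
Variables (mu0 mu1 : set M -> \bar R).
Hypotheses (mu0E : mu0 = Pr (image_measure P mF0)) (mu1E : mu1 = Pr (image_measure P mF1)).
Hypothesis same_mass : forall f : M -> R, measurable_fun setT f -> (forall x, 0 <= f x) ->
  (\int[P]_t (r0' (row_of t) ^+ 2 * f (torus_pi (X0' (row_of t))))%:E =
   \int[P]_t (r0 (row_of t) ^+ 2 * f (torus_pi (X0 (row_of t))))%:E)%E.

Let mF01 : measurable_fun setT (fun t : n.-tuple rT => (cone_map X0' r0' t, cone_map X1 r1 t)).
Proof. exact: measurable_fun_pair. Qed.

Let q0 := image_measure P mF01.

(** A plan is constrained only through the measures r^2 pushed to the base, not through its marginal
    laws on the cone. The pair [(X0', r0')] carries the same such measure as [(X0, r0)] by
    [same_mass], and evaluating both components at the same point of the box couples them. *)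
Lemma HK_plan_cone_maps : HK_plan mu0 mu1 q0.
Proof.
split.
(* Seen from the apex the distance is the radius, and the radii are bounded. *)
- pose apex : C := cone_pi point (nngabs 0); exists (apex, apex).
  have apexE c : cone_dist apex c ^+ 2 = cone_rad c ^+ 2.
    have [x [r <-]] := cone_pi_surj c.
    by rewrite cone_cost_pi cone_rad_pi /cone_cost/= normr0 expr0n mulr0 !mul0r add0r subr0.
  pose g (p : C * C) := 1 + (cone_rad p.1 ^+ 2 + cone_rad p.2 ^+ 2).
  have mg : measurable_fun setT g.
    apply: measurable_funD => //.
    have m1 : measurable_fun setT (fun p : C * C => cone_rad p.1).
      exact: (measurable_comp_fst measurable_cone_rad).
    have m2 : measurable_fun setT (fun p : C * C => cone_rad p.2).
      exact: (measurable_comp_snd measurable_cone_rad).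
    exact: (measurable_funD (measurable_funX 2 m1) (measurable_funX 2 m2)).
  rewrite (_ : (fun x => _) = EFin \o g); last first.
    apply/funext => p; rewrite /g/= sqr_sqrtr ?apexE//.
    by rewrite addr_ge0 ?sqr_ge0.
  rewrite integral_image_measure//; last 2 first.
  + by apply/measurable_EFinP.
  + by move=> p; rewrite lee_fin addr_ge0// addr_ge0// sqr_ge0.
  have -> : (\int[P]_t (EFin \o g) (cone_map X0' r0' t, cone_map X1 r1 t) =
      \int[P]_t (1 + (r0' (row_of t) ^+ 2 + r1 (row_of t) ^+ 2))%:E)%E.
    by apply: eq_integral => t _; rewrite /g/= !cone_rad_pi/= !real_normK ?num_real.
  rewrite (@mean_EFin _ _ (fun u => 1 + (r0' u ^+ 2 + r1 u ^+ 2))) ?ltry//.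
  by apply: bmD; [exact: bm_cst|apply: bmD; exact: bmX].
- move=> A mA; rewrite mu0E.
  have -> : pushforward q0 fst = image_measure P mF0' by [].
  by rewrite !Pr_cone_law//; apply: same_mass => //; exact: measurable_indic.
- move=> A mA; rewrite mu1E.
  by have -> : pushforward q0 snd = image_measure P mF1 by [].
Qed.

Definition cone_costs u := cone_cost (torus_pi (X0' u)) (torus_pi (X1 u)) `|r0' u| `|r1 u|.

Hypothesis bcost : bm cone_costs.

Lemma HK_upper : exists2 q, HK_plan mu0 mu1 q &
  (\int[q]_p (cone_dist p.1 p.2 ^+ 2)%:E <= (mean cone_costs)%:E)%E.
Proof.
exists q0; first exact: HK_plan_cone_maps.
rewrite -mean_EFin//.
have E t : cone_dist (cone_map X0' r0' t) (cone_map X1 r1 t) ^+ 2 = cone_costs (row_of t).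
  by rewrite cone_cost_pi.
apply: (@le_trans _ _ (\int[P]_t (cone_dist (cone_map X0' r0' t) (cone_map X1 r1 t) ^+ 2)%:E)%E).
  apply: (@integral_image_le _ _ _ _ _ _ _ mF01 (fun p : C * C => (cone_dist p.1 p.2 ^+ 2)%:E)).
  - by move=> p; rewrite lee_fin sqr_ge0.
  apply/measurable_EFinP => /=.
  by under eq_fun do rewrite E; exact: bcost.1.
by under eq_integral do rewrite /= E.
Qed.

Variables (a0 a1 : M -> R).
Hypotheses (ma0 : measurable_fun setT a0) (ma1 : measurable_fun setT a1).
Hypotheses (ba0 : exists B, forall x, `|a0 x| <= B) (ba1 : exists B, forall x, `|a1 x| <= B).
Hypothesis a01 : forall x y, cos (Num.min (torus_dist x y) pi) <= a0 x * a1 y.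

(* 2 r r' cos d <= 2 (r a0) (r' a1) <= (r a0)^2 + (r' a1)^2 *)
Lemma cone_dist_ge_dual (c c' : C) :
  cone_rad c ^+ 2 + cone_rad c' ^+ 2 - cone_rad c ^+ 2 * a0 (cone_base0 c) ^+ 2
    - cone_rad c' ^+ 2 * a1 (cone_base0 c') ^+ 2 <= cone_dist c c' ^+ 2.
Proof.
rewrite cone_dist_sqr /cone_cost; set r := cone_rad c; set r' := cone_rad c'.
have rr : 2 * r * r' * cos (Num.min (torus_dist (cone_base c) (cone_base c')) pi) <=
    2 * r * r' * (a0 (cone_base0 c) * a1 (cone_base0 c')).
  have r_ge0 : 0 <= r by exact: cone_rad_ge0.
  have r'_ge0 : 0 <= r' by exact: cone_rad_ge0.
  rewrite /cone_base0 -/r -/r'; have [rp|rp] := ltrP 0 r; last first.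
    have -> : r = 0 by apply/le_anti; rewrite rp.
    by rewrite mulr0 !mul0r.
  have [r'p|r'p] := ltrP 0 r'; last first.
    have -> : r' = 0 by apply/le_anti; rewrite r'p.
    by rewrite mulr0 !mul0r.
  by rewrite ler_wpM2l// !mulr_ge0.
have : 0 <= (r * a0 (cone_base0 c) - r' * a1 (cone_base0 c')) ^+ 2 by rewrite sqr_ge0.
by move=> h; lra.
Qed.

Definition dual_value := mean (fun u => r0 u ^+ 2) + mean (fun u => r1 u ^+ 2)
  - mean (fun u => r0 u ^+ 2 * a0 (torus_pi (X0 u)) ^+ 2)
  - mean (fun u => r1 u ^+ 2 * a1 (torus_pi (X1 u)) ^+ 2).

Let plan_integral (q : {measure set C -> \bar R}) X r (mX : msr_map X) (br : bm r)
    (mF : measurable_fun setT (cone_map X r)) (f : M -> R) :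
  (forall A, measurable A -> Pr q A = Pr (image_measure P mF) A) ->
  measurable_fun setT f -> (forall x, 0 <= f x) -> (exists B, forall x, `|f x| <= B) ->
  (\int[q]_c (cone_rad c ^+ 2 * f (cone_base0 c))%:E =
   (mean (fun u => r u ^+ 2 * f (torus_pi (X u))))%:E)%E.
Proof.
move=> qE mf f0 bf; rewrite (Pr_eq_integral qE)// integral_cone_law//.
apply: (@mean_EFin _ _ (fun u => r u ^+ 2 * f (torus_pi (X u)))); apply: bmM; first exact: bmX.
split; first exact: measurable_comp_torus_pi.
by case: bf => B fB; exists B.
Qed.

(** Each term on the left of [cone_dist_ge_dual] is a squared radius times a function of the base
    point of one component, so that its integral depends on the plan only through the prescribed
    measures. Integrating the inequality gives a bound common to all plans. *)
Lemma HK_lower (q : {measure set (C * C) -> \bar R}) : HK_plan mu0 mu1 q ->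
  (dual_value%:E <= \int[q]_p (cone_dist p.1 p.2 ^+ 2)%:E)%E.
Proof.
move=> [_ q0E q1E].
pose f0 (f : M -> R) (p : C * C) := cone_rad p.1 ^+ 2 * f (cone_base0 p.1).
pose f1 (f : M -> R) (p : C * C) := cone_rad p.2 ^+ 2 * f (cone_base0 p.2).
have H0 (f : M -> R) : measurable_fun setT f -> (forall x, 0 <= f x) -> (exists B, forall x, `|f x| <= B) ->
    q.-integrable setT (EFin \o f0 f) /\
    \int[q]_p f0 f p = mean (fun u => r0 u ^+ 2 * f (torus_pi (X0 u))).
  move=> mf fp fB.
  have mff := measurable_rad_base0 mf.
  have mf1 : measurable_fun setT (f0 f) by exact: (measurable_comp_fst mff).
  have f0_ge p : 0 <= f0 f p by rewrite mulr_ge0// sqr_ge0.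
  have E : (\int[q]_p (f0 f p)%:E = (mean (fun u => r0 u ^+ 2 * f (torus_pi (X0 u))))%:E)%E.
    have ff0 (c : C) : 0 <= cone_rad c ^+ 2 * f (cone_base0 c) by rewrite mulr_ge0// sqr_ge0.
    apply: eq_trans (esym (integral_image_fst q mff ff0)) _.
    apply: (plan_integral mX0 br0 (mF := mF0) _ mf fp fB) => A mA.
    exact: eq_trans (q0E A mA) (congr1 (fun m => m A) mu0E).
  split; last by rewrite /Rintegral E.
  apply/integrableP; split; first exact/measurable_EFinP.
  by under eq_integral do rewrite /= ger0_norm//; rewrite E ltry.
have H1 (f : M -> R) : measurable_fun setT f -> (forall x, 0 <= f x) -> (exists B, forall x, `|f x| <= B) ->
    q.-integrable setT (EFin \o f1 f) /\
    \int[q]_p f1 f p = mean (fun u => r1 u ^+ 2 * f (torus_pi (X1 u))).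
  move=> mf fp fB.
  have mff := measurable_rad_base0 mf.
  have mf1 : measurable_fun setT (f1 f) by exact: (measurable_comp_snd mff).
  have f1_ge p : 0 <= f1 f p by rewrite mulr_ge0// sqr_ge0.
  have E : (\int[q]_p (f1 f p)%:E = (mean (fun u => r1 u ^+ 2 * f (torus_pi (X1 u))))%:E)%E.
    have ff0 (c : C) : 0 <= cone_rad c ^+ 2 * f (cone_base0 c) by rewrite mulr_ge0// sqr_ge0.
    apply: eq_trans (esym (integral_image_snd q mff ff0)) _.
    apply: (plan_integral mX1 br1 (mF := mF1) _ mf fp fB) => A mA.
    exact: eq_trans (q1E A mA) (congr1 (fun m => m A) mu1E).
  split; last by rewrite /Rintegral E.
  apply/integrableP; split; first exact/measurable_EFinP.
  by under eq_integral do rewrite /= ger0_norm//; rewrite E ltry.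
have b1 : exists B : R, forall x : M, `|(fun=> 1 : R) x| <= B by exists 1 => x; rewrite normr1.
have bsq (a : M -> R) : (exists B, forall x, `|a x| <= B) -> exists B, forall x, `|a x ^+ 2| <= B.
  by move=> [B aB]; exists (B ^+ 2) => x; rewrite normrX lerXn2r// nnegrE// (le_trans _ (aB x)).
have [i0 e0] := H0 (fun=> 1) (measurable_cst _) (fun=> ler01) b1.
have [i1 e1] := H1 (fun=> 1) (measurable_cst _) (fun=> ler01) b1.
have [i2 e2] := H0 (fun x => a0 x ^+ 2) (measurable_funX 2 ma0) (fun=> sqr_ge0 _) (bsq _ ba0).
have [i3 e3] := H1 (fun x => a1 x ^+ 2) (measurable_funX 2 ma1) (fun=> sqr_ge0 _) (bsq _ ba1).
have i01 : q.-integrable setT (EFin \o (fun p => f0 (fun=> 1) p + f1 (fun=> 1) p)).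
  by have := integrableD measurableT i0 i1.
have i012 : q.-integrable setT (EFin \o (fun p => f0 (fun=> 1) p + f1 (fun=> 1) p - f0 (fun x => a0 x ^+ 2) p)).
  by have := integrableB measurableT i01 i2.
have i0123 : q.-integrable setT (EFin \o (fun p => f0 (fun=> 1) p + f1 (fun=> 1) p - f0 (fun x => a0 x ^+ 2) p - f1 (fun x => a1 x ^+ 2) p)).
  by have := integrableB measurableT i012 i3.
have -> : dual_value = \int[q]_p (f0 (fun=> 1) p + f1 (fun=> 1) p - f0 (fun x => a0 x ^+ 2) p - f1 (fun x => a1 x ^+ 2) p).
  rewrite RintegralB// RintegralB// RintegralD// e0 e1 e2 e3 /dual_value.
  by under [in RHS]eq_mean do rewrite mulr1; under [X in _ = _ + X - _ - _]eq_mean do rewrite mulr1.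
rewrite /Rintegral fineK; last exact: integrable_fin_num.
apply: integral_le_nonmeasurable => p; last by rewrite lee_fin sqr_ge0.
by rewrite lee_fin /f0 /f1 !mulr1; exact: cone_dist_ge_dual.
Qed.

(** The infimum lies between 0 and a finite cost, so that neither [fine] nor the square root in [HK]
    loses anything. *)
Lemma HK_sqr_bounds : dual_value <= HK mu0 mu1 ^+ 2 <= mean cone_costs.
Proof.
rewrite /HK; set S := [set _ | _ in _].
have [q qP qC] := HK_upper.
have Sge0 : (0 <= ereal_inf S)%E.
  by apply: le_ereal_inf_tmp => _ [q' _ <-]; apply: integral_ge0 => p _; rewrite lee_fin sqr_ge0.
have Sle : (ereal_inf S <= (mean cone_costs)%:E)%E.
  by apply: le_trans qC; apply: ereal_inf_lbound; exists q.
have Sge : (dual_value%:E <= ereal_inf S)%E.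
  by apply: le_ereal_inf_tmp => _ [q' q'P <-]; exact: HK_lower.
have Sfin : ereal_inf S \is a fin_num by rewrite ge0_fin_numE// (le_lt_trans Sle)// ltry.
by rewrite sqr_sqrtr ?fine_ge0// -!lee_fin fineK// Sge Sle.
Qed.

End Bounds.
End ConeLaw.

(** * Trigonometric polynomials *)

Section TrigPolynomials.
Context {R : realType} {n : nat}.
Implicit Types (u v d : 'rV[R]_n) (m : 'rV[int]_n) (p q : 'I_n).

Definition zdot m u : R := \sum_p (m 0 p)%:~R * u 0 p.

Lemma zdotDr m u v : zdot m (u + v) = zdot m u + zdot m v.
Proof. by rewrite /zdot -big_split/=; apply: eq_bigr => p _; rewrite mxE mulrDr. Qed.

Lemma zdotDl m m' u : zdot (m + m') u = zdot m u + zdot m' u.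
Proof. by rewrite /zdot -big_split/=; apply: eq_bigr => p _; rewrite mxE rmorphD/= mulrDl. Qed.

Lemma zdotNl m u : zdot (- m) u = - zdot m u.
Proof. by rewrite /zdot -sumrN; apply: eq_bigr => p _; rewrite mxE rmorphN/= mulNr. Qed.

Lemma zdot0l u : zdot 0 u = 0.
Proof. by rewrite /zdot big1// => p _; rewrite mxE mul0r. Qed.

Lemma zdotZr m c u : zdot m (c *: u) = c * zdot m u.
Proof. by rewrite /zdot mulr_sumr; apply: eq_bigr => p _; rewrite mxE mulrCA. Qed.

Lemma zdot_delta m p : zdot m (delta_mx 0 p) = (m 0 p)%:~R.
Proof.
rewrite /zdot (bigD1 p)//= big1 ?addr0 ?mxE ?eqxx ?mulr1// => q qp.
by rewrite mxE (negbTE qp) andbF mulr0.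
Qed.

Lemma zdot_le m u : `|zdot m u| <= (\sum_p `|(m 0 p)%:~R : R|) * enorm u.
Proof.
apply: le_trans (ler_norm_sum _ _ _) _; rewrite mulr_suml.
by apply: ler_sum => p _; rewrite normrM ler_wpM2l// coord_le_enorm.
Qed.

Definition tpoly := seq (R * 'rV[int]_n * R).
Implicit Types a b : tpoly.

Definition teval a u : R := \sum_(x <- a) x.1.1 * cos (zdot x.1.2 u + x.2).

Definition tD p a : tpoly := [seq (x.1.1 * (x.1.2 0 p)%:~R, x.1.2, x.2 + pi / 2) | x : R * 'rV[int]_n * R <- a].
Definition tscale (c : R) a : tpoly := [seq (c * x.1.1, x.1.2, x.2) | x : R * 'rV[int]_n * R <- a].
Definition tmul1 (x y : R * 'rV[int]_n * R) : tpoly :=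
  [:: (x.1.1 * y.1.1 / 2, x.1.2 + y.1.2, x.2 + y.2);
      (x.1.1 * y.1.1 / 2, x.1.2 - y.1.2, x.2 - y.2)].
Definition tmul a b : tpoly := flatten [seq flatten [seq tmul1 x y | y <- b] | x <- a].
Definition tsum (f : 'I_n -> tpoly) : tpoly := flatten [seq f p | p <- index_enum 'I_n].
Definition tcst (c : R) : tpoly := [:: (c, 0, 0)].

Lemma teval_nil u : teval [::] u = 0. Proof. by rewrite /teval big_nil. Qed.

Lemma teval_cat a b u : teval (a ++ b) u = teval a u + teval b u.
Proof. by rewrite /teval big_cat. Qed.

Lemma teval_cons x a u : teval (x :: a) u = x.1.1 * cos (zdot x.1.2 u + x.2) + teval a u.
Proof. by rewrite /teval big_cons. Qed.

Lemma teval_scale c a u : teval (tscale c a) u = c * teval a u.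
Proof. by rewrite /teval big_map mulr_sumr; apply: eq_bigr => x _; rewrite mulrA. Qed.

Lemma teval_cst c u : teval (tcst c) u = c.
Proof. by rewrite teval_cons teval_nil addr0 zdot0l add0r cos0 mulr1. Qed.

Lemma teval_flatten (s : seq tpoly) u : teval (flatten s) u = \sum_(a <- s) teval a u.
Proof. by elim: s => [|a s IH]; rewrite /= ?teval_nil ?big_nil// teval_cat big_cons IH. Qed.

Lemma teval_sum (f : 'I_n -> tpoly) u : teval (tsum f) u = \sum_p teval (f p) u.
Proof. by rewrite teval_flatten big_map. Qed.

Lemma teval_mul a b u : teval (tmul a b) u = teval a u * teval b u.
Proof.
rewrite teval_flatten big_map {2}/teval mulr_suml; apply: eq_bigr => x _.
rewrite teval_flatten big_map {2}/teval mulr_sumr; apply: eq_bigr => y _.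
rewrite /tmul1 !teval_cons teval_nil/= !zdotDl zdotNl.
have -> : zdot x.1.2 u + zdot y.1.2 u + (x.2 + y.2) =
  (zdot x.1.2 u + x.2) + (zdot y.1.2 u + y.2) by ring.
have -> : zdot x.1.2 u - zdot y.1.2 u + (x.2 - y.2) =
  (zdot x.1.2 u + x.2) - (zdot y.1.2 u + y.2) by ring.
by rewrite cosB cosD; field.
Qed.

Lemma teval_D p a u : teval (tD p a) u =
  \sum_(x <- a) - (x.1.1 * (x.1.2 0 p)%:~R * sin (zdot x.1.2 u + x.2)).
Proof. by rewrite /teval big_map; apply: eq_bigr => x _ /=; rewrite addrA cosDpihalf mulrN. Qed.

Lemma tD_cat p a b : tD p (a ++ b) = tD p a ++ tD p b.
Proof. by rewrite /tD map_cat. Qed.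

Lemma teval_D_cat p a b u : teval (tD p (a ++ b)) u = teval (tD p a) u + teval (tD p b) u.
Proof. by rewrite tD_cat teval_cat. Qed.

Lemma teval_D_scale p c a u : teval (tD p (tscale c a)) u = c * teval (tD p a) u.
Proof.
by rewrite !teval_D big_map mulr_sumr; apply: eq_bigr => x _ /=; ring.
Qed.

Lemma teval_D_flatten p (s : seq tpoly) u :
  teval (tD p (flatten s)) u = \sum_(a <- s) teval (tD p a) u.
Proof. by elim: s => [|a s IH]; rewrite /= ?teval_nil ?big_nil// teval_D_cat big_cons IH. Qed.

Lemma teval_D_sum p (f : 'I_n -> tpoly) u : teval (tD p (tsum f)) u = \sum_q teval (tD p (f q)) u.
Proof. by rewrite /tsum teval_D_flatten big_map. Qed.

Lemma teval_D_mul p a b u : teval (tD p (tmul a b)) u =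
  teval (tD p a) u * teval b u + teval a u * teval (tD p b) u.
Proof.
rewrite /tmul teval_D_flatten big_map teval_D [teval a u]/teval !mulr_suml -big_split/=; apply: eq_bigr => x _.
rewrite teval_D_flatten big_map teval_D [teval b u]/teval !mulr_sumr -big_split/=; apply: eq_bigr => y _.
rewrite !teval_cons teval_nil/= !addrA !cosDpihalf !zdotDl zdotNl !mxE rmorphB rmorphD/=.
have -> : zdot x.1.2 u + zdot y.1.2 u + x.2 + y.2 =
  (zdot x.1.2 u + x.2) + (zdot y.1.2 u + y.2) by ring.
have -> : zdot x.1.2 u - zdot y.1.2 u + x.2 - y.2 =
  (zdot x.1.2 u + x.2) - (zdot y.1.2 u + y.2) by ring.
by rewrite sinB sinD; field.
Qed.

Lemma teval_DC p q a u : teval (tD p (tD q a)) u = teval (tD q (tD p a)) u.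
Proof. by rewrite !teval_D !big_map; apply: eq_bigr => x _ /=; ring. Qed.

Lemma teval_bounded a : exists C, forall u, `|teval a u| <= C.
Proof.
exists (\sum_(x <- a) `|x.1.1|) => u; apply: le_trans (ler_norm_sum _ _ _) _.
by apply: ler_sum => x _; rewrite normrM ler_piMr// cos_max.
Qed.

Lemma teval_lipschitz a : exists C, forall u d, `|teval a (u + d) - teval a u| <= C * enorm d.
Proof.
exists (\sum_(x <- a) `|x.1.1| * \sum_p `|(x.1.2 0 p)%:~R : R|) => u d.
rewrite /teval -sumrB mulr_suml; apply: le_trans (ler_norm_sum _ _ _) _.
apply: ler_sum => x _; rewrite -mulrBr normrM -mulrA ler_wpM2l//.
apply: le_trans (cos_lipschitz _ _) _; rewrite zdotDr.
by rewrite (_ : _ - _ = zdot x.1.2 d) ?zdot_le//; ring.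
Qed.

Lemma teval_taylor a : exists C, forall u d,
  `|teval a (u + d) - teval a u - \sum_p teval (tD p a) u * d 0 p| <= C * enorm d ^+ 2.
Proof.
exists (\sum_(x <- a) `|x.1.1| * (\sum_p `|(x.1.2 0 p)%:~R : R|) ^+ 2) => u d.
have -> : \sum_p teval (tD p a) u * d 0 p =
    \sum_(x <- a) - (x.1.1 * zdot x.1.2 d * sin (zdot x.1.2 u + x.2)).
  under eq_bigr do rewrite teval_D mulr_suml.
  rewrite exchange_big/=; apply: eq_bigr => x _.
  by rewrite /zdot mulr_sumr mulr_suml -sumrN; apply: eq_bigr => p _; ring.
rewrite /teval -!sumrB mulr_suml; apply: le_trans (ler_norm_sum _ _ _) _.
apply: ler_sum => x _; rewrite zdotDr [_ + zdot _ d + _]addrAC.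
have -> : x.1.1 * cos (zdot x.1.2 u + x.2 + zdot x.1.2 d) - x.1.1 * cos (zdot x.1.2 u + x.2) -
  - (x.1.1 * zdot x.1.2 d * sin (zdot x.1.2 u + x.2)) =
  x.1.1 * (cos (zdot x.1.2 u + x.2 + zdot x.1.2 d) - cos (zdot x.1.2 u + x.2) +
    zdot x.1.2 d * sin (zdot x.1.2 u + x.2)) by ring.
rewrite normrM -mulrA ler_wpM2l//; apply: le_trans (cosD_taylor2 _ _) _.
rewrite -exprMn -real_normK ?num_real// lerXn2r ?nnegrE ?zdot_le//.
by rewrite mulr_ge0 ?enorm_ge0// sumr_ge0.
Qed.

Lemma zdot_period m (z : 'rV[int]_n) : exists k : int,
  zdot m ((2 * pi) *: map_mx intr z) = k%:~R * (2 * pi).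
Proof.
exists (\sum_p m 0 p * z 0 p); rewrite zdotZr mulrC; congr (_ * _).
by rewrite /zdot rmorph_sum/=; apply: eq_bigr => p _; rewrite mxE rmorphM.
Qed.

Lemma cos_period (x : R) (k : int) : cos (x + k%:~R * (2 * pi)) = cos x.
Proof.
have H (j : nat) (y : R) : cos (y + j%:R * (2 * pi)) = cos y.
  elim: j => [|j IH]; first by rewrite mul0r addr0.
  rewrite -addn1 natrD mulrDl mul1r addrA.
  by rewrite -[RHS]IH -[RHS]cosD2pi -[pi *+ 2]mulr_natl.
case: k => [j|j]; first exact: H.
by rewrite NegzE rmorphN/= mulNr -(H j.+1 (x - _)) subrK.
Qed.

Lemma teval_period a u (z : 'rV[int]_n) : teval a (u + (2 * pi) *: map_mx intr z) = teval a u.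
Proof.
apply: eq_bigr => x _; rewrite zdotDr; have [k ->] := zdot_period x.1.2 z.
by rewrite addrAC cos_period.
Qed.

Lemma msr_zdot m : msr (zdot m).
Proof. by apply: msr_sum => p; apply: msrM; [exact: msr_cst|exact: msr_coord]. Qed.

Lemma msr_teval a : msr (teval a).
Proof.
elim: a => [|x a IH].
  rewrite (_ : teval [::] = fun=> 0); first exact: msr_cst.
  by apply/funext => u; rewrite teval_nil.
rewrite (_ : teval (x :: a) = fun u => x.1.1 * cos (zdot x.1.2 u + x.2) + teval a u); last first.
  by apply/funext => u; rewrite teval_cons.
apply: msrD => //; apply: msrM; first exact: msr_cst.
apply: msr_continuous; first exact: continuous_cos.
by apply: msrD; [exact: msr_zdot|exact: msr_cst].
Qed.

Lemma bm_teval a : bm (teval a).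
Proof. by split; [exact: msr_teval|exact: teval_bounded]. Qed.

Lemma is_derive_teval a u v (y : R) : is_derive y 1 (fun y : R => teval a (u + y *: v))
  (\sum_p teval (tD p a) (u + y *: v) * v 0 p).
Proof.
elim: a => [|x a IH].
  apply: is_derive_eq; last first.
    by rewrite big1// => p _; rewrite teval_nil mul0r.
  by under eq_fun do rewrite teval_nil; exact: is_derive_cst.
have -> : (fun y : R => teval (x :: a) (u + y *: v)) = fun y =>
    x.1.1 * cos (y * zdot x.1.2 v + (zdot x.1.2 u + x.2)) + teval a (u + y *: v).
  by apply/funext => z; rewrite teval_cons zdotDr zdotZr; congr (_ * cos _ + _); ring.
have H : is_derive y 1 (fun y : R => x.1.1 * cos (y * zdot x.1.2 v + (zdot x.1.2 u + x.2)))
    (x.1.1 * (- sin (y * zdot x.1.2 v + (zdot x.1.2 u + x.2)) * zdot x.1.2 v)).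
  apply: is_derive_scalef.
  apply: (@is_derive_compf _ cos (fun y => y * zdot x.1.2 v + (zdot x.1.2 u + x.2))).
  have := is_derive_addf (is_derive_mulf (is_derive_id y 1) (is_derive_cst (zdot x.1.2 v) y 1)) (is_derive_cst (zdot x.1.2 u + x.2) y 1).
  by rewrite mulr0 addr0 mul1r addr0.
have K := is_derive_addf H IH.
apply: is_derive_eq.
rewrite [in RHS](eq_bigr (fun p => - (x.1.1 * (x.1.2 0 p)%:~R * sin (zdot x.1.2 (u + y *: v) + x.2)) * v 0 p + teval (tD p a) (u + y *: v) * v 0 p)).
  rewrite big_split/=; congr (_ + _); rewrite zdotDr zdotZr.
  have -> : zdot x.1.2 u + y * zdot x.1.2 v + x.2 = y * zdot x.1.2 v + (zdot x.1.2 u + x.2) by ring.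
  move: (sin _) => S.
  rewrite mulrA /zdot mulr_sumr; apply: eq_bigr => p _; ring.
by move=> p _; rewrite !teval_D big_cons mulrDl.
Qed.

Lemma derive_teval a u p : 'D_(delta_mx 0 p) (teval a) u = teval (tD p a) u.
Proof.
have H := is_derive_teval a u (delta_mx 0 p) 0.
have E : \sum_q teval (tD q a) (u + 0 *: delta_mx 0 p) * (delta_mx 0 p : 'rV[R]_n) 0 q = teval (tD p a) u.
  rewrite scale0r addr0 (bigD1 p)//= big1 ?addr0 ?mxE ?eqxx ?mulr1// => q qp.
  by rewrite mxE (negbTE qp) andbF mulr0.
case: H => _; rewrite E => <-.
have E2 : (fun h : R => h^-1 *: ((teval a \o shift u) (h *: delta_mx 0 p) - teval a u)) =
  (fun h : R => h^-1 *: (((fun y => teval a (u + y *: delta_mx 0 p)) \o shift 0) (h *: (1 : R)) -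
    teval a (u + 0 *: delta_mx 0 p))).
  by apply/funext => h /=; rewrite scale0r !addr0 [h *: 1]mulr1 [u + _]addrC.
by rewrite /derive E2.
Qed.

End TrigPolynomials.

(** * Shears of the torus and their compositions *)

Section VolumePreserving.
Context {R : realType} {n : nat}.
Local Notation rT := (measurableTypeR R).
Local Notation P := (box_volume R n).
Implicit Types (u : 'rV[R]_n) (S : 'rV[R]_n -> 'rV[R]_n) (J h : 'rV[R]_n -> R).

Definition lattice (z : 'rV[int]_n) : 'rV[R]_n := (2 * pi) *: map_mx intr z.

(* [S] is a map of the torus lifted to R^n, and [J] plays the role of its Jacobian. *)
Definition vol_pres S J := [/\ msr_map S, msr J, (forall u, 0 < J u),
  (forall u z, S (u + lattice z) = S u + lattice z) & (forall u z, J (u + lattice z) = J u)] /\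
  (forall h, msr h -> (forall u, 0 <= h u) -> (forall u z, h (u + lattice z) = h u) ->
  (\int[P]_t (J (row_of t) * h (S (row_of t)))%:E = \int[P]_t (h (row_of t))%:E)%E).

Lemma vol_pres_id : vol_pres id (fun=> 1).
Proof.
split; first by split => //; [exact: msr_id|exact: msr_cst].
by move=> h *; apply: eq_integral => t _; rewrite mul1r.
Qed.

Lemma vol_pres_comp S J S' J' : vol_pres S J -> vol_pres S' J' ->
  vol_pres (fun u => S (S' u)) (fun u => J (S' u) * J' u).
Proof.
move=> [[mS mJ J0 SP JP] SJ] [[mS' mJ' J'0 S'P J'P] SJ']; split; first split.
- by move=> p; exact: (msr_comp (mS p) mS').
- by apply: msrM => //; exact: msr_comp.
- by move=> u; rewrite mulr_gt0.
- by move=> u z; rewrite S'P SP.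
- by move=> u z; rewrite S'P JP J'P.
move=> h mh h0 hP; rewrite -(SJ h)//.
have := SJ' (fun u => J u * h (S u)); move=> <-.
- by apply: eq_integral => t _; congr (_%:E); ring.
- by apply: msrM => //; exact: msr_comp.
- by move=> u; rewrite mulr_ge0// ltW.
- by move=> u z; rewrite SP JP hP.
Qed.

Definition shear (p : 'I_n) (a : tpoly (R := R)) (delta : R) u : 'rV[R]_n :=
  u + (delta * teval a u) *: delta_mx 0 p.

Lemma shearE p a delta u q : shear p a delta u 0 q = u 0 q + (q == p)%:R * (delta * teval a u).
Proof. by rewrite !mxE eqxx/= mulrC. Qed.

Lemma row_of_upd (t : n.-tuple R) p y :
  row_of (upd t p y) = row_of t + (y - tnth t p) *: delta_mx 0 p.
Proof.
apply/rowP => q; rewrite !mxE updE eqxx/=.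
by have [->|_] := eqVneq q p; rewrite ?mulr1 ?mulr0 ?addr0// addrC subrK.
Qed.

(** The first bound makes the shear increasing along its coordinate, the second keeps the
    displacement within one period, as [box_shear] requires. *)
Lemma vol_pres_shear p a delta :
  (forall u, `|delta * teval (tD p a) u| < 1) -> (forall u, `|delta * teval a u| <= 2 * pi) ->
  vol_pres (shear p a delta) (fun u => 1 + delta * teval (tD p a) u).
Proof.
move=> a'1 aP.
have ma c b : msr (fun u => c * teval b u).
  by apply: msrM; [exact: msr_cst|exact: msr_teval].
split; first split.
- move=> q; rewrite (_ : (fun u => _) = fun u => u 0 q + (q == p)%:R * (delta * teval a u)).
    by apply: msrD; [exact: msr_coord|apply: msrM => //; exact: msr_cst].
  by apply/funext => u; rewrite shearE.
- by apply: msrD => //; exact: msr_cst.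
- by move=> u; have := a'1 u; rewrite ltr_norml => /andP[? _]; lra.
- by move=> u z; rewrite /shear teval_period addrAC.
- by move=> u z; rewrite teval_period.
move=> h mh h0 hP.
pose A (t : n.-tuple rT) := delta * teval a (row_of t).
pose A' (t : n.-tuple rT) := delta * teval (tD p a) (row_of t).
pose H (t : n.-tuple rT) := (h (row_of t))%:E.
have updl (t : n.-tuple R) (y : R) : row_of (upd t p y) = row_of (upd t p 0) + y *: delta_mx 0 p.
  by rewrite !row_of_upd -addrA -scalerDl; congr (_ + _ *: _); ring.
have period (t : n.-tuple R) y : row_of (upd t p (y + 2 * pi)) = row_of (upd t p y) + lattice (delta_mx 0 p).
  rewrite updl [in RHS]updl scalerDl addrA; congr (_ + _ *: _).
  by apply/rowP => q; rewrite !mxE; case: (_ && _).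
have E := @box_shear R n p A A' H.
transitivity (\int[P]_t ((1 + A' t)%:E * H (upd t p (tnth t p + A t)))%E)%E.
  apply: eq_integral => t _; rewrite /H EFinM; congr (_ * _%:E)%E.
  by rewrite row_of_upd /shear addrAC subrr add0r.
apply: E => //.
- exact: ma.
- exact: ma.
- by apply/measurable_EFinP.
- by move=> t; rewrite lee_fin.
- move=> t y; rewrite /A /A'.
  have D : is_derive y 1 (fun y : R => delta * teval a (row_of (upd t p 0) + y *: delta_mx 0 p))
     (delta * \sum_q teval (tD q a) (row_of (upd t p 0) + y *: delta_mx 0 p) * (delta_mx 0 p : 'rV[R]_n) 0 q).
    by apply: is_derive_scalef; exact: is_derive_teval.
  have <- : \sum_q teval (tD q a) (row_of (upd t p 0) + y *: delta_mx 0 p) * (delta_mx 0 p : 'rV[R]_n) 0 q = teval (tD p a) (row_of (upd t p y)).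
    rewrite (bigD1 p)//= big1 ?addr0 ?mxE ?eqxx ?mulr1 -?updl// => q qp.
    by rewrite mxE (negbTE qp) andbF mulr0.
  by under eq_fun do rewrite updl.
- move=> t; rewrite /A'.
  under eq_fun do rewrite updl.
  apply: (@is_derive_continuousT _ _ (fun y => delta * \sum_q teval (tD q (tD p a)) (row_of (upd t p 0) + y *: delta_mx 0 p) * (delta_mx 0 p : 'rV[R]_n) 0 q)) => y.
  by apply: is_derive_scalef; exact: is_derive_teval.
- by move=> t; exact: a'1.
- by move=> t; exact: aP.
- by move=> t y; rewrite /A period teval_period.
- by move=> t y; rewrite /H period hP.
Qed.

Fixpoint shears (Z : 'I_n -> tpoly (R := R)) (s : seq 'I_n) (delta : R) u : 'rV[R]_n :=
  if s is p :: s' then shear p (Z p) delta (shears Z s' delta u) else u.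

Fixpoint shears_jac (Z : 'I_n -> tpoly (R := R)) (s : seq 'I_n) (delta : R) u : R :=
  if s is p :: s' then
    (1 + delta * teval (tD p (Z p)) (shears Z s' delta u)) * shears_jac Z s' delta u
  else 1.

(** The points already produced by the other shears are O(delta) away from u, so that evaluating the
    next component of Z there instead of at u changes the result only by O(delta^2). The sum over
    [p == q] keeps track of the shears that act on coordinate q. *)
Lemma shears_estimate Z s : exists C delta0 : R, 0 < delta0 /\ forall delta, `|delta| < delta0 ->
  vol_pres (shears Z s delta) (shears_jac Z s delta) /\
  forall u, (forall q, `|shears Z s delta u 0 q - (u 0 q + delta * \sum_(p <- s | p == q) teval (Z p) u)| <= C * delta ^+ 2) /\
    `|shears_jac Z s delta u - (1 + delta * \sum_(p <- s) teval (tD p (Z p)) u)| <= C * delta ^+ 2.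
Proof.
elim: s => [|p s [C [d0 [d0_gt0 IH]]]].
  exists 0, 1; split => // delta _; split; first exact: vol_pres_id.
  move=> u; rewrite big_nil mulr0 addr0 subrr normr0 mul0r; split => // q.
  by rewrite big_nil mulr0 addr0 subrr normr0.
have [B ZB] := teval_bounded (Z p).
have [B' ZB'] := teval_bounded (tD p (Z p)).
have [L ZL] := teval_lipschitz (Z p).
have [L' ZL'] := teval_lipschitz (tD p (Z p)).
have /choice[M MZ] : forall q, exists M, forall u, `|\sum_(p <- s | p == q) teval (Z p) u| <= M.
  move=> q; elim: s {IH} => [|r s [M IH]]; first by exists 0 => u; rewrite big_nil normr0.
  have [K rK] := teval_bounded (Z r); exists (K + M) => u; rewrite big_cons.
  have K0 : 0 <= K by exact: le_trans (rK 0).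
  case: ifP => _; last by apply: le_trans (IH u) _; rewrite lerDr.
  by apply: le_trans (ler_normD _ _) _; exact: lerD.
have [M' M'Z] : exists M', forall u, `|\sum_(p <- s) teval (tD p (Z p)) u| <= M'.
  elim: s {IH MZ} => [|r s [M' IH]]; first by exists 0 => u; rewrite big_nil normr0.
  have [K rK] := teval_bounded (tD r (Z r)); exists (K + M') => u; rewrite big_cons.
  by apply: le_trans (ler_normD _ _) _; exact: lerD.
pose MM := \sum_q `|M q|.
have B0 : 0 <= B by exact: le_trans (ZB 0).
have B'0 : 0 <= B' by exact: le_trans (ZB' 0).
have M'0 : 0 <= M' by exact: le_trans (M'Z 0).
have MM0 : 0 <= MM by exact: sumr_ge0.
(* The sign of C follows from the induction hypothesis at a nonzero [delta], where C delta^2 bounds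
   an absolute value. *)
have C0 : 0 <= C.
  have h : `|d0 / 2| < d0 by rewrite gtr0_norm ?divr_gt0//; lra.
  have [_ /(_ 0) [_]] := IH (d0 / 2) h.
  by move=> /(le_trans (normr_ge0 _)); rewrite pmulr_lge0// exprn_gt0// divr_gt0.
pose sq := Num.sqrt n%:R * (MM + C) : R.
have sq0 : 0 <= sq by rewrite mulr_ge0 ?sqrtr_ge0// addr_ge0.
pose KL := `|L| * sq; pose KL' := `|L'| * sq.
have KL0 : 0 <= KL by rewrite mulr_ge0.
have KL'0 : 0 <= KL' by rewrite mulr_ge0.
(* The error constant adds the errors inherited from the induction, those of evaluating at the
   displaced point, and the product of the first-order terms of the Jacobian. Among the bounds on
   [delta], 1 gives delta^2 <= |delta|, and the last two are the hypotheses of [vol_pres_shear]. *)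
exists (C + KL + (1 + B') * C + KL' * (1 + M') + B' * M'), (Num.min d0 (Num.min 1 (Num.min (1 / (B' + 1)) (1 / (B + 1))))).
have p2 := pi_ge2 R.
split.
  by rewrite !lt_min d0_gt0 ltr01 !divr_gt0//; lra.
move=> delta; rewrite !lt_min => /and4P[dd0 d1 dB' dB].
have [IH1 IH2] := IH delta dd0.
have d2 : delta ^+ 2 <= `|delta|.
  by rewrite -real_normK ?num_real// expr2 ler_piMr// ltW.
have normd2 : delta ^+ 2 = `|delta| * `|delta| by rewrite -real_normK ?num_real// expr2.
have d20 : 0 <= delta ^+ 2 by exact: sqr_ge0.
split.
  apply: (@vol_pres_comp (shear p (Z p) delta) (fun u => 1 + delta * teval (tD p (Z p)) u) _ _ _ IH1).
  apply: vol_pres_shear => u.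
    rewrite normrM; apply: le_lt_trans (ler_wpM2l _ (ZB' u)) _ => //.
    have : `|delta| * (B' + 1) < 1 by move: dB'; rewrite ltr_pdivlMr//; lra.
    have := normr_ge0 delta; lra.
  rewrite normrM; apply: le_trans (ler_wpM2l _ (ZB u)) _ => //.
  have : `|delta| * (B + 1) < 1 by move: dB; rewrite ltr_pdivlMr//; lra.
  have := normr_ge0 delta; lra.
move=> u; have [IHS IHJ] := IH2 u; set v := shears Z s delta u in IHS *.
set J := shears_jac Z s delta u in IHJ *.
have vu q : `|(v - u) 0 q| <= (MM + C) * `|delta|.
  rewrite !mxE.
  have -> : v 0 q - u 0 q = (v 0 q - (u 0 q + delta * \sum_(p0 <- s | p0 == q) teval (Z p0) u)) + delta * \sum_(p0 <- s | p0 == q) teval (Z p0) u by ring.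
  apply: le_trans (ler_normD _ _) _; rewrite normrM mulrDl addrC; apply: lerD.
    rewrite mulrC ler_wpM2r//; apply: le_trans (MZ q u) _.
    apply: le_trans (ler_norm _) _; rewrite /MM (bigD1 q)//= lerDl.
    exact: sumr_ge0.
  by apply: le_trans (IHS q) _; rewrite ler_wpM2l.
have vu2 : enorm (v - u) <= sq * `|delta|.
  by rewrite /sq -mulrA; apply: enorm_le => //; rewrite mulr_ge0// addr_ge0.
have lip (a : tpoly (R := R)) (K : R) : (forall u d, `|teval a (u + d) - teval a u| <= K * enorm d) ->
    `|teval a v - teval a u| <= `|K| * sq * `|delta|.
  move=> aK; have := aK u (v - u).
  rewrite (_ : u + (v - u) = v); last by rewrite [LHS]addrC subrK.
  move=> /le_trans; apply.
  apply: le_trans (ler_wpM2r (enorm_ge0 _) (ler_norm K)) _.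
  by rewrite -mulrA ler_wpM2l.
have ZLv := lip _ _ ZL; have ZL'v := lip _ _ ZL'.
rewrite -/KL in ZLv; rewrite -/KL' in ZL'v.
split.
  move=> q; rewrite big_cons /= -/v shearE.
  apply: (@le_trans _ _ ((C + KL) * delta ^+ 2)); last first.
    rewrite ler_wpM2r//; have : 0 <= (1 + B') * C by rewrite mulr_ge0// addr_ge0.
    have : 0 <= KL' * (1 + M') by rewrite mulr_ge0// addr_ge0.
    have : 0 <= B' * M' by rewrite mulr_ge0.
    lra.
  have Cd : C * delta ^+ 2 <= (C + KL) * delta ^+ 2 by rewrite ler_wpM2r// lerDl.
  rewrite [p == q]eq_sym; case: (q == p); last first.
    by rewrite mul0r addr0; exact: le_trans (IHS q) _.
  rewrite mul1r.
  set sm := \sum_(j <- s | j == q) _.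
  have -> : v 0 q + delta * teval (Z p) v - (u 0 q + delta * (teval (Z p) u + sm)) =
    (v 0 q - (u 0 q + delta * sm)) + delta * (teval (Z p) v - teval (Z p) u) by ring.
  apply: le_trans (ler_normD _ _) _; rewrite mulrDl; apply: lerD; first exact: IHS.
  by rewrite normrM normd2 mulrCA ler_wpM2l.
rewrite big_cons /= -/v -/J; set sm := \sum_(j <- s) _.
set z := teval (tD p (Z p)) u; set z' := teval (tD p (Z p)) v.
have -> : (1 + delta * z') * J - (1 + delta * (z + sm)) =
  (1 + delta * z') * (J - (1 + delta * sm)) + (delta * (z' - z)) * (1 + delta * sm) +
  delta ^+ 2 * (z * sm) by ring.
have e1 : `|(1 + delta * z') * (J - (1 + delta * sm))| <= (1 + B') * C * delta ^+ 2.
  rewrite normrM -mulrA; apply: ler_pM => //.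
  apply: le_trans (ler_normD _ _) _; rewrite normr1 lerD2l normrM -[leRHS]mul1r.
  by apply: ler_pM => //; [exact: ltW|exact: ZB'].
have e2 : `|(delta * (z' - z)) * (1 + delta * sm)| <= KL' * (1 + M') * delta ^+ 2.
  rewrite !normrM normd2.
  have -> : KL' * (1 + M') * (`|delta| * `|delta|) = (`|delta| * (KL' * `|delta|)) * (1 + M') by ring.
  apply: ler_pM => //; first by rewrite ler_wpM2l.
  apply: le_trans (ler_normD _ _) _; rewrite normr1 lerD2l normrM -[leRHS]mul1r.
  by apply: ler_pM => //; [exact: ltW|exact: M'Z].
have e3 : `|delta ^+ 2 * (z * sm)| <= B' * M' * delta ^+ 2.
  by rewrite normrM (ger0_norm d20) mulrC ler_wpM2r// normrM ler_pM//; [exact: ZB'|exact: M'Z].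
apply: le_trans (ler_normD _ _) _; apply: le_trans (lerD (ler_normD _ _) (lexx _)) _.
have : 0 <= (C + KL) * delta ^+ 2 by rewrite mulr_ge0// addr_ge0.
by move: e1 e2 e3; rewrite !mulrDl; lra.
Qed.

End VolumePreserving.

(** * Means of trigonometric polynomials and Parseval's identity *)

Section MeanTrig.
Context {R : realType} {n : nat}.
Implicit Types (u : 'rV[R]_n) (S : 'rV[R]_n -> 'rV[R]_n) (J h : 'rV[R]_n -> R) (m : 'rV[int]_n).

Lemma mean_vol_pres_ge0 S J h : vol_pres S J -> bm h -> bm (fun u => J u * h (S u)) ->
  (forall u, 0 <= h u) -> (forall u z, h (u + lattice z) = h u) ->
  mean (fun u => J u * h (S u)) = mean h.
Proof.
move=> [_ SJ] bh bJh h0 hP; have := SJ h bh.1 h0 hP.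
by rewrite mean_EFin// (@mean_EFin _ _ (fun u => J u * h (S u)))// => -[].
Qed.

Lemma bm_cos m (theta : R) : bm (fun u => cos (zdot m u + theta)).
Proof.
split; last by exists 1 => u; exact: cos_max.
apply: msr_continuous; first exact: continuous_cos.
by apply: msrD; [exact: msr_zdot|exact: msr_cst].
Qed.

(** If some m_p is nonzero, the translation by pi / m_p along coordinate p, a shear of constant
    displacement, preserves the mean and changes the sign of the cosine. *)
Lemma mean_cos m (theta : R) :
  mean (fun u => cos (zdot m u + theta)) = (m == 0)%:R * cos theta.
Proof.
have [->|m0] := eqVneq m 0.
  rewrite mul1r -[RHS](@mean_cst R n); apply: eq_mean => u.
  by rewrite zdot0l add0r.
rewrite mul0r.
have [p mp] : exists p, m 0 p != 0.
  apply/existsP; apply: contraNT m0; rewrite negb_exists => /forallP H.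
  by apply/eqP/rowP => p; rewrite mxE; apply/eqP; have := H p; rewrite negbK.
have mpR : (m 0 p)%:~R != 0 :> R by rewrite intr_eq0.
pose a := tcst (n := n) (pi / (m 0 p)%:~R : R).
have Da u : teval (tD p a) u = 0.
  by rewrite teval_D big_cons big_nil/= mxE mulr0 mul0r oppr0 addr0.
have VP : vol_pres (shear p a 1) (fun u => 1 + 1 * teval (tD p a) u).
  apply: vol_pres_shear => u; first by rewrite Da mulr0 normr0.
  rewrite mul1r teval_cst normrM (gtr0_norm (pi_gt0 R)) normrV ?unitfE//.
  have : 1 <= `|(m 0 p)%:~R| :> R by rewrite -intr_norm ler1z; lia.
  move=> h; have h2 : `|(m 0 p)%:~R|^-1 <= 1 :> R by rewrite invf_le1// (lt_le_trans _ h).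
  have := pi_gt0 R => p0; have := ler_wpM2l (ltW p0) h2; lra.
(* Adding 1 gives the nonnegative function that [mean_vol_pres_ge0] asks for. *)
pose h u := 1 + cos (zdot m u + theta).
have bh : bm h by apply: bmD; [exact: bm_cst|exact: bm_cos].
have hS u : h (shear p a 1 u) = 1 - cos (zdot m u + theta).
  rewrite /h /shear zdotDr zdotZr zdot_delta mul1r teval_cst divfK//.
  by rewrite addrAC cosDpi.
have := mean_vol_pres_ge0 VP bh.
have -> : (fun u => (1 + 1 * teval (tD p a) u) * h (shear p a 1 u)) = fun u => 1 - cos (zdot m u + theta).
  by apply/funext => u; rewrite Da mulr0 addr0 mul1r hS.
have b1 : bm (fun u => 1 - cos (zdot m u + theta)).
  by apply: bmB; [exact: bm_cst|exact: bm_cos].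
move=> /(_ b1) H.
have {H} : mean (fun u => 1 - cos (zdot m u + theta)) = mean h.
  apply: H => u; first by rewrite /h; have := cos_geN1 (zdot m u + theta); lra.
  move=> z; rewrite /h; congr (_ + _).
  have := teval_period [:: (1, m, theta)] u z.
  by rewrite !teval_cons !teval_nil/= !mul1r !addr0.
rewrite meanB ?meanD; [|exact: bm_cst|exact: bm_cos|exact: bm_cst|exact: bm_cos].
by lra.
Qed.

Lemma mean_teval (a : tpoly (R := R) (n := n)) :
  mean (teval a) = \sum_(x <- a) x.1.1 * ((x.1.2 == 0)%:R * cos x.2).
Proof.
elim: a => [|x a IH].
  by rewrite big_nil -[RHS](@mean_cst R n); apply: eq_mean => u; rewrite teval_nil.
rewrite big_cons -IH -mean_cos -meanZ; last exact: bm_cos.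
rewrite -meanD; [|by apply: bmM; [exact: bm_cst|exact: bm_cos]|exact: bm_teval].
by apply: eq_mean => u; rewrite teval_cons.
Qed.

Lemma mean_tD p (a : tpoly (R := R) (n := n)) : mean (teval (tD p a)) = 0.
Proof.
rewrite mean_teval big_map big1// => x _ /=.
by have [->|_] := eqVneq x.1.2 0; rewrite ?mxE ?mulr0 !mul0r ?mulr0.
Qed.

End MeanTrig.

Section Parseval.
Context {R : realType} {n : nat}.
Variables (I : finType) (nu : I -> I) (M : I -> 'rV[int]_n) (theta : I -> R).
Hypotheses (M_inj : injective M) (M_neq0 : forall i, M i != 0)
  (MN : forall i, M (nu i) = - M i) (thetaN : forall i, theta (nu i) = - theta i).

Let Phi i (u : 'rV[R]_n) := zdot (M i) u + theta i.

Let mean_cosD i j : mean (fun u => cos (Phi i u + Phi j u)) = (j == nu i)%:R.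
Proof.
have -> : (fun u => cos (Phi i u + Phi j u)) = fun u => cos (zdot (M i + M j) u + (theta i + theta j)).
  by apply/funext => u; congr cos; rewrite zdotDl /Phi; ring.
rewrite mean_cos addr_eq0 -[M i == _]eqr_oppLR -MN (inj_eq M_inj) [nu i == j]eq_sym.
by have [->|_] := eqVneq j (nu i); rewrite ?mul0r// thetaN subrr cos0 mulr1.
Qed.

Let mean_cosB i j : mean (fun u => cos (Phi i u - Phi j u)) = (j == i)%:R.
Proof.
have -> : (fun u => cos (Phi i u - Phi j u)) = fun u => cos (zdot (M i - M j) u + (theta i - theta j)).
  by apply/funext => u; congr cos; rewrite zdotDl zdotNl /Phi; ring.
rewrite mean_cos subr_eq0 (inj_eq M_inj) [i == j]eq_sym.
by have [->|_] := eqVneq j i; rewrite ?mul0r// subrr cos0 mulr1.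
Qed.

Let bD i j : bm (fun u => cos (Phi i u + Phi j u)).
Proof.
have -> : (fun u => cos (Phi i u + Phi j u)) = fun u => cos (zdot (M i + M j) u + (theta i + theta j)).
  by apply/funext => u; congr cos; rewrite zdotDl /Phi; ring.
exact: bm_cos.
Qed.

Let bB i j : bm (fun u => cos (Phi i u - Phi j u)).
Proof.
have -> : (fun u => cos (Phi i u - Phi j u)) = fun u => cos (zdot (M i - M j) u + (theta i - theta j)).
  by apply/funext => u; congr cos; rewrite zdotDl zdotNl /Phi; ring.
exact: bm_cos.
Qed.

(** The map nu pairs each frequency with its opposite, so that the functions indexed by i and [nu i]
    are equal (cosines, e = 1) or opposite (sines, e = -1). The mean of a product of two of them is
    1 / 2 for j = i and e / 2 for j = [nu i]; the two halves add up, whence a sum of squares with no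
    factor 1 / 2. *)
Let mean_quadratic (e : R) (f : I -> 'rV[R]_n -> R) (A : I -> R) :
  (forall i j u, f i u * f j u = 2^-1 * cos (Phi i u - Phi j u) + e / 2 * cos (Phi i u + Phi j u)) ->
  (forall i, A (nu i) = e * A i) -> e ^+ 2 = 1 ->
  mean (fun u => (\sum_i A i * f i u) ^+ 2) = \sum_i A i ^+ 2.
Proof.
move=> ff AN e1.
pose G i j (u : 'rV[R]_n) := A i * A j / 2 * cos (Phi i u - Phi j u) + A i * A j * e / 2 * cos (Phi i u + Phi j u).
have bG i j : bm (G i j) by apply: bmD; apply: bmM => //; exact: bm_cst.
have -> : (fun u => (\sum_i A i * f i u) ^+ 2) = fun u => \sum_i \sum_j G i j u.
  apply/funext => u; rewrite expr2 mulr_suml; apply: eq_bigr => i _.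
  by rewrite mulr_sumr; apply: eq_bigr => j _; rewrite mulrACA ff /G; ring.
rewrite mean_sum; last by move=> i; exact: bm_sum.
apply: eq_bigr => i _; rewrite mean_sum//.
have mG j : mean (G i j) = A i * A j / 2 * (j == i)%:R + A i * A j * e / 2 * (j == nu i)%:R.
  by rewrite /G meanD; [rewrite !meanZ ?mean_cosB ?mean_cosD//| |]; apply: bmM => //; exact: bm_cst.
under eq_bigr do rewrite mG.
rewrite big_split/= (bigD1 i)//= big1 => [|j /negbTE->]; last by rewrite mulr0.
rewrite [X in _ + X](bigD1 (nu i))//= big1 => [|j /negbTE->]; last by rewrite mulr0.
rewrite !eqxx !mulr1 AN; have -> : A i * (e * A i) * e / 2 = e ^+ 2 * (A i ^+ 2 / 2) by ring.
by rewrite e1; field.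
Qed.

Lemma parseval_cos (A : I -> R) : (forall i, A (nu i) = A i) ->
  mean (fun u => (\sum_i A i * cos (zdot (M i) u + theta i)) ^+ 2) = \sum_i A i ^+ 2.
Proof.
move=> AN; apply: (@mean_quadratic 1 (fun i u => cos (Phi i u))); last by rewrite expr1n.
  by move=> i j u; rewrite cosB cosD; field.
by move=> i; rewrite mul1r.
Qed.

Lemma parseval_sin (A : I -> R) : (forall i, A (nu i) = - A i) ->
  mean (fun u => (\sum_i A i * sin (zdot (M i) u + theta i)) ^+ 2) = \sum_i A i ^+ 2.
Proof.
move=> AN; apply: (@mean_quadratic (-1) (fun i u => sin (Phi i u))); last by rewrite sqrrN expr1n.
  by move=> i j u; rewrite cosB cosD; field.
by move=> i; rewrite mulN1r.
Qed.

Lemma mean_cos_sum (A : I -> R) : mean (fun u => \sum_i A i * cos (zdot (M i) u + theta i)) = 0.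
Proof.
rewrite mean_sum; last by move=> i; apply: bmM; [exact: bm_cst|exact: bm_cos].
apply: big1 => i _; rewrite meanZ; last exact: bm_cos.
by rewrite mean_cos (negbTE (M_neq0 i)) mul0r mulr0.
Qed.

End Parseval.

(** * Uniform asymptotics *)

Section BigO.
Context {R : realType} {n : nat}.
Implicit Types (F G : R -> R -> 'rV[R]_n -> R) (Q : R -> R -> 'rV[R]_n -> Prop).

(** Here s and t are small but unrelated, and all orders are counted in s + t; the bounded ratio of
    s and t intervenes only in [lim_star_bO]. *)
Definition eventually0 Q := exists2 d : R, 0 < d &
  forall s t u, 0 < s -> 0 < t -> s < d -> t < d -> Q s t u.

Lemma eventually0_and Q Q' : eventually0 Q -> eventually0 Q' ->
  eventually0 (fun s t u => Q s t u /\ Q' s t u).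
Proof.
move=> [d d0 dQ] [d' d'0 d'Q]; exists (Num.min d d'); first by rewrite lt_min d0.
move=> s t u s0 t0; rewrite !lt_min => /andP[? ?] /andP[? ?].
by split; [exact: dQ|exact: d'Q].
Qed.

Lemma eventually0_mono Q Q' : eventually0 Q ->
  (forall s t u, 0 < s -> 0 < t -> Q s t u -> Q' s t u) -> eventually0 Q'.
Proof. by move=> [d d0 dQ] QQ'; exists d => // s t u s0 t0 sd td; apply: QQ' => //; exact: dQ. Qed.

Lemma eventually0_all Q : (forall s t u, 0 < s -> 0 < t -> Q s t u) -> eventually0 Q.
Proof. by move=> H; exists 1 => // s t u s0 t0 _ _; exact: H. Qed.

Lemma eventually0_forall (I : finType) (Q : I -> R -> R -> 'rV[R]_n -> Prop) :
  (forall i, eventually0 (Q i)) -> eventually0 (fun s t u => forall i, Q i s t u).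
Proof.
move=> H; have /choice[d dP] : forall i, exists d : R, 0 < d /\
  forall s t u, 0 < s -> 0 < t -> s < d -> t < d -> Q i s t u.
  by move=> i; have [d d0 dQ] := H i; exists d.
exists (\big[Num.min/1]_i d i).
  by elim/big_ind: _ => // [x y x0 y0|i _]; [rewrite lt_min x0|case: (dP i)].
move=> s t u s0 t0 sd td i; have [_] := dP i; apply => //.
  by apply: lt_le_trans sd _; exact: bigmin_le_cond.
by apply: lt_le_trans td _; exact: bigmin_le_cond.
Qed.

(* A class, so that instance resolution computes orders of magnitude. *)
Class bO (k : nat) F : Prop := bO_bound :
  exists C : R, eventually0 (fun s t u => `|F s t u| <= C * (s + t) ^+ k).

Lemma bO_boundP k F : bO k F ->
  exists2 C : R, 0 <= C & eventually0 (fun s t u => `|F s t u| <= C * (s + t) ^+ k).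
Proof.
move=> [C H]; exists `|C| => //; apply: (eventually0_mono H) => s t u s0 t0 /le_trans; apply.
by rewrite ler_wpM2r ?ler_norm// exprn_ge0// addr_ge0// ltW.
Qed.

Lemma bO_le j k F G : bO j G -> (k <= j)%N ->
  eventually0 (fun s t u => `|F s t u| <= `|G s t u|) -> bO k F.
Proof.
move=> /bO_boundP[C C0 HG] kj HF; exists C.
have [d d0 H] := eventually0_and HG HF.
exists (Num.min d 2^-1); first by rewrite lt_min d0 invr_gt0 ltr0n.
move=> s t u s0 t0; rewrite !lt_min => /andP[sd s1] /andP[td t1].
have [hG hF] := H s t u s0 t0 sd td.
apply: le_trans hF _; apply: le_trans hG _; rewrite ler_wpM2l//.
by apply: ler_wiXn2l => //; lra.
Qed.

Lemma bO_weaken j k F : bO j F -> (k <= j)%N -> bO k F.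
Proof. by move=> Fj kj; apply: (bO_le Fj kj); apply: eventually0_all. Qed.

Lemma bO_ext k F G : bO k G -> (forall s t u, 0 < s -> 0 < t -> F s t u = G s t u) -> bO k F.
Proof. by move=> Gk FG; apply: (bO_le Gk (leqnn k)); apply: eventually0_all => s t u s0 t0; rewrite FG. Qed.

Lemma bO_eventually_ext k F G : bO k G -> eventually0 (fun s t u => F s t u = G s t u) -> bO k F.
Proof. by move=> Gk FG; apply: (bO_le Gk (leqnn k)); apply: (eventually0_mono FG) => s t u s0 t0 ->. Qed.

Global Instance bO_cst c : bO 0 (fun _ _ _ => c).
Proof. by exists `|c|; apply: eventually0_all => s t u _ _; rewrite mulr1. Qed.

Global Instance bO_s : bO 1 (fun s _ _ => s).
Proof.
by exists 1; apply: eventually0_all => s t u s0 t0; rewrite mul1r gtr0_norm// lerDl ltW.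
Qed.

Global Instance bO_t : bO 1 (fun _ t _ => t).
Proof.
by exists 1; apply: eventually0_all => s t u s0 t0; rewrite mul1r gtr0_norm// lerDr ltW.
Qed.

Lemma bO_bounded (f : 'rV[R]_n -> R) : (exists C, forall u, `|f u| <= C) -> bO 0 (fun _ _ u => f u).
Proof. by move=> [C fC]; exists C; apply: eventually0_all => s t u _ _; rewrite mulr1. Qed.

Global Instance bO_teval a : bO 0 (fun _ _ u => teval a u).
Proof. by apply: bO_bounded; exact: teval_bounded. Qed.

Global Instance bO_teval_family a (S : R -> R -> 'rV[R]_n -> 'rV[R]_n) :
  bO 0 (fun s t u => teval a (S s t u)).
Proof.
by have [C aC] := teval_bounded a; exists C; apply: eventually0_all => s t u _ _; rewrite mulr1.
Qed.

Global Instance bO_add j k F G : bO j F -> bO k G -> bO (minn j k) (fun s t u => F s t u + G s t u).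
Proof.
move=> Fj Gk.
have /bO_boundP[C C0 HF] := bO_weaken Fj (geq_minl j k).
have /bO_boundP[D D0 HG] := bO_weaken Gk (geq_minr j k).
exists (C + D); apply: (eventually0_mono (eventually0_and HF HG)) => s t u s0 t0 [h1 h2].
by apply: le_trans (ler_normD _ _) _; rewrite mulrDl lerD.
Qed.

Global Instance bO_opp k F : bO k F -> bO k (fun s t u => - F s t u).
Proof. by move=> [C H]; exists C; apply: (eventually0_mono H) => s t u _ _; rewrite normrN. Qed.

Global Instance bO_mul j k F G : bO j F -> bO k G -> bO (j + k) (fun s t u => F s t u * G s t u).
Proof.
move=> /bO_boundP[C C0 HF] /bO_boundP[D D0 HG]; exists (C * D).
apply: (eventually0_mono (eventually0_and HF HG)) => s t u s0 t0 [h1 h2].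
by rewrite normrM exprD mulrACA ler_pM.
Qed.

Global Instance bO_exp k m F : bO k F -> bO (k * m) (fun s t u => F s t u ^+ m).
Proof.
move=> /bO_boundP[C C0 HF]; exists (C ^+ m); apply: (eventually0_mono HF) => s t u s0 t0 h.
by rewrite normrX exprM -exprMn lerXn2r// nnegrE// mulr_ge0// exprn_ge0// addr_ge0// ltW.
Qed.

Global Instance bO_sum (I : finType) k (F : I -> R -> R -> 'rV[R]_n -> R) :
  (forall i, bO k (F i)) -> bO k (fun s t u => \sum_i F i s t u).
Proof.
move=> H; have /choice[C HC] : forall i, exists C : R,
    eventually0 (fun s t u => `|F i s t u| <= C * (s + t) ^+ k) by move=> i; exact: (H i).
exists (\sum_i C i); apply: (eventually0_mono (eventually0_forall HC)) => s t u s0 t0 h.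
rewrite mulr_suml; apply: le_trans (ler_norm_sum _ _ _) _.
by apply: ler_sum => i _; exact: h.
Qed.

Lemma bO_small k F (e : R) : bO k F -> (0 < k)%N -> 0 < e -> eventually0 (fun s t u => `|F s t u| <= e).
Proof.
move=> Fk k0 e0; have /bO_boundP[C C0 [d d0 H]] := bO_weaken Fk k0.
exists (Num.min d (e / (2 * (C + 1)))).
  by rewrite lt_min d0 divr_gt0// mulr_gt0// ltr_wpDl.
move=> s t u s0 t0; rewrite !lt_min => /andP[sd s1] /andP[td t1].
apply: le_trans (H s t u s0 t0 sd td) _; rewrite expr1.
have C1 : 0 < 2 * (C + 1) by rewrite mulr_gt0// ltr_wpDl.
rewrite ltr_pdivlMr// in s1; rewrite ltr_pdivlMr// in t1.
have : 0 < s * 2 by rewrite mulr_gt0.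
have : 0 < t * 2 by rewrite mulr_gt0.
lra.
Qed.

Lemma bO_enorm k (V : R -> R -> 'rV[R]_n -> 'rV[R]_n) : (forall p, bO k (fun s t u => V s t u 0 p)) ->
  bO k (fun s t u => enorm (V s t u)).
Proof.
move=> H; have /choice[C HC] : forall p, exists C : R,
    eventually0 (fun s t u => `|V s t u 0 p| <= C * (s + t) ^+ k) by move=> i; exact: (H i).
exists (Num.sqrt n%:R * \sum_p `|C p|); apply: (eventually0_mono (eventually0_forall HC)) => s t u s0 t0 h.
have st0 : 0 <= (s + t) ^+ k by rewrite exprn_ge0// addr_ge0// ltW.
rewrite ger0_norm ?enorm_ge0// -mulrA; apply: enorm_le.
  by rewrite mulr_ge0// sumr_ge0.
move=> p; apply: le_trans (h p) _; rewrite ler_wpM2r//.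
by apply: le_trans (ler_norm _) _; rewrite (bigD1 p)//= lerDl sumr_ge0.
Qed.

Lemma bO_teval_diff k a (S : R -> R -> 'rV[R]_n -> 'rV[R]_n) :
  (forall p, bO k (fun s t u => S s t u 0 p - u 0 p)) ->
  bO k (fun s t u => teval a (S s t u) - teval a u).
Proof.
move=> HS; have [L aL] := teval_lipschitz a.
have H : bO k (fun s t u => enorm (S s t u - u)).
  by apply: bO_enorm => p; apply: bO_ext (HS p) _ => s t u _ _; rewrite !mxE.
apply: (@bO_le k k _ (fun s t u => L * enorm (S s t u - u))) => //.
  exact: (@bO_weaken (0 + k)).
apply: eventually0_all => s t u _ _.
have := aL u (S s t u - u); rewrite (_ : u + (S s t u - u) = S s t u); last by rewrite addrC subrK.
by move=> /le_trans; apply; exact: ler_norm.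
Qed.

Lemma bO_teval_taylor k a (S : R -> R -> 'rV[R]_n -> 'rV[R]_n) :
  (forall p, bO k (fun s t u => S s t u 0 p - u 0 p)) ->
  bO (k * 2) (fun s t u => teval a (S s t u) - teval a u
    - \sum_p teval (tD p a) u * (S s t u 0 p - u 0 p)).
Proof.
move=> HS; have [L aL] := teval_taylor a.
have H : bO k (fun s t u => enorm (S s t u - u)).
  by apply: bO_enorm => p; apply: bO_ext (HS p) _ => s t u _ _; rewrite !mxE.
apply: (@bO_le (0 + k * 2) (k * 2) _ (fun s t u => L * enorm (S s t u - u) ^+ 2)) => //.
apply: eventually0_all => s t u _ _.
have := aL u (S s t u - u); rewrite (_ : u + (S s t u - u) = S s t u); last by rewrite addrC subrK.
rewrite (eq_bigr (fun p => teval (tD p a) u * (S s t u 0 p - u 0 p))); last by move=> p _; rewrite !mxE.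
by move=> /le_trans; apply; exact: ler_norm.
Qed.

(* Expands square roots: [F] is the error, [G] the sum of the root and its approximation. *)
Lemma bO_factor k F G (c : R) : 0 < c -> bO k (fun s t u => F s t u * G s t u) ->
  eventually0 (fun s t u => c <= G s t u) -> bO k F.
Proof.
move=> c0 FG Gc; apply: (@bO_le k k _ (fun s t u => c^-1 * (F s t u * G s t u))) => //.
  exact: (@bO_weaken (0 + k)).
apply: (eventually0_mono Gc) => s t u _ _ cG; rewrite !normrM mulrCA.
rewrite ler_peMr// gtr0_norm ?invr_gt0// mulrC ler_pdivlMr// mul1r.
exact: le_trans (ler_norm _).
Qed.

End BigO.

(** Resolution produces an order that is a closed number, and [isT] checks by computation that it is
    at least the one requested. *)
Ltac bO_tac := eapply bO_weaken; [typeclasses eauto | exact isT].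

(** * Fourth-order expansion of the cone cost *)

Section ConeExponential.
Context {R : realType} {n : nat}.
Implicit Types (v : 'rV[R]_n) (a : R).

Lemma enormZ (c : R) v : enorm (c *: v) = `|c| * enorm v.
Proof.
rewrite /enorm -sqrtr_sqr -sqrtrM ?sqr_ge0//; congr Num.sqrt.
by rewrite /dot mulr_sumr; apply: eq_bigr => p _; rewrite !mxE; ring.
Qed.

Lemma enorm_eq0 v : enorm v = 0 -> v = 0.
Proof.
move=> v0; apply/rowP => p; rewrite mxE; apply/eqP; rewrite -normr_le0 -v0.
exact: coord_le_enorm.
Qed.

Definition sinc (x : R) := if x == 0 then 1 else sin x / x.

Lemma sincE x : sin x = x * sinc x.
Proof.
rewrite /sinc; case: eqVneq => [->|x0]; first by rewrite sin0 mul0r.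
by rewrite mulrC divfK.
Qed.

Lemma sinc_taylor4 x : 0 <= x -> `|sinc x - (1 - x ^+ 2 / 6)| <= x ^+ 4.
Proof.
move=> x0; rewrite /sinc; case: eqVneq => [->|xn0].
  by rewrite !expr0n/= mul0r subr0 subrr normr0.
have xp : 0 < x by rewrite lt_neqAle eq_sym xn0.
rewrite -(ler_pM2l xp) -{1}(gtr0_norm xp) -normrM.
have -> : x * (sin x / x - (1 - x ^+ 2 / 6)) = sin x - (x - x ^+ 3 / 6) by field.
by rewrite -exprS; exact: sin_taylor5.
Qed.

(** The point (a, |v|) of the plane in polar coordinates has radius [modulus a v] and angle
    [enorm (polar a v)]. From a point of radius 1, with a = 1 + 2 s phi and v = s grad phi, the
    exponential moves the base point by [polar a v] and leads to the radius [modulus a v]. *)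
Definition polar a v : 'rV[R]_n := (atan (enorm v / a) / enorm v) *: v.
Definition modulus a v : R := Num.sqrt (a ^+ 2 + enorm v ^+ 2).

Lemma sqr_modulus a v : modulus a v ^+ 2 = a ^+ 2 + enorm v ^+ 2.
Proof. by rewrite sqr_sqrtr// addr_ge0 ?sqr_ge0. Qed.

Lemma modulus_gt0 a v : 0 < a -> 0 < modulus a v.
Proof. by move=> a0; rewrite sqrtr_gt0 ltr_pwDl ?exprn_gt0// sqr_ge0. Qed.

Lemma modulus_ge a v : 0 < a -> a <= modulus a v.
Proof.
move=> a0; rewrite -ler_sqr ?nnegrE ?(ltW a0) ?(ltW (modulus_gt0 v a0))// sqr_modulus lerDl.
exact: sqr_ge0.
Qed.

Lemma atan_ge0 (x : R) : 0 <= x -> 0 <= atan x.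
Proof. by move=> x0; rewrite -(@atan0 R) le_atan. Qed.

Lemma enorm_polar a v : 0 < a -> enorm (polar a v) = atan (enorm v / a).
Proof.
move=> a0; rewrite enormZ.
have [v0|v0] := eqVneq (enorm v) 0; first by rewrite v0 mul0r mulr0 atan0.
have vp : 0 < enorm v by rewrite lt_neqAle eq_sym v0 enorm_ge0.
rewrite ger0_norm ?divfK// divr_ge0 ?enorm_ge0// atan_ge0// divr_ge0 ?enorm_ge0//.
exact: ltW.
Qed.

Lemma enorm_polar_le a v : 0 < a -> enorm (polar a v) <= enorm v / a.
Proof.
move=> a0; rewrite enorm_polar//.
have h : 0 <= enorm v / a by rewrite divr_ge0 ?enorm_ge0// ltW.
by have /andP[] := atan_taylor h; rewrite subr_ge0.
Qed.

Lemma modulus_cos a v : 0 < a -> modulus a v * cos (enorm (polar a v)) = a.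
Proof.
move=> a0; rewrite enorm_polar// cos_atan.
have -> : modulus a v = a * Num.sqrt (1 + (enorm v / a) ^+ 2).
  rewrite /modulus (_ : a ^+ 2 + _ = a ^+ 2 * (1 + (enorm v / a) ^+ 2)).
    by rewrite sqrtrM ?sqr_ge0// sqrtr_sqr gtr0_norm.
  by field; rewrite gt_eqF.
rewrite -mulrA divff ?mulr1// gt_eqF// sqrtr_gt0.
by rewrite ltr_pwDl// sqr_ge0.
Qed.

Lemma modulus_sin a v : 0 < a -> modulus a v * sin (enorm (polar a v)) = enorm v.
Proof.
move=> a0; have := modulus_cos v a0; rewrite enorm_polar//; set x := enorm v / a => xa.
have tx : sin (atan x) = x * cos (atan x).
  transitivity (tan (atan x) * cos (atan x)); last by rewrite atanK.
  rewrite /tan divfK// cos_atan gt_eqF// invr_gt0 sqrtr_gt0.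
  by rewrite ltr_pwDl// sqr_ge0.
by rewrite tx mulrCA xa /x divfK// gt_eqF.
Qed.

Lemma modulus_sinc a v p : 0 < a -> modulus a v * sinc (enorm (polar a v)) * polar a v 0 p = v 0 p.
Proof.
move=> a0; have [v0|v0] := eqVneq (enorm v) 0.
  by rewrite (enorm_eq0 v0) /polar scaler0 mxE mulr0.
have vp : 0 < enorm v by rewrite lt_neqAle eq_sym v0 enorm_ge0.
have h := modulus_sin v a0; rewrite sincE in h.
have -> : polar a v 0 p = enorm (polar a v) / enorm v * v 0 p by rewrite enorm_polar// mxE.
have -> : modulus a v * sinc (enorm (polar a v)) * (enorm (polar a v) / enorm v * v 0 p) =
  (modulus a v * (enorm (polar a v) * sinc (enorm (polar a v)))) / enorm v * v 0 p by ring.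
by rewrite h divff// mul1r.
Qed.

End ConeExponential.

Section ConeExpansion.
Context {R : realType} {n : nat}.
Local Notation fam := (R -> R -> 'rV[R]_n -> R).
Local Notation vfam := (R -> R -> 'rV[R]_n -> 'rV[R]_n).
Variables (h : fam) (v : vfam).
Hypotheses (Hh : bO 1 h) (Hv : forall p, bO 1 (fun s t u => v s t u 0 p)).
Let a : fam := fun s t u => 1 + 2 * h s t u.
Let Th : vfam := fun s t u => polar (a s t u) (v s t u).
Let r : fam := fun s t u => modulus (a s t u) (v s t u).

Lemma amp_ge : eventually0 (fun s t u => 2^-1 <= a s t u).
Proof.
apply: (eventually0_mono (bO_small (e := 4^-1) Hh isT _)); first by rewrite invr_gt0.
by move=> s t u s0 t0; rewrite ler_norml /a => /andP[? _]; lra.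
Qed.

Lemma bO_enorm_v : bO 1 (fun s t u => enorm (v s t u)).
Proof. exact: bO_enorm. Qed.

Lemma bO_polar p : bO 1 (fun s t u => Th s t u 0 p).
Proof.
have H := bO_enorm_v.
apply: (@bO_le _ _ 1 1 _ (fun s t u => 2 * enorm (v s t u))) => //; first by bO_tac.
apply: (eventually0_mono amp_ge) => s t u _ _ a2.
have a0 : 0 < a s t u by apply: lt_le_trans a2; rewrite invr_gt0.
apply: le_trans (coord_le_enorm _ _) _; apply: le_trans (enorm_polar_le _ a0) _.
rewrite [leRHS]ger0_norm ?mulr_ge0 ?enorm_ge0// mulrC ler_wpM2r ?enorm_ge0//.
by rewrite -[leRHS]invrK lef_pV2 ?posrE ?invr_gt0.
Qed.

Lemma bO_modulus2 : bO 2 (fun s t u => r s t u - a s t u).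
Proof.
have H := bO_enorm_v.
apply: (@bO_factor _ _ 2 _ (fun s t u => r s t u + a s t u) 2^-1); first by rewrite invr_gt0.
  apply: (@bO_ext _ _ 2 _ (fun s t u => enorm (v s t u) ^+ 2)); first by bO_tac.
  by move=> s t u _ _; rewrite -subr_sqr sqr_modulus; ring.
apply: (eventually0_mono amp_ge) => s t u _ _ a2.
have a0 : 0 < a s t u by apply: lt_le_trans a2; rewrite invr_gt0.
by have := modulus_ge (v s t u) a0; rewrite -/(r s t u); lra.
Qed.

Lemma bO_amp : bO 0 a. Proof. rewrite /a; bO_tac. Qed.

Lemma bO_modulus0 : bO 0 r.
Proof.
have H := bO_modulus2; have H' := bO_amp.
apply: (@bO_ext _ _ 0 _ (fun s t u => (r s t u - a s t u) + a s t u)); first by bO_tac.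
by move=> s t u _ _; ring.
Qed.

Lemma bO_modulus3 : bO 3 (fun s t u => r s t u - (a s t u + \sum_p v s t u 0 p ^+ 2 / 2)).
Proof.
have H := bO_enorm_v.
apply: (@bO_factor _ _ 3 _ (fun s t u => r s t u + (a s t u + enorm (v s t u) ^+ 2 / 2)) 2^-1); first by rewrite invr_gt0.
  apply: (@bO_ext _ _ 3 _ (fun s t u => enorm (v s t u) ^+ 2 * (- (2 * h s t u)) - enorm (v s t u) ^+ 4 / 4)).
    by bO_tac.
  by move=> s t u _ _; rewrite -mulr_suml -sqr_enorm -subr_sqr sqr_modulus /a; field.
apply: (eventually0_mono amp_ge) => s t u _ _ a2.
have a0 : 0 < a s t u by apply: lt_le_trans a2; rewrite invr_gt0.
have := modulus_ge (v s t u) a0; rewrite -/(r s t u).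
have := sqr_ge0 (enorm (v s t u)); lra.
Qed.

Lemma bO_enorm_polar : bO 1 (fun s t u => enorm (Th s t u)).
Proof. by apply: bO_enorm; exact: bO_polar. Qed.

Lemma bO_sinc : bO 4 (fun s t u => sinc (enorm (Th s t u)) - (1 - enorm (Th s t u) ^+ 2 / 6)).
Proof.
have H := bO_enorm_polar.
apply: (@bO_le _ _ 4 4 _ (fun s t u => enorm (Th s t u) ^+ 4)) => //; first by bO_tac.
apply: eventually0_all => s t u _ _; apply: le_trans (sinc_taylor4 (enorm_ge0 _)) _.
exact: ler_norm.
Qed.

(** Exactly, v = r sinc |T| T for T the polar displacement, and sinc - 1 is quadratic in |T|. *)
Lemma bO_modulus_polar p : bO 3 (fun s t u => r s t u * Th s t u 0 p - v s t u 0 p).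
Proof.
have H1 := bO_enorm_polar; have H2 := bO_modulus0; have H3 := bO_polar p; have H4 := bO_sinc.
apply: (@bO_eventually_ext _ _ 3 _ (fun s t u => r s t u * Th s t u 0 p *
  (enorm (Th s t u) ^+ 2 / 6 - (sinc (enorm (Th s t u)) - (1 - enorm (Th s t u) ^+ 2 / 6))))).
  by bO_tac.
apply: (eventually0_mono amp_ge) => s t u _ _ a2.
have a0 : 0 < a s t u by apply: lt_le_trans a2; rewrite invr_gt0.
by rewrite -(modulus_sinc (v s t u) p a0) -/(r s t u) -/(Th s t u); ring.
Qed.

Lemma bO_polar2 p : bO 2 (fun s t u => Th s t u 0 p - v s t u 0 p).
Proof.
have H1 := bO_modulus_polar p; have H2 := bO_modulus2; have H3 := bO_polar p.
apply: (@bO_ext _ _ 2 _ (fun s t u => (r s t u * Th s t u 0 p - v s t u 0 p)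
  - ((r s t u - a s t u) + 2 * h s t u) * Th s t u 0 p)); first by bO_tac.
by move=> s t u _ _; rewrite /a; ring.
Qed.

Lemma bO_polar3 p : bO 3 (fun s t u => Th s t u 0 p - (1 - 2 * h s t u) * v s t u 0 p).
Proof.
have H1 := bO_modulus_polar p; have H2 := bO_modulus2; have H3 := bO_polar p.
apply: (@bO_ext _ _ 3 _ (fun s t u => (1 - 2 * h s t u) * ((r s t u * Th s t u 0 p - v s t u 0 p)
  - (r s t u - a s t u) * Th s t u 0 p) + 4 * h s t u ^+ 2 * Th s t u 0 p)); first by bO_tac.
by move=> s t u _ _; rewrite /a; ring.
Qed.

Lemma bO_cos_enorm (V : vfam) : (forall p, bO 1 (fun s t u => V s t u 0 p)) ->
  bO 6 (fun s t u => cos (enorm (V s t u)) - (1 - enorm (V s t u) ^+ 2 / 2 + (enorm (V s t u) ^+ 2) ^+ 2 / 24)).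
Proof.
move=> /bO_enorm H.
apply: (@bO_le _ _ 6 6 _ (fun s t u => enorm (V s t u) ^+ 6)) => //; first by bO_tac.
apply: eventually0_all => s t u _ _; rewrite -exprM; apply: le_trans (cos_taylor6 _) _.
exact: ler_norm.
Qed.

End ConeExpansion.

Section ChordBracket.
Context {R : realType} {n : nat}.
Local Notation fam := (R -> R -> 'rV[R]_n -> R).
Variables (x y z m e cw c1 c2 k1 k2 : fam).
Hypotheses (Hx : bO 2 x) (Hy : bO 2 y) (Hz : bO 2 z) (Hm : bO 3 m) (He : bO 4 e).
Let q : fam := fun s t u => x s t u + y s t u - 2 * z s t u + 2 * m s t u + e s t u.
Hypotheses
  (Hcw : bO 6 (fun s t u => cw s t u - (1 - q s t u / 2 + q s t u ^+ 2 / 24)))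
  (Hc1 : bO 6 (fun s t u => c1 s t u - (1 - x s t u / 2 + x s t u ^+ 2 / 24)))
  (Hc2 : bO 6 (fun s t u => c2 s t u - (1 - y s t u / 2 + y s t u ^+ 2 / 24)))
  (Hk1 : bO 4 (fun s t u => k1 s t u - (1 - x s t u / 6)))
  (Hk2 : bO 4 (fun s t u => k2 s t u - (1 - y s t u / 6))).

(** In the application x = |T1|^2, y = |T2|^2, z = T1 . T2, m = (T1 - T2) . d and e = |d|^2, so that
    q is the squared norm of T2 - T1 - d. For parallel T1, T2 and d = 0 the bracket vanishes by the
    addition formula for cosines; in general its leading term (z^2 - x y) / 6 measures the angle
    between T1 and T2, and it is the origin of the curvature Sec_up. *)
Lemma chord_bracket : bO 5 (fun s t u =>
  cw s t u - c1 s t u * c2 s t u - k1 s t u * k2 s t u * z s t u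
  - ((z s t u ^+ 2 - x s t u * y s t u) / 6 - m s t u - e s t u / 2)).
Proof.
apply: (@bO_ext _ _ 5 _ (fun s t u => (cw s t u - (1 - q s t u / 2 + q s t u ^+ 2 / 24))
  - (c1 s t u - (1 - x s t u / 2 + x s t u ^+ 2 / 24)) *
    ((1 - y s t u / 2 + y s t u ^+ 2 / 24) + (c2 s t u - (1 - y s t u / 2 + y s t u ^+ 2 / 24)))
  - (1 - x s t u / 2 + x s t u ^+ 2 / 24) * (c2 s t u - (1 - y s t u / 2 + y s t u ^+ 2 / 24))
  - ((k1 s t u - (1 - x s t u / 6)) * ((1 - y s t u / 6) + (k2 s t u - (1 - y s t u / 6)))
     + (1 - x s t u / 6) * (k2 s t u - (1 - y s t u / 6))) * z s t u
  + (((x s t u * y s t u ^+ 2 + x s t u ^+ 2 * y s t u) / 48 - x s t u ^+ 2 * y s t u ^+ 2 / 576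
       - x s t u * y s t u * z s t u / 36)
    + (2 * (x s t u + y s t u - 2 * z s t u) * (2 * m s t u + e s t u) + (2 * m s t u + e s t u) ^+ 2) / 24))).
  by bO_tac.
move=> s t u _ _.
have id1 (W C c D C1 C2 Q K1 K2 k k' A : R) : W - C * c - k * k' * D - A =
    (W - Q) - (C - C1) * (C2 + (c - C2)) - C1 * (c - C2)
    - ((k - K1) * (K2 + (k' - K2)) + K1 * (k' - K2)) * D + (Q - C1 * C2 - K1 * K2 * D - A) by ring.
rewrite [LHS](id1 _ _ _ _ (1 - x s t u / 2 + x s t u ^+ 2 / 24) (1 - y s t u / 2 + y s t u ^+ 2 / 24)
    (1 - q s t u / 2 + q s t u ^+ 2 / 24) (1 - x s t u / 6) (1 - y s t u / 6)).
congr (_ + _); rewrite /q.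
by move: (x s t u) (y s t u) (z s t u) (m s t u) (e s t u) => X Y Z M E; field.
Qed.

End ChordBracket.

Section Chord.
Context {R : realType} {n : nat}.
Local Notation fam := (R -> R -> 'rV[R]_n -> R).
Local Notation vfam := (R -> R -> 'rV[R]_n -> 'rV[R]_n).
Variables (h1 h2 : fam) (v1 v2 d : vfam).
Hypotheses (Hh1 : bO 1 h1) (Hh2 : bO 1 h2).
Hypotheses (Hv1 : forall p, bO 1 (fun s t u => v1 s t u 0 p))
  (Hv2 : forall p, bO 1 (fun s t u => v2 s t u 0 p))
  (Hd : forall p, bO 2 (fun s t u => d s t u 0 p)).
Let a1 : fam := fun s t u => 1 + 2 * h1 s t u.
Let a2 : fam := fun s t u => 1 + 2 * h2 s t u.
Let T1 : vfam := fun s t u => polar (a1 s t u) (v1 s t u).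
Let T2 : vfam := fun s t u => polar (a2 s t u) (v2 s t u).
Let r1 : fam := fun s t u => modulus (a1 s t u) (v1 s t u).
Let r2 : fam := fun s t u => modulus (a2 s t u) (v2 s t u).
Let w : vfam := fun s t u => T2 s t u - T1 s t u - d s t u.

(** By [modulus_cos] and [modulus_sinc], a1 a2 + v1 . v2 is exactly r1 r2 times the two terms
    subtracted from the cosine in [chord_bracket]. Only the bracket, already small, has to be
    expanded, and the factor r1 r2 = 1 + O(s + t) in front of it matters only for the term in d. *)
Lemma bO_chord : bO 5 (fun s t u => r1 s t u * r2 s t u * cos (enorm (w s t u)) -
  (a1 s t u * a2 s t u + \sum_p v1 s t u 0 p * v2 s t u 0 p
   + ((\sum_p v1 s t u 0 p * v2 s t u 0 p) ^+ 2
      - (\sum_p v1 s t u 0 p ^+ 2) * \sum_p v2 s t u 0 p ^+ 2) / 6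
   - \sum_p (a2 s t u * v1 s t u 0 p - a1 s t u * v2 s t u 0 p) * d s t u 0 p
   - (\sum_p d s t u 0 p ^+ 2) / 2)).
Proof.
have HT1 p : bO 1 (fun s t u => T1 s t u 0 p) := bO_polar Hh1 Hv1 p.
have HT2 p : bO 1 (fun s t u => T2 s t u 0 p) := bO_polar Hh2 Hv2 p.
have Hw p : bO 1 (fun s t u => w s t u 0 p).
  apply: (@bO_ext _ _ 1 _ (fun s t u => T2 s t u 0 p - T1 s t u 0 p - d s t u 0 p)); first by bO_tac.
  by move=> s t u _ _; rewrite !mxE.
have HC := bO_cos_enorm Hw.
have HC1 := bO_cos_enorm HT1; have HC2 := bO_cos_enorm HT2.
have HS1 := bO_sinc Hh1 Hv1; have HS2 := bO_sinc Hh2 Hv2.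
rewrite -/T1 in HS1; rewrite -/T2 in HS2.
pose x : fam := fun s t u => \sum_p T1 s t u 0 p ^+ 2.
pose y : fam := fun s t u => \sum_p T2 s t u 0 p ^+ 2.
pose z : fam := fun s t u => \sum_p T1 s t u 0 p * T2 s t u 0 p.
pose m : fam := fun s t u => \sum_p (T1 s t u 0 p - T2 s t u 0 p) * d s t u 0 p.
pose e : fam := fun s t u => \sum_p d s t u 0 p ^+ 2.
have Hx : bO 2 x by rewrite /x; bO_tac.
have Hy : bO 2 y by rewrite /y; bO_tac.
have Hz : bO 2 z by rewrite /z; bO_tac.
have Hm : bO 3 m by rewrite /m; bO_tac.
have He : bO 4 e by rewrite /e; bO_tac.
have qE s t u : enorm (w s t u) ^+ 2 = x s t u + y s t u - 2 * z s t u + 2 * m s t u + e s t u.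
  rewrite sqr_enorm /x /y /z /m /e !mulr_sumr -sumrN -!big_split/=.
  by apply: eq_bigr => p _; rewrite !mxE; ring.
have xE s t u : enorm (T1 s t u) ^+ 2 = x s t u by rewrite sqr_enorm.
have yE s t u : enorm (T2 s t u) ^+ 2 = y s t u by rewrite sqr_enorm.
pose B : fam := fun s t u => cos (enorm (w s t u)) - cos (enorm (T1 s t u)) * cos (enorm (T2 s t u))
  - sinc (enorm (T1 s t u)) * sinc (enorm (T2 s t u)) * z s t u.
have HB : bO 5 (fun s t u => B s t u - ((z s t u ^+ 2 - x s t u * y s t u) / 6 - m s t u - e s t u / 2)).
  apply: (@chord_bracket _ _ x y z m e (fun s t u => cos (enorm (w s t u))) (fun s t u => cos (enorm (T1 s t u)))
    (fun s t u => cos (enorm (T2 s t u))) (fun s t u => sinc (enorm (T1 s t u))) (fun s t u => sinc (enorm (T2 s t u)))) => //.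
  - by apply: (bO_ext HC) => s t u _ _; rewrite qE.
  - by apply: (bO_ext HC1) => s t u _ _; rewrite xE.
  - by apply: (bO_ext HC2) => s t u _ _; rewrite yE.
  - by apply: (bO_ext HS1) => s t u _ _; rewrite xE.
  - by apply: (bO_ext HS2) => s t u _ _; rewrite yE.
have Hr1 : bO 0 r1 := bO_modulus0 Hh1 Hv1.
have Hr2 : bO 0 r2 := bO_modulus0 Hh2 Hv2.
have HR1 : bO 2 (fun s t u => r1 s t u - a1 s t u) := bO_modulus2 Hh1 Hv1.
have HR2 : bO 2 (fun s t u => r2 s t u - a2 s t u) := bO_modulus2 Hh2 Hv2.
have HRT1 p : bO 3 (fun s t u => r1 s t u * T1 s t u 0 p - v1 s t u 0 p) := bO_modulus_polar Hh1 Hv1 p.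
have HRT2 p : bO 3 (fun s t u => r2 s t u * T2 s t u 0 p - v2 s t u 0 p) := bO_modulus_polar Hh2 Hv2 p.
have Hrr : bO 1 (fun s t u => r1 s t u * r2 s t u - 1).
  apply: (@bO_ext _ _ 1 _ (fun s t u => ((r1 s t u - a1 s t u) + 2 * h1 s t u) * r2 s t u
     + ((r2 s t u - a2 s t u) + 2 * h2 s t u))); first by bO_tac.
  by move=> s t u _ _; rewrite /a1 /a2; ring.
have HD1 p : bO 2 (fun s t u => T1 s t u 0 p - v1 s t u 0 p) := bO_polar2 Hh1 Hv1 p.
have HD2 p : bO 2 (fun s t u => T2 s t u 0 p - v2 s t u 0 p) := bO_polar2 Hh2 Hv2 p.
pose x0 : fam := fun s t u => \sum_p v1 s t u 0 p ^+ 2.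
pose y0 : fam := fun s t u => \sum_p v2 s t u 0 p ^+ 2.
pose z0 : fam := fun s t u => \sum_p v1 s t u 0 p * v2 s t u 0 p.
have Hx0 : bO 2 x0 by rewrite /x0; bO_tac.
have Hy0 : bO 2 y0 by rewrite /y0; bO_tac.
have Hz0 : bO 2 z0 by rewrite /z0; bO_tac.
have Hxx : bO 3 (fun s t u => x s t u - x0 s t u).
  apply: (@bO_ext _ _ 3 _ (fun s t u => \sum_p (T1 s t u 0 p - v1 s t u 0 p) * (T1 s t u 0 p + v1 s t u 0 p))); first by bO_tac.
  by move=> s t u _ _; rewrite -sumrB; apply: eq_bigr => p _; ring.
have Hyy : bO 3 (fun s t u => y s t u - y0 s t u).
  apply: (@bO_ext _ _ 3 _ (fun s t u => \sum_p (T2 s t u 0 p - v2 s t u 0 p) * (T2 s t u 0 p + v2 s t u 0 p))); first by bO_tac.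
  by move=> s t u _ _; rewrite -sumrB; apply: eq_bigr => p _; ring.
have Hzz : bO 3 (fun s t u => z s t u - z0 s t u).
  apply: (@bO_ext _ _ 3 _ (fun s t u => \sum_p ((T1 s t u 0 p - v1 s t u 0 p) * T2 s t u 0 p + v1 s t u 0 p * (T2 s t u 0 p - v2 s t u 0 p)))); first by bO_tac.
  by move=> s t u _ _; rewrite -sumrB; apply: eq_bigr => p _; ring.
pose m0 : fam := fun s t u => \sum_p (a2 s t u * v1 s t u 0 p - a1 s t u * v2 s t u 0 p) * d s t u 0 p.
have Hmm : bO 5 (fun s t u => r1 s t u * r2 s t u * m s t u - m0 s t u).
  apply: (@bO_ext _ _ 5 _ (fun s t u => \sum_p
     (r2 s t u * (r1 s t u * T1 s t u 0 p - v1 s t u 0 p) + (r2 s t u - a2 s t u) * v1 s t u 0 p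
      - r1 s t u * (r2 s t u * T2 s t u 0 p - v2 s t u 0 p) - (r1 s t u - a1 s t u) * v2 s t u 0 p) * d s t u 0 p)); first by bO_tac.
  by move=> s t u _ _; rewrite /m /m0 mulr_sumr -sumrB; apply: eq_bigr => p _; ring.
apply: (@bO_eventually_ext _ _ 5 _ (fun s t u =>
   r1 s t u * r2 s t u * (B s t u - ((z s t u ^+ 2 - x s t u * y s t u) / 6 - m s t u - e s t u / 2))
   + (r1 s t u * r2 s t u - 1) * ((z s t u ^+ 2 - x s t u * y s t u) / 6 - e s t u / 2)
   + ((z s t u - z0 s t u) * (z s t u + z0 s t u) - (x s t u - x0 s t u) * y s t u - x0 s t u * (y s t u - y0 s t u)) / 6
   - (r1 s t u * r2 s t u * m s t u - m0 s t u))); first by bO_tac.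
apply: (eventually0_mono (eventually0_and (amp_ge Hh1) (amp_ge Hh2))) => s t u _ _ [ha1 ha2].
have a10 : 0 < a1 s t u by apply: lt_le_trans ha1; rewrite invr_gt0.
have a20 : 0 < a2 s t u by apply: lt_le_trans ha2; rewrite invr_gt0.
rewrite -/(z0 s t u) -/(x0 s t u) -/(y0 s t u) -/(m0 s t u) -/(e s t u).
have Ea : a1 s t u * a2 s t u = r1 s t u * r2 s t u * (cos (enorm (T1 s t u)) * cos (enorm (T2 s t u))).
  by rewrite mulrACA [r1 s t u * _](modulus_cos _ a10) [r2 s t u * _](modulus_cos _ a20).
have Ez : z0 s t u = r1 s t u * r2 s t u * (sinc (enorm (T1 s t u)) * sinc (enorm (T2 s t u)) * z s t u).
  rewrite /z0 /z !mulr_sumr; apply: eq_bigr => p _.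
  rewrite -{1}(modulus_sinc (v1 s t u) p a10) -{1}(modulus_sinc (v2 s t u) p a20).
  by rewrite -/(r1 s t u) -/(r2 s t u) -/(T1 s t u) -/(T2 s t u); ring.
have -> : a1 s t u * a2 s t u + z0 s t u = r1 s t u * r2 s t u * (cos (enorm (w s t u)) - B s t u).
  by rewrite Ea {1}Ez /B; ring.
by field.
Qed.

End Chord.

Section CostExpansion.
Context {R : realType} {n : nat}.
Local Notation fam := (R -> R -> 'rV[R]_n -> R).
Local Notation vfam := (R -> R -> 'rV[R]_n -> 'rV[R]_n).
Variables (phi psi D : tpoly (R := R) (n := n)) (Z : 'I_n -> tpoly (R := R) (n := n)).
Variables (S : vfam) (J : fam).

Definition tgrad (a : tpoly) (u : 'rV[R]_n) : 'rV[R]_n := \row_p teval (tD p a) u.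

Lemma tgradE (a : tpoly) u p : tgrad a u 0 p = teval (tD p a) u.
Proof. by rewrite mxE. Qed.

Definition amp (s : R) (a : tpoly (R := R) (n := n)) u : R := 1 + 2 * (s * teval a u).
Definition disp (s : R) (a : tpoly) u : 'rV[R]_n := polar (amp s a u) (s *: tgrad a u).
Definition radius (s : R) (a : tpoly) u : R := modulus (amp s a u) (s *: tgrad a u).

Hypothesis HS : forall p, bO 4 (fun s t u => S s t u 0 p - (u 0 p + s * t * teval (Z p) u)).
Hypothesis HJ : bO 4 (fun s t u => J s t u - (1 + s * t * teval D u)).

Let lam : fam := fun s t u => Num.sqrt (J s t u).

Lemma bO_shift p : bO 2 (fun s t u => S s t u 0 p - u 0 p).
Proof.
have H := HS p.
apply: (@bO_ext _ _ 2 _ (fun s t u => (S s t u 0 p - (u 0 p + s * t * teval (Z p) u)) + s * t * teval (Z p) u)); first by bO_tac.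
by move=> s t u _ _; ring.
Qed.

Lemma bO_teval_shift a : bO 4 (fun s t u => teval a (S s t u) - (teval a u
  + s * t * \sum_p teval (tD p a) u * teval (Z p) u)).
Proof.
have H := bO_teval_taylor a bO_shift; have H4 := HS.
apply: (@bO_ext _ _ 4 _ (fun s t u => (teval a (S s t u) - teval a u
    - \sum_p teval (tD p a) u * (S s t u 0 p - u 0 p)) +
    \sum_p teval (tD p a) u * (S s t u 0 p - (u 0 p + s * t * teval (Z p) u)))); first by bO_tac.
move=> s t u _ _.
have -> : \sum_p teval (tD p a) u * (S s t u 0 p - (u 0 p + s * t * teval (Z p) u)) =
  \sum_p teval (tD p a) u * (S s t u 0 p - u 0 p) - s * t * \sum_p teval (tD p a) u * teval (Z p) u.
  by rewrite mulr_sumr -sumrB; apply: eq_bigr => p _; ring.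
by move: (\sum_p _) (\sum_p _) => A B; ring.
Qed.

Lemma jac_gt : eventually0 (fun s t u => 2^-1 <= J s t u).
Proof.
have H : bO 1 (fun s t u => J s t u - 1).
  apply: (@bO_ext _ _ 1 _ (fun s t u => (J s t u - (1 + s * t * teval D u)) + s * t * teval D u)); first by bO_tac.
  by move=> s t u _ _; ring.
apply: (eventually0_mono (bO_small (e := 2^-1) H isT _)); first by rewrite invr_gt0.
by move=> s t u s0 t0; rewrite ler_norml => /andP[? _]; lra.
Qed.

Lemma bO_lam : bO 4 (fun s t u => lam s t u - (1 + s * t * teval D u / 2)).
Proof.
apply: (@bO_factor _ _ 4 _ (fun s t u => lam s t u + (1 + s * t * teval D u / 2)) 2^-1); first by rewrite invr_gt0.
  apply: (@bO_eventually_ext _ _ 4 _ (fun s t u => (J s t u - (1 + s * t * teval D u)) - (s * t * teval D u / 2) ^+ 2)).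
    by bO_tac.
  apply: (eventually0_mono jac_gt) => s t u _ _ J2; rewrite -subr_sqr sqr_sqrtr; first by field.
  by apply: le_trans J2; rewrite invr_ge0.
have H : bO 2 (fun s t u => s * t * teval D u) by bO_tac.
apply: (eventually0_mono (bO_small (e := 1) H isT ltr01)) => s t u _ _.
rewrite ler_norml => /andP[h _]; have := sqrtr_ge0 (J s t u); rewrite -/(lam s t u); lra.
Qed.

(** Cone cost between the flow of x along s phi, its radius multiplied by l, and the flow of u along
    t psi. It is written on the lift to R^n, where it is the true cost as soon as the displacement
    is at most pi. *)
Definition cone_step_cost (s t : R) (u x : 'rV[R]_n) (l : R) : R :=
  l ^+ 2 * radius s phi x ^+ 2 + radius t psi u ^+ 2
  - 2 * l * radius s phi x * radius t psi u
    * cos (enorm (u + disp t psi u - (x + disp s phi x))).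

Definition gap_density (s t : R) u : R :=
  4 * (s * teval phi u - t * teval psi u) ^+ 2
  + \sum_p (s * teval (tD p phi) u - t * teval (tD p psi) u) ^+ 2.

Definition hess_Z p u : R := \sum_q teval (tD q (tD p phi)) u * teval (Z q) u.

(* The terms of order at most four of the cost, besides [gap_density], for the coupling
   S = u + s t Z with mass J = 1 + s t D. *)
Definition cost_correction (s t : R) u : R :=
  let f := teval phi u in let g := teval psi u in let d := teval D u in
  let gp p := teval (tD p phi) u in let hp p := teval (tD p psi) u in
  let zp p := teval (Z p) u in let Hp p := hess_Z p u in
  let G11 := \sum_p gp p ^+ 2 in let G22 := \sum_p hp p ^+ 2 in
  let G12 := \sum_p gp p * hp p in
  let gZ := \sum_p gp p * zp p in let hZ := \sum_p hp p * zp p in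
  let ZZ := \sum_p zp p ^+ 2 in
  let gH := \sum_p gp p * Hp p in let hH := \sum_p hp p * Hp p in
  s ^+ 2 * t ^+ 2 * (G11 * G22 - G12 ^+ 2) / 3
  + s * t * (2 * s * gZ - 2 * t * hZ + 2 * (s * f - t * g) * d)
  + s ^+ 3 * t * (4 * f ^+ 2 * d + 8 * f * gZ + d * G11 + 2 * gH)
  + s ^+ 2 * t ^+ 2 * (d ^+ 2 / 4 - 4 * f * g * d - 8 * g * gZ - d * G12 - 2 * hH
      + 4 * g * gZ - 4 * f * hZ + ZZ).

(** By [bO_chord] the cost is the flat expression (lam a1 - a2)^2 + |lam v1 - v2|^2, corrected by
    the angular term K and by the terms m0 and e of the shift S - id. The quantities [X0] and [Xp]
    that are squared have order one, so that their expansion to order three determines the squares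
    to order four. *)
Lemma bO_cost : bO 5 (fun s t u => cone_step_cost s t u (S s t u) (lam s t u)
   - (gap_density s t u + cost_correction s t u)).
Proof.
pose gp p (u : 'rV[R]_n) := teval (tD p phi) u.
pose hp p (u : 'rV[R]_n) := teval (tD p psi) u.
pose zp p (u : 'rV[R]_n) := teval (Z p) u.
pose h1 : fam := fun s t u => s * teval phi (S s t u).
pose h2 : fam := fun s t u => t * teval psi u.
pose v1 : vfam := fun s t u => s *: tgrad phi (S s t u).
pose v2 : vfam := fun s t u => t *: tgrad psi u.
pose d : vfam := fun s t u => S s t u - u.
have v1E s t u p : v1 s t u 0 p = s * teval (tD p phi) (S s t u) by rewrite mxE tgradE.
have v2E s t u p : v2 s t u 0 p = t * hp p u by rewrite mxE tgradE.
have dE s t u p : d s t u 0 p = S s t u 0 p - u 0 p by rewrite !mxE.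
have Hh1 : bO 1 h1 by rewrite /h1; bO_tac.
have Hh2 : bO 1 h2 by rewrite /h2; bO_tac.
have Hv1 p : bO 1 (fun s t u => v1 s t u 0 p).
  by apply: (@bO_ext _ _ 1 _ (fun s t u => s * teval (tD p phi) (S s t u))) => //; bO_tac.
have Hv2 p : bO 1 (fun s t u => v2 s t u 0 p).
  by apply: (@bO_ext _ _ 1 _ (fun s t u => t * teval (tD p psi) u)) => //; bO_tac.
have Hd p : bO 2 (fun s t u => d s t u 0 p).
  by apply: (bO_ext (bO_shift p)).
have chord := bO_chord Hh1 Hh2 Hv1 Hv2 Hd.
pose a1 : fam := fun s t u => 1 + 2 * h1 s t u.
pose a2 : fam := fun s t u => 1 + 2 * h2 s t u.
pose K : fam := fun s t u => ((\sum_p v1 s t u 0 p * v2 s t u 0 p) ^+ 2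
      - (\sum_p v1 s t u 0 p ^+ 2) * \sum_p v2 s t u 0 p ^+ 2) / 6.
pose m0 : fam := fun s t u => \sum_p (a2 s t u * v1 s t u 0 p - a1 s t u * v2 s t u 0 p) * d s t u 0 p.
pose e : fam := fun s t u => \sum_p d s t u 0 p ^+ 2.
pose kap : fam := fun s t u => radius s phi (S s t u) * radius t psi u
    * cos (enorm (u + disp t psi u - (S s t u + disp s phi (S s t u))))
  - (a1 s t u * a2 s t u + \sum_p v1 s t u 0 p * v2 s t u 0 p + K s t u - m0 s t u - e s t u / 2).
have Hkap : bO 5 kap.
  apply: (bO_ext chord) => s t u _ _; rewrite /kap /K /m0 /e /a1 /a2; congr (_ * _ * cos (enorm _) - _).
  by apply/rowP => p; rewrite !mxE; ring.
have Hl4 := bO_lam.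
have Hl2 : bO 2 (fun s t u => lam s t u - 1).
  apply: (@bO_ext _ _ 2 _ (fun s t u => (lam s t u - (1 + s * t * teval D u / 2)) + s * t * teval D u / 2)); first by bO_tac.
  by move=> s t u _ _; ring.
have Hl0 : bO 0 lam.
  apply: (@bO_ext _ _ 0 _ (fun s t u => (lam s t u - 1) + 1)); first by bO_tac.
  by move=> s t u _ _; ring.
have Ha1 : bO 0 a1 by rewrite /a1; bO_tac.
have Ha2 : bO 0 a2 by rewrite /a2; bO_tac.
have Hf4 := bO_teval_shift phi.
have Hg4 p := bO_teval_shift (tD p phi).
pose X0 : fam := fun s t u => lam s t u * a1 s t u - a2 s t u.
pose Xp p : fam := fun s t u => lam s t u * v1 s t u 0 p - v2 s t u 0 p.
pose gZ u := \sum_p gp p u * zp p u.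
pose x1 : fam := fun s t u => 2 * (s * teval phi u) - 2 * (t * teval psi u).
pose x2 : fam := fun s t u => s * t * teval D u / 2.
pose x3 : fam := fun s t u => s ^+ 2 * t * (teval D u * teval phi u + 2 * gZ u).
pose y1 p : fam := fun s t u => s * gp p u - t * hp p u.
pose y3 p : fam := fun s t u => s ^+ 2 * t * (teval D u * gp p u / 2 + hess_Z p u).
have HgZ : bO 0 (fun _ _ u => gZ u) by rewrite /gZ; bO_tac.
have Hgp p : bO 0 (fun _ _ u => gp p u) by exact: bO_teval.
have Hhp p : bO 0 (fun _ _ u => hp p u) by exact: bO_teval.
have Hzp p : bO 0 (fun _ _ u => zp p u) by exact: bO_teval.
have HHp p : bO 0 (fun _ _ u => hess_Z p u) by rewrite /hess_Z; bO_tac.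
have Hx1 : bO 1 x1 by rewrite /x1; bO_tac.
have Hx2 : bO 2 x2 by rewrite /x2; bO_tac.
have Hx3 : bO 3 x3 by rewrite /x3; bO_tac.
have Hy1 p : bO 1 (y1 p) by rewrite /y1; bO_tac.
have Hy3 p : bO 3 (y3 p) by rewrite /y3; bO_tac.
have HX0 : bO 4 (fun s t u => X0 s t u - (x1 s t u + x2 s t u + x3 s t u)).
  apply: (@bO_ext _ _ 4 _ (fun s t u => (lam s t u - (1 + s * t * teval D u / 2)) * a1 s t u
    + (1 + s * t * teval D u / 2) * (2 * s * (teval phi (S s t u) - (teval phi u + s * t * gZ u)))
    + s * t * teval D u / 2 * (2 * s ^+ 2 * t * gZ u))); first by bO_tac.
  by move=> s t u _ _; rewrite /X0 /x1 /x2 /x3 /a1 /a2 /h1 /h2; field.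
have HXp p : bO 4 (fun s t u => Xp p s t u - (y1 p s t u + y3 p s t u)).
  apply: (@bO_ext _ _ 4 _ (fun s t u => (lam s t u - (1 + s * t * teval D u / 2)) * v1 s t u 0 p
    + (1 + s * t * teval D u / 2) * (s * (teval (tD p phi) (S s t u) - (gp p u + s * t * hess_Z p u)))
    + s * t * teval D u / 2 * (s ^+ 2 * t * hess_Z p u))); first by bO_tac.
  by move=> s t u _ _; rewrite /Xp /y1 /y3 v1E v2E; field.
have HX01 : bO 1 X0.
  apply: (@bO_ext _ _ 1 _ (fun s t u => (X0 s t u - (x1 s t u + x2 s t u + x3 s t u)) + (x1 s t u + x2 s t u + x3 s t u))); first by bO_tac.
  by move=> s t u _ _; rewrite subrK.
have HXp1 p : bO 1 (Xp p).
  apply: (@bO_ext _ _ 1 _ (fun s t u => (Xp p s t u - (y1 p s t u + y3 p s t u)) + (y1 p s t u + y3 p s t u))); first by bO_tac.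
  by move=> s t u _ _; rewrite subrK.
have HX02 : bO 5 (fun s t u => X0 s t u ^+ 2 - (x1 s t u ^+ 2 + 2 * x1 s t u * x2 s t u + x2 s t u ^+ 2 + 2 * x1 s t u * x3 s t u)).
  apply: (@bO_ext _ _ 5 _ (fun s t u => (X0 s t u - (x1 s t u + x2 s t u + x3 s t u)) * (X0 s t u + (x1 s t u + x2 s t u + x3 s t u))
     + 2 * x2 s t u * x3 s t u + x3 s t u ^+ 2)); first by bO_tac.
  by move=> s t u _ _; ring.
have HXp2 : bO 5 (fun s t u => \sum_p Xp p s t u ^+ 2 - \sum_p (y1 p s t u ^+ 2 + 2 * y1 p s t u * y3 p s t u)).
  apply: (@bO_ext _ _ 5 _ (fun s t u => \sum_p ((Xp p s t u - (y1 p s t u + y3 p s t u)) * (Xp p s t u + (y1 p s t u + y3 p s t u))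
     + y3 p s t u ^+ 2))); first by bO_tac.
  by move=> s t u _ _; rewrite -sumrB; apply: eq_bigr => p _; ring.
pose z0 : fam := fun s t u => \sum_p v1 s t u 0 p * v2 s t u 0 p.
pose w1 : fam := fun s t u => \sum_p v1 s t u 0 p ^+ 2.
pose w2 : fam := fun s t u => \sum_p v2 s t u 0 p ^+ 2.
pose G12 u := \sum_p gp p u * hp p u.
pose G11 u := \sum_p gp p u ^+ 2.
pose G22 u := \sum_p hp p u ^+ 2.
have HG12 : bO 0 (fun _ _ u => G12 u) by rewrite /G12; bO_tac.
have HG11 : bO 0 (fun _ _ u => G11 u) by rewrite /G11; bO_tac.
have HG22 : bO 0 (fun _ _ u => G22 u) by rewrite /G22; bO_tac.
have Hv1s p : bO 3 (fun s t u => v1 s t u 0 p - s * gp p u).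
  apply: (@bO_ext _ _ 3 _ (fun s t u => s * ((teval (tD p phi) (S s t u) - (gp p u + s * t * hess_Z p u)) + s * t * hess_Z p u))); first by bO_tac.
  by move=> s t u _ _; rewrite v1E; ring.
have Hz0 : bO 2 z0 by rewrite /z0; bO_tac.
have Hw1 : bO 2 w1 by rewrite /w1; bO_tac.
have Hw2 : bO 2 w2 by rewrite /w2; bO_tac.
have w2E s t u : w2 s t u = t ^+ 2 * G22 u.
  by rewrite /w2 /G22 mulr_sumr; apply: eq_bigr => p _; rewrite v2E exprMn.
have Hz0s : bO 4 (fun s t u => z0 s t u - s * t * G12 u).
  apply: (@bO_ext _ _ 4 _ (fun s t u => \sum_p (v1 s t u 0 p - s * gp p u) * v2 s t u 0 p)); first by bO_tac.
  by move=> s t u _ _; rewrite /z0 /G12 mulr_sumr -sumrB; apply: eq_bigr => p _; rewrite v2E; ring.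
have Hw1s : bO 4 (fun s t u => w1 s t u - s ^+ 2 * G11 u).
  apply: (@bO_ext _ _ 4 _ (fun s t u => \sum_p (v1 s t u 0 p - s * gp p u) * (v1 s t u 0 p + s * gp p u))); first by bO_tac.
  by move=> s t u _ _; rewrite /w1 /G11 mulr_sumr -sumrB; apply: eq_bigr => p _; ring.
have HK : bO 5 (fun s t u => K s t u - s ^+ 2 * t ^+ 2 * (G12 u ^+ 2 - G11 u * G22 u) / 6).
  apply: (@bO_ext _ _ 5 _ (fun s t u => ((z0 s t u - s * t * G12 u) * (z0 s t u + s * t * G12 u)
     - (w1 s t u - s ^+ 2 * G11 u) * (t ^+ 2 * G22 u)) / 6)); first by bO_tac.
  by move=> s t u _ _; rewrite /K -/(z0 s t u) -/(w1 s t u) -/(w2 s t u) w2E; field.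
have HK4 : bO 4 K by rewrite /K; bO_tac.
pose hZ u := \sum_p hp p u * zp p u.
pose ZZ u := \sum_p zp p u ^+ 2.
have HhZ : bO 0 (fun _ _ u => hZ u) by rewrite /hZ; bO_tac.
have HZZ : bO 0 (fun _ _ u => ZZ u) by rewrite /ZZ; bO_tac.
have Hdz p : bO 4 (fun s t u => d s t u 0 p - s * t * zp p u).
  by apply: (bO_ext (HS p)) => s t u _ _; rewrite dE /zp; ring.
have Hm03 : bO 3 m0 by rewrite /m0; bO_tac.
have Ha1s : bO 3 (fun s t u => a1 s t u - (1 + 2 * (s * teval phi u))).
  apply: (@bO_ext _ _ 3 _ (fun s t u => 2 * s * ((teval phi (S s t u) - (teval phi u + s * t * gZ u)) + s * t * gZ u))); first by bO_tac.
  by move=> s t u _ _; rewrite /a1 /h1; ring.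
have Hm0 : bO 5 (fun s t u => m0 s t u - s * t * ((1 + 2 * (t * teval psi u)) * s * gZ u - (1 + 2 * (s * teval phi u)) * t * hZ u)).
  apply: (@bO_ext _ _ 5 _ (fun s t u => \sum_p (
     (a2 s t u * v1 s t u 0 p - a1 s t u * v2 s t u 0 p) * (d s t u 0 p - s * t * zp p u)
     + (a2 s t u * (v1 s t u 0 p - s * gp p u) - (a1 s t u - (1 + 2 * (s * teval phi u))) * v2 s t u 0 p) * (s * t * zp p u)))); first by bO_tac.
  move=> s t u _ _.
  have -> : s * t * ((1 + 2 * (t * teval psi u)) * s * gZ u - (1 + 2 * (s * teval phi u)) * t * hZ u)
     = \sum_p s * t * ((1 + 2 * (t * teval psi u)) * s * (gp p u * zp p u) - (1 + 2 * (s * teval phi u)) * t * (hp p u * zp p u)).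
    by rewrite -mulr_sumr sumrB -!mulr_sumr.
  by rewrite /m0 -sumrB; apply: eq_bigr => p _; rewrite v2E /a2 /h2; ring.
have He4 : bO 4 e by rewrite /e; bO_tac.
have He : bO 5 (fun s t u => e s t u - s ^+ 2 * t ^+ 2 * ZZ u).
  apply: (@bO_ext _ _ 5 _ (fun s t u => \sum_p (d s t u 0 p - s * t * zp p u) * (d s t u 0 p + s * t * zp p u))); first by bO_tac.
  by move=> s t u _ _; rewrite /e /ZZ mulr_sumr -sumrB; apply: eq_bigr => p _; ring.
pose gH u := \sum_p gp p u * hess_Z p u.
pose hH u := \sum_p hp p u * hess_Z p u.
apply: (@bO_ext _ _ 5 _ (fun s t u =>
   (X0 s t u ^+ 2 - (x1 s t u ^+ 2 + 2 * x1 s t u * x2 s t u + x2 s t u ^+ 2 + 2 * x1 s t u * x3 s t u))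
   + (\sum_p Xp p s t u ^+ 2 - \sum_p (y1 p s t u ^+ 2 + 2 * y1 p s t u * y3 p s t u))
   - 2 * (K s t u - s ^+ 2 * t ^+ 2 * (G12 u ^+ 2 - G11 u * G22 u) / 6)
   + 2 * (m0 s t u - s * t * ((1 + 2 * (t * teval psi u)) * s * gZ u - (1 + 2 * (s * teval phi u)) * t * hZ u))
   + (e s t u - s ^+ 2 * t ^+ 2 * ZZ u)
   - 2 * (lam s t u - 1) * (K s t u - m0 s t u - e s t u / 2)
   - 2 * lam s t u * kap s t u)); first by bO_tac.
move=> s t u _ _.
have R1E : radius s phi (S s t u) ^+ 2 = a1 s t u ^+ 2 + w1 s t u.
  by rewrite sqr_modulus sqr_enorm.
have R2E : radius t psi u ^+ 2 = a2 s t u ^+ 2 + w2 s t u.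
  by rewrite sqr_modulus sqr_enorm.
have XpE : \sum_p Xp p s t u ^+ 2 = lam s t u ^+ 2 * w1 s t u - 2 * lam s t u * z0 s t u + w2 s t u.
  rewrite /w1 /w2 /z0 !mulr_sumr -sumrN -!big_split/=; apply: eq_bigr => p _.
  by rewrite /Xp; ring.
have yE : \sum_p (y1 p s t u ^+ 2 + 2 * y1 p s t u * y3 p s t u) =
    \sum_p (s * gp p u - t * hp p u) ^+ 2 + 2 * s ^+ 2 * t * (s * (teval D u / 2 * G11 u + gH u)
       - t * (teval D u / 2 * G12 u + hH u)).
  rewrite /G11 /G12 /gH /hH !mulr_sumr -!big_split/= !mulr_sumr -sumrB mulr_sumr -big_split/=.
  by apply: eq_bigr => p _; rewrite /y1 /y3; field.
rewrite /cone_step_cost /gap_density /cost_correction.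
rewrite -/(G11 u) -/(G12 u) -/(G22 u) -/(gZ u) -/(hZ u) -/(ZZ u) -/(gH u) -/(hH u).
rewrite {}XpE {}yE {}R1E {}R2E.
have kE : radius s phi (S s t u) * radius t psi u
    * cos (enorm (u + disp t psi u - (S s t u + disp s phi (S s t u)))) =
   kap s t u + (a1 s t u * a2 s t u + z0 s t u + K s t u - m0 s t u - e s t u / 2).
  by rewrite /kap -/(z0 s t u); ring.
rewrite -!mulrA [radius s phi _ * (_ * _)]mulrA {}kE /X0 /x1 /x2 /x3.
move: (\sum_p (s * gp p u - t * hp p u) ^+ 2) => gap.
move: (kap s t u) (a1 s t u) (a2 s t u) (z0 s t u) (K s t u) (m0 s t u) (e s t u) (w1 s t u) (w2 s t u) (lam s t u).
move: (G11 u) (G12 u) (G22 u) (gZ u) (hZ u) (ZZ u) (gH u) (hH u) (teval phi u) (teval psi u) (teval D u).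
by move=> *; field.
Qed.

End CostExpansion.

(** * Dual potentials *)

Section QuarticConjugate.
Context {R : realType} {n : nat}.
Implicit Types (u v w x y : 'rV[R]_n) (f : 'rV[R]_n -> R).

Lemma quarticE (r : R) : quartic r = r ^+ 2 / 2 + (r ^+ 2) ^+ 2 / 12.
Proof. by rewrite /quartic -exprM. Qed.

(** The quadratic part of [quartic] yields the term |w' - w|^2 / 2, and its quartic part is
    convex. *)
Lemma quartic_convex w w' : quartic (enorm w)
   + \sum_p w 0 p * (1 + enorm w ^+ 2 / 3) * (w' 0 p - w 0 p) + enorm (w' - w) ^+ 2 / 2
  <= quartic (enorm w').
Proof.
rewrite !quarticE.
have -> : \sum_p w 0 p * (1 + enorm w ^+ 2 / 3) * (w' 0 p - w 0 p) =
    (1 + enorm w ^+ 2 / 3) * \sum_p w 0 p * (w' 0 p - w 0 p).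
  by rewrite mulr_sumr; apply: eq_bigr => p _; ring.
have AE : enorm w' ^+ 2 = enorm w ^+ 2 + 2 * (\sum_p w 0 p * (w' 0 p - w 0 p)) + enorm (w' - w) ^+ 2.
  rewrite !sqr_enorm mulr_sumr -!big_split/=; apply: eq_bigr => p _; rewrite !mxE; ring.
move: (\sum_p _) AE (sqr_ge0 (enorm w)) (sqr_ge0 (enorm (w' - w))) => I.
move: (enorm w' ^+ 2) (enorm w ^+ 2) (enorm (w' - w) ^+ 2) => A B E AE B0 E0.
have : 0 <= (A - B) ^+ 2 + 2 * B * E by rewrite addr_ge0 ?sqr_ge0 ?mulr_ge0.
have -> : (A - B) ^+ 2 + 2 * B * E = A ^+ 2 - B ^+ 2 - 4 * (B * I) by rewrite AE; ring.
have -> : (1 + B / 3) * I = I + B * I / 3 by ring.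
move: (A ^+ 2) (B ^+ 2) (B * I) AE => A2 B2 BI AE h; lra.
Qed.

(* [quartic] replaces the cost - ln cos: it bounds it from below, which makes the dual pair below
   admissible, and is smooth and finite everywhere. *)
Definition conj f y : R := sup [set f x - quartic (enorm (y - x)) | x in [set: 'rV[R]_n]].

Lemma quartic_ge0 (r : R) : 0 <= quartic r.
Proof.
rewrite quarticE.
by have := sqr_ge0 r; have := sqr_ge0 (r ^+ 2); lra.
Qed.

Lemma enorm0 : enorm (0 : 'rV[R]_n) = 0.
Proof. by rewrite /enorm /dot big1 ?sqrtr0// => p _; rewrite mxE mul0r. Qed.

Section Bounded.
Variables (f : 'rV[R]_n -> R) (B : R).
Hypothesis fB : forall u, `|f u| <= B.

Let set_f y := [set f x - quartic (enorm (y - x)) | x in [set: 'rV[R]_n]].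

Let set_f_ub y : ubound (set_f y) B.
Proof.
move=> _ [x _ <-]; rewrite lerBlDr; apply: le_trans (ler_norm _) _; apply: le_trans (fB x) _.
by rewrite lerDl quartic_ge0.
Qed.

Let set_f_neq0 y : set_f y !=set0. Proof. by exists (f 0 - quartic (enorm (y - 0))); exists 0. Qed.

Lemma conj_ge y x : f x - quartic (enorm (y - x)) <= conj f y.
Proof. by apply: ub_le_sup; [exists B; exact: set_f_ub|exists x]. Qed.

Lemma conj_le y (c : R) : (forall x, f x - quartic (enorm (y - x)) <= c) -> conj f y <= c.
Proof. by move=> H; apply: ge_sup; [exact: set_f_neq0|move=> _ [x _ <-]]. Qed.

Lemma conj_bounded y : `|conj f y| <= B.
Proof.
rewrite ler_norml; apply/andP; split.
  apply: le_trans (conj_ge y y); rewrite subrr enorm0 /quartic !expr0n/= !mul0r addr0 subr0.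
  by have := fB y; rewrite ler_norml => /andP[].
by apply: conj_le => x; apply: set_f_ub; exists x.
Qed.

(** The cost depends only on y - x: a competitor x for u, translated by v - u, competes for v at the
    same cost. *)
Lemma conj_lipschitz (L : R) : (forall u v, `|f u - f v| <= L * enorm (u - v)) ->
  forall u v, `|conj f u - conj f v| <= L * enorm (u - v).
Proof.
move=> fL.
have H u v : conj f u <= conj f v + L * enorm (u - v).
  apply: conj_le => x; have := conj_ge v (x + v - u).
  have -> : v - (x + v - u) = u - x by apply/rowP => p; rewrite !mxE; ring.
  have := fL x (x + v - u); have -> : x - (x + v - u) = u - v by apply/rowP => p; rewrite !mxE; ring.
  by rewrite ler_norml => /andP[_]; lra.
move=> u v; rewrite ler_norml; apply/andP; split; last by have := H u v; lra.
by have := H v u; rewrite -enormN opprB; lra.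
Qed.

Lemma conj_period (z : 'rV[int]_n) : (forall u, f (u + lattice z) = f u) ->
  forall u, conj f (u + lattice z) = conj f u.
Proof.
move=> fz u; congr sup; apply/seteqP; split => _ [x _ <-].
  exists (x - lattice z) => //; rewrite -(fz (x - _)) subrK; congr (_ - quartic (enorm _)).
  by apply/rowP => p; rewrite !mxE; ring.
exists (x + lattice z) => //; rewrite fz; congr (_ - quartic (enorm _)).
by apply/rowP => p; rewrite !mxE; ring.
Qed.

End Bounded.

Definition dual0 f (x : torus R n) : R := expR (- f (torus_repr x)).
Definition dual1 f (x : torus R n) : R := expR (conj f (torus_repr x)).

Lemma periodic_repr f : (forall u z, f (u + lattice z) = f u) ->
  forall u, f (torus_repr (torus_pi u)) = f u.
Proof. by move=> fP u; have [z ->] := torus_repr_pi u; exact: fP. Qed.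

(** For the lift v of y nearest to u and |v - u| <= pi, the definition of the conjugate gives f u -
    f^c v <= quartic |v - u|, and [cos_le_quartic] concludes. At larger distances the truncated
    cosine is -1. *)
Lemma dual_admissible f (B : R) : (forall u, `|f u| <= B) -> (forall u z, f (u + lattice z) = f u) ->
  forall x y : torus R n, cos (Num.min (torus_dist x y) pi) <= dual0 f x * dual1 f y.
Proof.
move=> fB fP x y; have [u <-] := torus_pi_surj x.
have [v [<- -> _]] := torus_dist_lift_attained u y.
rewrite /dual0 /dual1 periodic_repr// (periodic_repr (fun u z => conj_period (fP^~ z) u)).
rewrite -expRD; have [vu|vu] := lerP (enorm (v - u)) pi; last first.
  by rewrite cospi; apply: le_trans (expR_ge0 _); lra.
apply: le_trans (cos_le_quartic _) _; first by rewrite enorm_ge0.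
by rewrite ler_expR; have := conj_ge fB v u; lra.
Qed.

Lemma measurable_dual0 f : msr f -> (forall u z, f (u + lattice z) = f u) ->
  measurable_fun setT (dual0 f).
Proof.
move=> mf fP; apply: measurable_on_torus.
rewrite (_ : (fun t => _) = fun t => expR (- f (row_of t))).
  apply: (@msr_continuous _ _ expR (fun u => - f u)); first exact: continuous_expR.
  apply: (@msr_continuous _ _ -%R f) => //; exact: opp_continuous.
by apply/funext => t; rewrite /dual0 torus_of_tupleE periodic_repr.
Qed.

Lemma measurable_dual1 f (B L : R) : (forall u, `|f u| <= B) ->
  (forall u v, `|f u - f v| <= L * enorm (u - v)) -> (forall u z, f (u + lattice z) = f u) ->
  measurable_fun setT (dual1 f).
Proof.
move=> fB fL fP; apply: measurable_on_torus.
rewrite (_ : (fun t => _) = fun t => expR (conj f (row_of t))).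
  apply: (@msr_continuous _ _ expR (conj f)); first exact: continuous_expR.
  exact: msr_lipschitz (conj_lipschitz fB fL).
apply/funext => t; rewrite /dual1 torus_of_tupleE.
by rewrite (periodic_repr (fun u z => conj_period (fP^~ z) u)).
Qed.

Lemma dual0_bounded f (B : R) : (forall u, `|f u| <= B) -> exists C, forall x : torus R n, `|dual0 f x| <= C.
Proof.
move=> fB; exists (expR B) => x; rewrite ger0_norm ?expR_ge0// ler_expR.
by have := fB (torus_repr x); rewrite ler_norml => /andP[h _]; lra.
Qed.

Lemma dual1_bounded f (B : R) : (forall u, `|f u| <= B) -> exists C, forall x : torus R n, `|dual1 f x| <= C.
Proof.
move=> fB; exists (expR B) => x; rewrite ger0_norm ?expR_ge0// ler_expR.
by have := conj_bounded fB (torus_repr x); rewrite ler_norml => /andP[].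
Qed.

End QuarticConjugate.

Section Exponentials.
Context {R : realType} {n : nat}.
Local Notation fam := (R -> R -> 'rV[R]_n -> R).

Lemma bO_expR3 (F G : fam) : bO 1 F -> bO 3 (fun s t u => F s t u - G s t u) -> bO 1 G ->
  bO 3 (fun s t u => expR (F s t u) - (1 + G s t u + G s t u ^+ 2 / 2)).
Proof.
move=> F1 FG G1.
have H : bO 3 (fun s t u => expR (F s t u) - (1 + F s t u + F s t u ^+ 2 / 2)).
  apply: (@bO_le _ _ 3 3 _ (fun s t u => 4 * F s t u ^+ 3)) => //; first by bO_tac.
  apply: (eventually0_mono (bO_small (e := 1) F1 isT ltr01)) => s t u _ _ F1'.
  by apply: le_trans (expR_taylor3 F1') _; rewrite normrM normrX (ger0_norm (ler0n _ _)).
apply: (@bO_ext _ _ 3 _ (fun s t u => (expR (F s t u) - (1 + F s t u + F s t u ^+ 2 / 2))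
  + (F s t u - G s t u) * (1 + (F s t u + G s t u) / 2))); first by bO_tac.
by move=> s t u _ _; field.
Qed.

Lemma bO_expR_sub1 k (F : fam) : bO k.+1 F -> bO k.+1 (fun s t u => expR (F s t u) - 1).
Proof.
move=> Fk; apply: (@bO_le _ _ k.+1 k.+1 _ (fun s t u => 6 * F s t u)) => //.
  by apply: (@bO_weaken _ _ (0 + k.+1)).
apply: (eventually0_mono (bO_small (e := 1) Fk isT ltr01)) => s t u _ _ F1.
have h := expR_taylor3 F1.
have -> : expR (F s t u) - 1 = (expR (F s t u) - (1 + F s t u + F s t u ^+ 2 / 2)) + F s t u * (1 + F s t u / 2) by field.
apply: le_trans (ler_normD _ _) _; rewrite !normrM (ger0_norm (ler0n _ _)).
have h2 : `|F s t u| ^+ 3 <= `|F s t u| by rewrite exprSr ler_piMl// exprn_ile1.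
have h3 : `|1 + F s t u / 2| <= 2.
  apply: le_trans (ler_normD _ _) _; rewrite normr1 normrM [`|2^-1|]ger0_norm ?invr_ge0//; move: F1; lra.
have h4 : `|F s t u| * `|1 + F s t u / 2| <= `|F s t u| * 2 by rewrite ler_wpM2l.
by lra.
Qed.

End Exponentials.

(** * The dual potential and the duality gap *)

Section DualityGap.
Context {R : realType} {n : nat}.
Local Notation fam := (R -> R -> 'rV[R]_n -> R).
Local Notation vfam := (R -> R -> 'rV[R]_n -> 'rV[R]_n).
Local Notation tp := (tpoly (R := R) (n := n)).
Variables (phi psi chi D : tp) (Z : 'I_n -> tp).
Variables (S : vfam) (J : fam).
Hypothesis HS : forall p, bO 4 (fun s t u => S s t u 0 p - (u 0 p + s * t * teval (Z p) u)).
Hypothesis HJ : bO 4 (fun s t u => J s t u - (1 + s * t * teval D u)).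
Hypothesis DE : forall u, teval D u = - 4 * teval chi u.
Hypothesis ZE : forall p u, teval (Z p) u =
  (\sum_q (teval (tD q (tD p phi)) u * teval (tD q psi) u
          - teval (tD q (tD p psi)) u * teval (tD q phi) u)) / 2 - teval (tD p chi) u.

(** The coefficients are read off from [bO_optimality]. At X = u + s grad phi + ..., the terms in s
    of the gradient must give (1 - 2 s phi) s grad phi, whence grad [pot20] = - Hess phi grad phi -
    2 phi grad phi; those in t must give - (1 - 2 t psi) t grad psi, whence grad [pot02] = 2 psi
    grad psi. The s t terms impose only Z = grad [pot11] - Hess psi grad phi; the half of <grad phi,
    grad psi> in [pot11] makes Z + grad chi antisymmetric in phi and psi. *)
Definition pot20 : tp :=
  tscale (-1) (tmul phi phi ++ tscale 2^-1 (tsum (fun q => tmul (tD q phi) (tD q phi)))).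
Definition pot02 : tp := tmul psi psi.
Definition pot11 : tp :=
  tscale 2^-1 (tsum (fun q => tmul (tD q phi) (tD q psi))) ++ tscale (-1) chi.

(* Up to sign, the Taylor polynomial of order two in (s, t) of the logarithm of the optimal
   dual potential. *)
Definition potential (s t : R) : tp :=
  tscale s phi ++ tscale (- t) psi ++ tscale (s ^+ 2) pot20 ++ tscale (t ^+ 2) pot02
  ++ tscale (s * t) pot11.

Local Notation pot s t u := (teval (potential s t) u).

Lemma potE s t u : pot s t u = s * teval phi u - t * teval psi u + s ^+ 2 * teval pot20 u
  + t ^+ 2 * teval pot02 u + s * t * teval pot11 u.
Proof.
by rewrite /potential; move: pot20 pot02 pot11 => a b c; rewrite !teval_cat !teval_scale; ring.
Qed.

Lemma pot_DE p s t u : teval (tD p (potential s t)) u =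
  s * teval (tD p phi) u - t * teval (tD p psi) u + s ^+ 2 * teval (tD p pot20) u
  + t ^+ 2 * teval (tD p pot02) u + s * t * teval (tD p pot11) u.
Proof.
by rewrite /potential; move: pot20 pot02 pot11 => a b c; rewrite !teval_D_cat !teval_D_scale; ring.
Qed.

Lemma pot20E u : teval pot20 u = - (teval phi u ^+ 2 + (\sum_q teval (tD q phi) u ^+ 2) / 2).
Proof.
rewrite teval_scale teval_cat teval_mul teval_scale teval_sum.
by under eq_bigr do rewrite teval_mul -expr2; rewrite mulN1r [2^-1 * _]mulrC expr2.
Qed.

Lemma pot02E u : teval pot02 u = teval psi u ^+ 2.
Proof. by rewrite teval_mul expr2. Qed.

Lemma pot11E u : teval pot11 u =
  (\sum_q teval (tD q phi) u * teval (tD q psi) u) / 2 - teval chi u.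
Proof.
rewrite teval_cat !teval_scale teval_sum mulN1r mulrC.
by under eq_bigr do rewrite teval_mul.
Qed.

Lemma pot20_DE p u : teval (tD p pot20) u = - (2 * teval phi u * teval (tD p phi) u
  + \sum_q teval (tD q (tD p phi)) u * teval (tD q phi) u).
Proof.
rewrite teval_D_scale teval_D_cat teval_D_mul teval_D_scale teval_D_sum mulN1r.
congr (- (_ + _)); first by ring.
rewrite [LHS]mulr_sumr.
by apply: eq_bigr => q _; rewrite teval_D_mul teval_DC; field.
Qed.

Lemma pot02_DE p u : teval (tD p pot02) u = 2 * teval psi u * teval (tD p psi) u.
Proof. by rewrite teval_D_mul; ring. Qed.

Lemma pot11_DE p u : teval (tD p pot11) u =
  (\sum_q (teval (tD q (tD p phi)) u * teval (tD q psi) u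
          + teval (tD q (tD p psi)) u * teval (tD q phi) u)) / 2 - teval (tD p chi) u.
Proof.
rewrite teval_D_cat !teval_D_scale teval_D_sum mulN1r mulrC; congr (_ / 2 - _).
by apply: eq_bigr => q _; rewrite teval_D_mul teval_DC [teval (tD p (tD q psi)) u]teval_DC; ring.
Qed.

Let gp p (u : 'rV[R]_n) := teval (tD p phi) u.
Let hp p (u : 'rV[R]_n) := teval (tD p psi) u.
Let G11 u := \sum_p gp p u ^+ 2.
Let G12 u := \sum_p gp p u * hp p u.
Let G22 u := \sum_p hp p u ^+ 2.
Let X : vfam := fun s t u => S s t u + disp s phi (S s t u).
Let Y : vfam := fun s t u => u + disp t psi u.
Let w : vfam := fun s t u => Y s t u - X s t u.
Let lam : fam := fun s t u => Num.sqrt (J s t u).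
Let r : fam := fun s t u => lam s t u * radius s phi (S s t u).
Let r' : fam := fun _ t u => radius t psi u.

Let Hgp p : bO 0 (fun _ _ u => gp p u). Proof. exact: bO_teval. Qed.
#[local] Existing Instance Hgp.
Let Hhp p : bO 0 (fun _ _ u => hp p u). Proof. exact: bO_teval. Qed.
#[local] Existing Instance Hhp.
Let HG11 : bO 0 (fun _ _ u => G11 u). Proof. rewrite /G11; bO_tac. Qed.
#[local] Existing Instance HG11.
Let HG12 : bO 0 (fun _ _ u => G12 u). Proof. rewrite /G12; bO_tac. Qed.
#[local] Existing Instance HG12.
Let HG22 : bO 0 (fun _ _ u => G22 u). Proof. rewrite /G22; bO_tac. Qed.
#[local] Existing Instance HG22.

Let h1 : fam := fun s t u => s * teval phi (S s t u).
Let h2 : fam := fun _ t u => t * teval psi u.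
Let v1 : vfam := fun s t u => s *: tgrad phi (S s t u).
Let v2 : vfam := fun _ t u => t *: tgrad psi u.
Let Hh1 : bO 1 h1. Proof. rewrite /h1; bO_tac. Qed.
#[local] Existing Instance Hh1.
Let Hh2 : bO 1 h2. Proof. rewrite /h2; bO_tac. Qed.
#[local] Existing Instance Hh2.
Let Hv1 p : bO 1 (fun s t u => v1 s t u 0 p).
Proof.
apply: (@bO_ext _ _ 1 _ (fun s t u => s * teval (tD p phi) (S s t u))); first by bO_tac.
by move=> s t u _ _; rewrite mxE tgradE.
Qed.
#[local] Existing Instance Hv1.
Let Hv2 p : bO 1 (fun s t u => v2 s t u 0 p).
Proof.
apply: (@bO_ext _ _ 1 _ (fun s t u => t * teval (tD p psi) u)); first by bO_tac.
by move=> s t u _ _; rewrite mxE tgradE.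
Qed.
#[local] Existing Instance Hv2.

Let HD1 p : bO 3 (fun s t u => disp s phi (S s t u) 0 p - (1 - 2 * h1 s t u) * v1 s t u 0 p)
  := bO_polar3 Hh1 Hv1 p.
Let HD2 p : bO 3 (fun s t u => disp t psi u 0 p - (1 - 2 * h2 s t u) * v2 s t u 0 p)
  := bO_polar3 Hh2 Hv2 p.

Let Hshift a : bO 2 (fun s t u => teval a (S s t u) - teval a u).
Proof. exact: bO_teval_diff (bO_shift HS). Qed.
#[local] Existing Instance Hshift.

Let Hdisp1 p : bO 3 (fun s t u => disp s phi (S s t u) 0 p - (1 - 2 * (s * teval phi u)) * (s * gp p u)).
Proof.
have A := Hshift phi; have B := Hshift (tD p phi); have C := HD1 p.
apply: (@bO_ext _ _ 3 _ (fun s t u => (disp s phi (S s t u) 0 p - (1 - 2 * h1 s t u) * v1 s t u 0 p)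
   - 2 * s * (teval phi (S s t u) - teval phi u) * v1 s t u 0 p
   + (1 - 2 * (s * teval phi u)) * (s * (teval (tD p phi) (S s t u) - teval (tD p phi) u)))); first by bO_tac.
by move=> s t u _ _; rewrite /h1 [v1 _ _ _ _ _]mxE tgradE /gp; ring.
Qed.

Let Hdisp2 p : bO 3 (fun s t u => disp t psi u 0 p - (1 - 2 * (t * teval psi u)) * (t * hp p u)).
Proof.
apply: (bO_ext (HD2 p)) => s t u _ _; by rewrite /h2 [v2 _ _ _ _ _]mxE tgradE.
Qed.

Let HX2 p : bO 2 (fun s t u => X s t u 0 p - u 0 p - s * gp p u).
Proof.
have A := bO_shift HS p; have B := Hdisp1 p.
apply: (@bO_ext _ _ 2 _ (fun s t u => (S s t u 0 p - u 0 p) +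
  (disp s phi (S s t u) 0 p - (1 - 2 * (s * teval phi u)) * (s * gp p u)) - 2 * (s * teval phi u) * (s * gp p u))); first by bO_tac.
by move=> s t u _ _; rewrite [X _ _ _ _ _]mxE; ring.
Qed.

Let HX1 p : bO 1 (fun s t u => X s t u 0 p - u 0 p).
Proof.
have A := HX2 p.
apply: (@bO_ext _ _ 1 _ (fun s t u => (X s t u 0 p - u 0 p - s * gp p u) + s * gp p u)); first by bO_tac.
by move=> s t u _ _; rewrite subrK.
Qed.

Let HtX1 a : bO 1 (fun s t u => teval a (X s t u) - teval a u).
Proof. exact: bO_teval_diff HX1. Qed.

Let HtX2 a : bO 2 (fun s t u => teval a (X s t u) - teval a u - s * \sum_q teval (tD q a) u * gp q u).
Proof.
have A := bO_teval_taylor a HX1; have B := HX2.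
apply: (@bO_ext _ _ 2 _ (fun s t u => (teval a (X s t u) - teval a u
    - \sum_p teval (tD p a) u * (X s t u 0 p - u 0 p))
    + \sum_p teval (tD p a) u * (X s t u 0 p - u 0 p - s * gp p u))); first by bO_tac.
move=> s t u _ _.
have -> : \sum_p teval (tD p a) u * (X s t u 0 p - u 0 p - s * gp p u) =
  \sum_p teval (tD p a) u * (X s t u 0 p - u 0 p) - s * \sum_q teval (tD q a) u * gp q u.
  by rewrite mulr_sumr -sumrB; apply: eq_bigr => p _; ring.
by move: (\sum_p _) (\sum_p _) => A' B'; ring.
Qed.

Let Hw3 p : bO 3 (fun s t u => w s t u 0 p + (s * t * teval (Z p) u
  + (1 - 2 * (s * teval phi u)) * (s * gp p u) - (1 - 2 * (t * teval psi u)) * (t * hp p u))).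
Proof.
have A := Hdisp1 p; have B := Hdisp2 p; have C := HS p.
apply: (@bO_ext _ _ 3 _ (fun s t u => (disp t psi u 0 p - (1 - 2 * (t * teval psi u)) * (t * hp p u))
   - (disp s phi (S s t u) 0 p - (1 - 2 * (s * teval phi u)) * (s * gp p u))
   - (S s t u 0 p - (u 0 p + s * t * teval (Z p) u)))); first by bO_tac.
by move=> s t u _ _; rewrite !mxE; ring.
Qed.

Let Hw2 p : bO 2 (fun s t u => w s t u 0 p + (s * gp p u - t * hp p u)).
Proof.
have A := Hw3 p.
apply: (@bO_ext _ _ 2 _ (fun s t u => (w s t u 0 p + (s * t * teval (Z p) u
  + (1 - 2 * (s * teval phi u)) * (s * gp p u) - (1 - 2 * (t * teval psi u)) * (t * hp p u)))
  - s * t * teval (Z p) u + 2 * (s * teval phi u) * (s * gp p u) - 2 * (t * teval psi u) * (t * hp p u))); first by bO_tac.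
by move=> s t u _ _; ring.
Qed.

Let Hw1 p : bO 1 (fun s t u => w s t u 0 p).
Proof.
have A := Hw2 p.
apply: (@bO_ext _ _ 1 _ (fun s t u => (w s t u 0 p + (s * gp p u - t * hp p u)) - (s * gp p u - t * hp p u))); first by bO_tac.
by move=> s t u _ _; rewrite addrK.
Qed.
#[local] Existing Instance Hw1.

(* First-order optimality: the gradient of the potential matches the transport displacement. *)
Lemma bO_optimality p : bO 3 (fun s t u => teval (tD p (potential s t)) (X s t u) + w s t u 0 p).
Proof.
have A1 := HtX2 (tD p phi); have A2 := HtX2 (tD p psi).
have B1 := HtX1 (tD p pot20); have B2 := HtX1 (tD p pot02); have B3 := HtX1 (tD p pot11).
have C := Hw3 p.
apply: (@bO_ext _ _ 3 _ (fun s t u =>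
   s * (teval (tD p phi) (X s t u) - teval (tD p phi) u - s * \sum_q teval (tD q (tD p phi)) u * gp q u)
   - t * (teval (tD p psi) (X s t u) - teval (tD p psi) u - s * \sum_q teval (tD q (tD p psi)) u * gp q u)
   + s ^+ 2 * (teval (tD p pot20) (X s t u) - teval (tD p pot20) u)
   + t ^+ 2 * (teval (tD p pot02) (X s t u) - teval (tD p pot02) u)
   + s * t * (teval (tD p pot11) (X s t u) - teval (tD p pot11) u)
   + (w s t u 0 p + (s * t * teval (Z p) u
      + (1 - 2 * (s * teval phi u)) * (s * gp p u) - (1 - 2 * (t * teval psi u)) * (t * hp p u))))).
  by bO_tac.
move=> s t u _ _; rewrite pot_DE ZE.
rewrite [teval (tD p pot20) u]pot20_DE [teval (tD p pot02) u]pot02_DE [teval (tD p pot11) u]pot11_DE.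
rewrite big_split sumrB /= -/(gp p u) -/(hp p u).
move: (teval (tD p pot20) (X s t u)) (teval (tD p pot02) (X s t u)) (teval (tD p pot11) (X s t u)) => P1 P2 P3.
move: (teval (tD p phi) (X s t u)) (teval (tD p psi) (X s t u)) (w s t u 0 p) => Q1 Q2 W.
rewrite -/(gp p u).
have E1 : \sum_q teval (tD q (tD p phi)) u * gp q u = \sum_q teval (tD q (tD p phi)) u * teval (tD q phi) u by [].
have E2 : \sum_q teval (tD q (tD p psi)) u * gp q u = \sum_q teval (tD q (tD p psi)) u * teval (tD q phi) u by [].
rewrite E1 E2.
move: (\sum_q teval (tD q (tD p phi)) u * teval (tD q phi) u) (\sum_q teval (tD q (tD p phi)) u * teval (tD q psi) u)
  (\sum_q teval (tD q (tD p psi)) u * teval (tD q phi) u) (gp p u) (hp p u) (teval phi u) (teval psi u) (teval (tD p chi) u) => *.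
by field.
Qed.

Let Hpot : bO 1 (fun s t u => pot s t (X s t u)).
Proof.
apply: (@bO_ext _ _ 1 _ (fun s t u => s * teval phi (X s t u) - t * teval psi (X s t u)
  + s ^+ 2 * teval pot20 (X s t u) + t ^+ 2 * teval pot02 (X s t u) + s * t * teval pot11 (X s t u))); first by bO_tac.
by move=> s t u _ _; rewrite potE.
Qed.
#[local] Existing Instance Hpot.

Let f1 : fam := fun s t u => s * teval phi u - t * teval psi u.
Let f2 : fam := fun s t u => s ^+ 2 * (G11 u / 2 - teval phi u ^+ 2) + t ^+ 2 * teval psi u ^+ 2
  - s * t * (G12 u / 2 + teval chi u).
Let nw : fam := fun s t u => s ^+ 2 * G11 u - 2 * (s * t) * G12 u + t ^+ 2 * G22 u.
Let Hf1 : bO 1 f1. Proof. rewrite /f1; bO_tac. Qed.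
#[local] Existing Instance Hf1.
Let Hf2 : bO 2 f2. Proof. rewrite /f2; bO_tac. Qed.
#[local] Existing Instance Hf2.
Let Hnw : bO 2 nw. Proof. rewrite /nw; bO_tac. Qed.
#[local] Existing Instance Hnw.

Let HpotX : bO 3 (fun s t u => pot s t (X s t u) - (f1 s t u + f2 s t u)).
Proof.
have A1 := HtX2 phi; have A2 := HtX2 psi.
have B1 := HtX1 pot20; have B2 := HtX1 pot02; have B3 := HtX1 pot11.
apply: (@bO_ext _ _ 3 _ (fun s t u =>
   s * (teval phi (X s t u) - teval phi u - s * \sum_q teval (tD q phi) u * gp q u)
   - t * (teval psi (X s t u) - teval psi u - s * \sum_q teval (tD q psi) u * gp q u)
   + s ^+ 2 * (teval pot20 (X s t u) - teval pot20 u)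
   + t ^+ 2 * (teval pot02 (X s t u) - teval pot02 u)
   + s * t * (teval pot11 (X s t u) - teval pot11 u))); first by bO_tac.
move=> s t u _ _; rewrite potE [teval pot20 u]pot20E [teval pot02 u]pot02E [teval pot11 u]pot11E /f1 /f2.
have -> : \sum_q teval (tD q phi) u * gp q u = G11 u by apply: eq_bigr => q _; rewrite expr2.
have -> : \sum_q teval (tD q psi) u * gp q u = G12 u by apply: eq_bigr => q _; rewrite mulrC.
rewrite -/(G11 u) -/(G12 u).
move: (teval pot20 (X s t u)) (teval pot02 (X s t u)) (teval pot11 (X s t u)) (teval phi (X s t u)) (teval psi (X s t u)) => P1 P2 P3 Q1 Q2.
move: (G11 u) (G12 u) (teval phi u) (teval psi u) (teval chi u) => *; by field.
Qed.

Let Henw : bO 1 (fun s t u => enorm (w s t u)). Proof. exact: bO_enorm. Qed.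
#[local] Existing Instance Henw.

Lemma bO_displacement : bO 1 (fun s t u =>
  enorm (u + disp t psi u - (S s t u + disp s phi (S s t u)))).
Proof. exact: Henw. Qed.

Let Hnw3 : bO 3 (fun s t u => enorm (w s t u) ^+ 2 - nw s t u).
Proof.
have A := Hw2.
apply: (@bO_ext _ _ 3 _ (fun s t u => \sum_p (w s t u 0 p + (s * gp p u - t * hp p u)) * (w s t u 0 p - (s * gp p u - t * hp p u)))); first by bO_tac.
move=> s t u _ _; rewrite sqr_enorm.
have -> : nw s t u = \sum_p (s * gp p u - t * hp p u) ^+ 2.
  by rewrite /nw /G11 /G12 /G22 !mulr_sumr -sumrN -!big_split/=; apply: eq_bigr => p _; ring.
by rewrite -sumrB; apply: eq_bigr => p _; ring.
Qed.

Let Hquartic : bO 3 (fun s t u => quartic (enorm (w s t u)) - nw s t u / 2).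
Proof.
have A := Hnw3.
apply: (@bO_ext _ _ 3 _ (fun s t u => (enorm (w s t u) ^+ 2 - nw s t u) / 2 + (enorm (w s t u) ^+ 2) ^+ 2 / 12)); first by bO_tac.
by move=> s t u _ _; rewrite quarticE; field.
Qed.

(** Gradient at x = X of the function pot x - quartic |Y - x| whose supremum is the conjugate at Y.
    The cubic term w |w|^2 / 3 does not spoil the order three of [bO_optimality]. *)
Let G p : fam := fun s t u => teval (tD p (potential s t)) (X s t u)
  + w s t u 0 p * (1 + enorm (w s t u) ^+ 2 / 3).

Let HG p : bO 3 (G p).
Proof.
have A := bO_optimality p; have B := Hw1 p.
apply: (@bO_ext _ _ 3 _ (fun s t u => (teval (tD p (potential s t)) (X s t u) + w s t u 0 p)
  + w s t u 0 p * (enorm (w s t u) ^+ 2 / 3))); first by bO_tac.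
by move=> s t u _ _; rewrite /G; ring.
Qed.

(** The second-order remainders of the potential are O(s + t) |y - x|^2. The constant 1 / 4 is half
    of the 1 / 2 in [quartic_convex], so that the other half is left to absorb a linear term in
    [bO_conj]. *)
Lemma potential_semiconcave : eventually0 (fun s t (_ : 'rV[R]_n) => forall x y : 'rV[R]_n,
  pot s t y <= pot s t x + \sum_p teval (tD p (potential s t)) x * (y 0 p - x 0 p) + 4^-1 * enorm (y - x) ^+ 2).
Proof.
have [C1 T1] := teval_taylor phi; have [C2 T2] := teval_taylor psi.
have [C3 T3] := teval_taylor pot20; have [C4 T4] := teval_taylor pot02; have [C5 T5] := teval_taylor pot11.
have [d d0 dP] := @bO_small R n 1 (fun s t _ => s * `|C1| + t * `|C2| + s ^+ 2 * `|C3| + t ^+ 2 * `|C4| + s * t * `|C5|) 4^-1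
   ltac:(bO_tac) isT ltac:(by rewrite invr_gt0).
exists d => // s t u s0 t0 sd td x y.
have := dP s t u s0 t0 sd td; rewrite ger0_norm; last first.
  by rewrite !addr_ge0// !mulr_ge0 ?exprn_ge0 ?(ltW s0) ?(ltW t0).
move=> dC.
pose E a := teval a y - teval a x - \sum_p teval (tD p a) x * (y - x) 0 p.
have TE a (C : R) : (forall u d, `|teval a (u + d) - teval a u - \sum_p teval (tD p a) u * d 0 p| <= C * enorm d ^+ 2) ->
    `|E a| <= `|C| * enorm (y - x) ^+ 2.
  move=> H; have := H x (y - x); rewrite (_ : x + (y - x) = y); last by rewrite addrC subrK.
  by move=> /le_trans; apply; rewrite ler_wpM2r ?sqr_ge0 ?ler_norm.
have E1 := TE _ _ T1; have E2 := TE _ _ T2; have E3 := TE _ _ T3; have E4 := TE _ _ T4; have E5 := TE _ _ T5.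
have -> : \sum_p teval (tD p (potential s t)) x * (y 0 p - x 0 p) =
   s * (\sum_p teval (tD p phi) x * (y - x) 0 p) - t * (\sum_p teval (tD p psi) x * (y - x) 0 p)
   + s ^+ 2 * (\sum_p teval (tD p pot20) x * (y - x) 0 p) + t ^+ 2 * (\sum_p teval (tD p pot02) x * (y - x) 0 p)
   + s * t * (\sum_p teval (tD p pot11) x * (y - x) 0 p).
  rewrite !mulr_sumr -sumrN -!big_split/=; apply: eq_bigr => p _.
  by rewrite pot_DE !mxE; ring.
rewrite -lerBlDl !potE.
set q := enorm (y - x) ^+ 2 in E1 E2 E3 E4 E5 *.
have q0 : 0 <= q by exact: sqr_ge0.
apply: (@le_trans _ _ (s * E phi - t * E psi + s ^+ 2 * E pot20 + t ^+ 2 * E pot02 + s * t * E pot11)).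
  by rewrite le_eqVlt; apply/orP; left; apply/eqP; rewrite /E; ring.
have b (a : tp) (c C : R) : 0 <= c -> `|E a| <= C * q -> c * E a <= c * C * q /\ - (c * E a) <= c * C * q.
  move=> c0 h; split.
    by rewrite -mulrA ler_wpM2l//; apply: le_trans (ler_norm _) h.
  by rewrite -mulrN -mulrA ler_wpM2l//; apply: le_trans h; rewrite -normrN ler_norm.
have [b1 _] := b _ _ _ (ltW s0) E1; have [_ b2] := b _ _ _ (ltW t0) E2.
have [b3 _] := b _ _ _ (sqr_ge0 s) E3; have [b4 _] := b _ _ _ (sqr_ge0 t) E4.
have [b5 _] := b _ _ _ (mulr_ge0 (ltW s0) (ltW t0)) E5.
have := ler_wpM2r q0 dC; rewrite !mulrDl; lra.
Qed.

(** By [quartic_convex] and [potential_semiconcave], the function maximised exceeds its value at X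
    by at most G . (y - X) - |y - X|^2 / 4 <= |G|^2. As X need not be the maximiser, an approximate
    critical point suffices, and the defect G of order three is squared. *)
Lemma bO_conj : bO 6 (fun s t u => conj (teval (potential s t)) (Y s t u)
  - (pot s t (X s t u) - quartic (enorm (w s t u)))).
Proof.
have A := HG.
apply: (@bO_le _ _ 6 6 _ (fun s t u => \sum_p G p s t u ^+ 2)) => //; first by bO_tac.
apply: (eventually0_mono potential_semiconcave) => s t u _ _ sc.
have [B fB] := teval_bounded (potential s t).
rewrite ger0_norm; last by have := conj_ge fB (Y s t u) (X s t u); rewrite -/(w s t u); lra.
apply: le_trans (ler_norm _); rewrite lerBlDr; apply: conj_le => y.
have h1' := sc (X s t u) y.
have h2' := quartic_convex (w s t u) (Y s t u - y).
have yE p : (Y s t u - y) 0 p - w s t u 0 p = - (y 0 p - X s t u 0 p) by rewrite !mxE; ring.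
rewrite (_ : \sum_p w s t u 0 p * (1 + enorm (w s t u) ^+ 2 / 3) * ((Y s t u - y) 0 p - w s t u 0 p) =
   - \sum_p w s t u 0 p * (1 + enorm (w s t u) ^+ 2 / 3) * (y 0 p - X s t u 0 p)) in h2'; last first.
  by rewrite -sumrN; apply: eq_bigr => p _; rewrite yE; ring.
rewrite (_ : Y s t u - y - w s t u = - (y - X s t u)) in h2'; last by apply/rowP => p; rewrite !mxE; ring.
rewrite enormN in h2'.
have : \sum_p G p s t u * (y 0 p - X s t u 0 p) <= \sum_p G p s t u ^+ 2 + 4^-1 * enorm (y - X s t u) ^+ 2.
  rewrite sqr_enorm mulr_sumr -big_split/=; apply: ler_sum => p _.
  have -> : (y - X s t u) 0 p = y 0 p - X s t u 0 p by rewrite !mxE.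
  by have := sqr_ge0 (G p s t u - 2^-1 * (y 0 p - X s t u 0 p)); lra.
have -> : \sum_p G p s t u * (y 0 p - X s t u 0 p) =
   \sum_p teval (tD p (potential s t)) (X s t u) * (y 0 p - X s t u 0 p) +
   \sum_p w s t u 0 p * (1 + enorm (w s t u) ^+ 2 / 3) * (y 0 p - X s t u 0 p).
  by rewrite -big_split/=; apply: eq_bigr => p _; rewrite /G; ring.
lra.
Qed.

Let cj : fam := fun s t u => conj (teval (potential s t)) (Y s t u).

Let Hcj : bO 3 (fun s t u => cj s t u - (f1 s t u + f2 s t u - nw s t u / 2)).
Proof.
have A := bO_conj; have B := HpotX; have C := Hquartic.
apply: (@bO_ext _ _ 3 _ (fun s t u => (conj (teval (potential s t)) (Y s t u)
  - (pot s t (X s t u) - quartic (enorm (w s t u)))) + (pot s t (X s t u) - (f1 s t u + f2 s t u))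
  - (quartic (enorm (w s t u)) - nw s t u / 2))); first by bO_tac.
by move=> s t u _ _; rewrite /cj; ring.
Qed.

Let Hcj1 : bO 1 cj.
Proof.
have A := Hcj.
apply: (@bO_ext _ _ 1 _ (fun s t u => (cj s t u - (f1 s t u + f2 s t u - nw s t u / 2)) + (f1 s t u + f2 s t u - nw s t u / 2))); first by bO_tac.
by move=> s t u _ _; rewrite subrK.
Qed.
#[local] Existing Instance Hcj1.

Let Hr : bO 3 (fun s t u => r s t u - (1 + 2 * (s * teval phi u) + (s ^+ 2 * G11 u / 2 + s * t * teval D u / 2))).
Proof.
have A := bO_lam HJ; have B := bO_modulus3 Hh1 Hv1; have C := Hshift phi; have E p := Hshift (tD p phi).
have F : bO 0 (fun s t u => radius s phi (S s t u)) := bO_modulus0 Hh1 Hv1.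
have V : bO 2 (fun s t u => \sum_p v1 s t u 0 p ^+ 2 / 2) by bO_tac.
apply: (@bO_ext _ _ 3 _ (fun s t u => (lam s t u - (1 + s * t * teval D u / 2)) * radius s phi (S s t u)
  + (1 + s * t * teval D u / 2) * ((modulus (1 + 2 * h1 s t u) (v1 s t u) - (1 + 2 * h1 s t u + \sum_p v1 s t u 0 p ^+ 2 / 2))
     + 2 * s * (teval phi (S s t u) - teval phi u)
     + s ^+ 2 / 2 * (\sum_p (teval (tD p phi) (S s t u) - teval (tD p phi) u) * (teval (tD p phi) (S s t u) + teval (tD p phi) u)))
  + s * t * teval D u / 2 * (2 * (s * teval phi u) + s ^+ 2 * G11 u / 2))); first by bO_tac.
move=> s t u _ _.
have -> : \sum_p (teval (tD p phi) (S s t u) - teval (tD p phi) u) * (teval (tD p phi) (S s t u) + teval (tD p phi) u)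
  = \sum_p teval (tD p phi) (S s t u) ^+ 2 - G11 u.
  by rewrite -sumrB; apply: eq_bigr => p _; rewrite /gp; ring.
have -> : \sum_p v1 s t u 0 p ^+ 2 / 2 = s ^+ 2 / 2 * \sum_p teval (tD p phi) (S s t u) ^+ 2.
  by rewrite mulr_sumr; apply: eq_bigr => p _; rewrite mxE tgradE; field.
rewrite /r -/(radius s phi (S s t u)) /h1.
move: (\sum_p _) (lam s t u) (radius _ _ _) (G11 u) (teval phi u) (teval D u) (teval phi (S s t u)) => *.
by field.
Qed.

Let Hr' : bO 3 (fun s t u => r' s t u - (1 + 2 * (t * teval psi u) + t ^+ 2 * G22 u / 2)).
Proof.
apply: (bO_ext (bO_modulus3 Hh2 Hv2)) => s t u _ _; congr (_ - (_ + _)).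
by rewrite /G22 mulr_sumr mulr_suml; apply: eq_bigr => p _; rewrite mxE tgradE /hp; field.
Qed.

Let a0 : fam := fun s t u => expR (- pot s t (X s t u)).
Let a1 : fam := fun s t u => expR (cj s t u).

(** Equality in 2 a b <= a^2 + b^2 up to order three. The parts of order one, [e1], and two, [e2],
    of both weighted radii are compared separately. *)
Let balance : bO 3 (fun s t u => r s t u * a0 s t u - r' s t u * a1 s t u).
Proof.
have A0 : bO 3 (fun s t u => a0 s t u - (1 + - (f1 s t u + f2 s t u) + (- (f1 s t u + f2 s t u)) ^+ 2 / 2)).
  have H := HpotX.
  have F1 : bO 1 (fun s t u => - pot s t (X s t u)) by bO_tac.
  have G1 : bO 1 (fun s t u => - (f1 s t u + f2 s t u)) by bO_tac.
  have FG : bO 3 (fun s t u => - pot s t (X s t u) - - (f1 s t u + f2 s t u)).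
    apply: (@bO_ext _ _ 3 _ (fun s t u => - (pot s t (X s t u) - (f1 s t u + f2 s t u)))).
    by move=> s t u _ _; ring.
  exact: (bO_expR3 F1 FG G1).
have A1 : bO 3 (fun s t u => a1 s t u - (1 + (f1 s t u + (f2 s t u - nw s t u / 2)) + (f1 s t u + (f2 s t u - nw s t u / 2)) ^+ 2 / 2)).
  have G1 : bO 1 (fun s t u => f1 s t u + (f2 s t u - nw s t u / 2)) by bO_tac.
  have FG : bO 3 (fun s t u => cj s t u - (f1 s t u + (f2 s t u - nw s t u / 2))).
    by apply: (bO_ext Hcj) => s t u _ _; ring.
  exact: (bO_expR3 Hcj1 FG G1).
have B0 := Hr; have B1 := Hr'.
have A00 : bO 0 a0.
  apply: (@bO_ext _ _ 0 _ (fun s t u => (a0 s t u - (1 + - (f1 s t u + f2 s t u) + (- (f1 s t u + f2 s t u)) ^+ 2 / 2)) + (1 + - (f1 s t u + f2 s t u) + (- (f1 s t u + f2 s t u)) ^+ 2 / 2))); first by bO_tac.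
  by move=> s t u _ _; rewrite subrK.
have A10 : bO 0 a1.
  apply: (@bO_ext _ _ 0 _ (fun s t u => (a1 s t u - (1 + (f1 s t u + (f2 s t u - nw s t u / 2)) + (f1 s t u + (f2 s t u - nw s t u / 2)) ^+ 2 / 2)) + (1 + (f1 s t u + (f2 s t u - nw s t u / 2)) + (f1 s t u + (f2 s t u - nw s t u / 2)) ^+ 2 / 2))); first by bO_tac.
  by move=> s t u _ _; rewrite subrK.
pose p1 : fam := fun s t u => 2 * (s * teval phi u).
pose p2 : fam := fun s t u => s ^+ 2 * G11 u / 2 + s * t * teval D u / 2.
pose q1 : fam := fun s t u => 2 * (t * teval psi u).
pose q2 : fam := fun s t u => t ^+ 2 * G22 u / 2.
pose g2 : fam := fun s t u => f2 s t u - nw s t u / 2.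
have Hp1 : bO 1 p1 by rewrite /p1; bO_tac.
have Hp2 : bO 2 p2 by rewrite /p2; bO_tac.
have Hq1 : bO 1 q1 by rewrite /q1; bO_tac.
have Hq2 : bO 2 q2 by rewrite /q2; bO_tac.
have Hg2 : bO 2 g2 by rewrite /g2; bO_tac.
apply: (@bO_ext _ _ 3 _ (fun s t u =>
   (r s t u - (1 + p1 s t u + p2 s t u)) * a0 s t u
   + (1 + p1 s t u + p2 s t u) * (a0 s t u - (1 + - (f1 s t u + f2 s t u) + (- (f1 s t u + f2 s t u)) ^+ 2 / 2))
   - (r' s t u - (1 + q1 s t u + q2 s t u)) * a1 s t u
   - (1 + q1 s t u + q2 s t u) * (a1 s t u - (1 + (f1 s t u + g2 s t u) + (f1 s t u + g2 s t u) ^+ 2 / 2))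
   + (f1 s t u * f2 s t u + f2 s t u ^+ 2 / 2 + p1 s t u * (- f2 s t u + (f1 s t u + f2 s t u) ^+ 2 / 2)
      + p2 s t u * (- (f1 s t u + f2 s t u) + (f1 s t u + f2 s t u) ^+ 2 / 2))
   - (f1 s t u * g2 s t u + g2 s t u ^+ 2 / 2 + q1 s t u * (g2 s t u + (f1 s t u + g2 s t u) ^+ 2 / 2)
      + q2 s t u * ((f1 s t u + g2 s t u) + (f1 s t u + g2 s t u) ^+ 2 / 2)))).
  by bO_tac.
move=> s t u _ _.
have e1 : p1 s t u - f1 s t u = q1 s t u + f1 s t u by rewrite /p1 /q1 /f1; ring.
(* The s t terms reduce to D / 2 + chi = - chi, which is D = - 4 chi. *)
have e2 : p2 s t u - f2 s t u + f1 s t u ^+ 2 / 2 - p1 s t u * f1 s t u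
   = q2 s t u + g2 s t u + f1 s t u ^+ 2 / 2 + q1 s t u * f1 s t u.
  rewrite /p2 /q2 /g2 /f2 /nw /p1 /q1 /f1 DE.
  move: (G11 u) (G12 u) (G22 u) (teval phi u) (teval psi u) (teval chi u) => *; by field.
move: (r s t u) (r' s t u) (a0 s t u) (a1 s t u) e1 e2.
move: (p1 s t u) (p2 s t u) (q1 s t u) (q2 s t u) (f1 s t u) (f2 s t u) (g2 s t u) => P1 P2 Q1 Q2 F1 F2 G2 x x' y y' e1 e2.
have -> : F2 = P2 + F1 ^+ 2 / 2 - P1 * F1 - (Q2 + G2 + F1 ^+ 2 / 2 + Q1 * F1) by rewrite -e2; ring.
have -> : P1 = Q1 + 2 * F1 by rewrite -(subrK F1 P1) e1; ring.
by field.
Qed.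

(** The product a0 a1 is e^(- quartic |w|) up to the error of the conjugate, and e^(- quartic)
    differs from cos only from degree six on: near equality in the dual constraint at coupled
    points. *)
Let complementary : bO 5 (fun s t u => a0 s t u * a1 s t u - cos (enorm (w s t u))).
Proof.
pose eta : fam := fun s t u => cj s t u - (pot s t (X s t u) - quartic (enorm (w s t u))).
have He : bO 6 eta := bO_conj.
have Hexp : bO 6 (fun s t u => expR (eta s t u) - 1) := bO_expR_sub1 He.
have Hq : bO 6 (fun s t u => expR (- quartic (enorm (w s t u))) - cos (enorm (w s t u))).
  apply: (@bO_le _ _ 6 6 _ (fun s t u => enorm (w s t u) ^+ 6 + enorm (w s t u) ^+ 8)) => //; first by bO_tac.
  apply: (eventually0_mono (bO_small (e := 1) Henw isT ltr01)) => s t u _ _; rewrite ger0_norm ?enorm_ge0// => w1.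
  have := expRN_quartic_le (enorm (w s t u)); have := @cos_le_quartic _ (enorm (w s t u)).
  rewrite enorm_ge0/= (le_trans w1)//; last by have := pi_ge2 R; lra.
  move=> /(_ isT) h1' h2'; rewrite ger0_norm ?subr_ge0//.
  by apply: le_trans (ler_norm _); lra.
have Hq0 : bO 0 (fun s t u => expR (- quartic (enorm (w s t u)))).
  exists 1; apply: eventually0_all => s t u _ _; rewrite mulr1 ger0_norm ?expR_ge0// -expR0 ler_expR oppr_le0.
  exact: quartic_ge0.
apply: (@bO_ext _ _ 5 _ (fun s t u => expR (- quartic (enorm (w s t u))) * (expR (eta s t u) - 1)
   + (expR (- quartic (enorm (w s t u))) - cos (enorm (w s t u))))); first by bO_tac.
move=> s t u _ _; rewrite /a0 /a1 -expRD mulrBr -expRD mulr1 addrA subrK.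
by congr (expR _ - _); rewrite /eta; ring.
Qed.

(** The gap is (r a0 - r' a1)^2 + 2 r r' (a0 a1 - cos |w|): [balance] enters squared, and
    [complementary] enters linearly. *)
Lemma bO_duality_gap : bO 5 (fun s t u =>
  (Num.sqrt (J s t u) * radius s phi (S s t u)) ^+ 2
    * expR (- pot s t (S s t u + disp s phi (S s t u))) ^+ 2
  + radius t psi u ^+ 2 * expR (conj (teval (potential s t)) (u + disp t psi u)) ^+ 2
  - 2 * (Num.sqrt (J s t u) * radius s phi (S s t u)) * radius t psi u
    * cos (enorm (u + disp t psi u - (S s t u + disp s phi (S s t u))))).
Proof.
rewrite -[X in bO 5 X]/(fun s t u => r s t u ^+ 2 * a0 s t u ^+ 2 + r' s t u ^+ 2 * a1 s t u ^+ 2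
  - 2 * r s t u * r' s t u * cos (enorm (w s t u))).
have A := balance; have B := complementary.
have Hr0 : bO 0 r.
  have H := Hr.
  apply: (@bO_ext _ _ 0 _ (fun s t u => (r s t u - (1 + 2 * (s * teval phi u) + (s ^+ 2 * G11 u / 2 + s * t * teval D u / 2))) + (1 + 2 * (s * teval phi u) + (s ^+ 2 * G11 u / 2 + s * t * teval D u / 2)))); first by bO_tac.
  by move=> s t u _ _; rewrite subrK.
have Hr'0 : bO 0 r' := bO_modulus0 Hh2 Hv2.
apply: (@bO_ext _ _ 5 _ (fun s t u => (r s t u * a0 s t u - r' s t u * a1 s t u) ^+ 2
  + 2 * r s t u * r' s t u * (a0 s t u * a1 s t u - cos (enorm (w s t u))))); first by bO_tac.
by move=> s t u _ _; ring.
Qed.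

End DualityGap.

(** * Curvatures of trigonometric polynomials *)

Section Lifts.
Context {R : realType} {n : nat}.
Local Notation M := (torus R n).
Local Notation P := (box_volume R n).
Local Notation mu := (torus_volume R n).
Local Notation tp := (tpoly (R := R) (n := n)).
Implicit Types (a b : tp) (F G : M -> R) (u : 'rV[R]_n).

Definition lifts F a := forall u, F (torus_pi u) = teval a u.

Lemma lifts_scale F a s : lifts F a -> lifts (s \*o F) (tscale s a).
Proof. by move=> Fa u; rewrite teval_scale/= Fa. Qed.

Lemma lifts_comb F G a b s t : lifts F a -> lifts G b ->
  lifts (s \*o F \- t \*o G) (tscale s a ++ tscale (- t) b).
Proof. by move=> Fa Gb u; rewrite teval_cat !teval_scale/= Fa Gb mulNr. Qed.

Lemma grad_lifts F a u : lifts F a -> grad F (torus_pi u) = tgrad a u.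
Proof.
move=> Fa; apply/rowP => p; rewrite !mxE (_ : F \o torus_pi (n:=n) = teval a); last exact/funext.
rewrite derive_teval; have [z ->] := torus_repr_pi u; exact: teval_period.
Qed.

Lemma tgrad_scale s a u : tgrad (tscale s a) u = s *: tgrad a u.
Proof. by apply/rowP => p; rewrite !mxE teval_D_scale. Qed.

Lemma mean_torus (g : M -> R) h : (forall u, g (torus_pi u) = h u) -> bm h ->
  \int[mu]_x g x = mean h.
Proof.
move=> gh bh.
have mg : measurable_fun setT g.
  by apply: measurable_on_torus; under eq_fun do rewrite torus_of_tupleE gh; exact: bh.1.
rewrite /Rintegral /mean; congr fine.
have := @integral_pushforward _ _ _ _ R (@torus_of_tuple R n) (@measurable_torus_of_tuple R n) P setT (EFin \o g).
rewrite preimage_setT => ->//.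
- by apply: eq_integral => t _; rewrite /= torus_of_tupleE gh.
- exact/measurable_EFinP.
- have := bm_integrable bh; apply: eq_integrable => // t _ /=.
  by rewrite torus_of_tupleE gh.
Qed.

Lemma H1_dotE F G a b : lifts F a -> lifts G b -> H1_dot mu F G =
  mean (fun u => \sum_p teval (tD p a) u * teval (tD p b) u + 4 * (teval a u * teval b u)).
Proof.
move=> Fa Gb; apply: mean_torus => [u|].
  rewrite (grad_lifts _ Fa) (grad_lifts _ Gb) Fa Gb mulrA; congr (_ + _).
  by apply: eq_bigr => p _; rewrite !tgradE.
apply: bmD; first by apply: bm_sum => p; apply: bmM; exact: bm_teval.
by apply: bmM; [exact: bm_cst|apply: bmM; exact: bm_teval].
Qed.

Lemma H1_norm2E F a : lifts F a -> H1_norm2 mu F =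
  mean (fun u => \sum_p teval (tD p a) u ^+ 2 + 4 * teval a u ^+ 2).
Proof.
move=> Fa; apply: mean_torus => [u|].
  by rewrite (grad_lifts _ Fa) Fa sqr_enorm; congr (_ + _); apply: eq_bigr => p _; rewrite tgradE.
apply: bmD; first by apply: bm_sum => p; apply: bmX; exact: bm_teval.
by apply: bmM; [exact: bm_cst|apply: bmX; exact: bm_teval].
Qed.

Lemma H1_gap2E F G a b s t : lifts F a -> lifts G b ->
  H1_gap2 mu F G s t = mean (gap_density a b s t).
Proof.
move=> Fa Gb; rewrite /H1_gap2 (H1_norm2E (lifts_comb s t Fa Gb)); apply: eq_mean => u.
rewrite /gap_density addrC teval_cat !teval_scale mulNr; congr (_ + _).
by apply: eq_bigr => p _; rewrite teval_D_cat !teval_D_scale mulNr.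
Qed.

(** The radial component 2 r phi is proportional to r, so that the flow commutes with dilations of
    the cone: the displacement of the base point does not depend on r, and the radius is multiplied
    by [radius s a u]. *)
Lemma cone_flowE F a s u (r : {nonneg R}) : lifts F a -> 0 < r%:num ->
  cone_flow s F (cone_pi (torus_pi u) r) =
  cone_pi (torus_pi (u + disp s a u)) (nngabs (r%:num * radius s a u)).
Proof.
move=> Fa r0; rewrite /cone_flow /cone_exp !cone_rad_pi cone_base_pi// (grad_lifts _ Fa) Fa.
set v := s *: tgrad a u.
have rE : r%:num + s * (2 * r%:num * teval a u) = r%:num * amp s a u by rewrite /amp; ring.
congr cone_pi.
  case: eqVneq => [v0|_].
    by rewrite /disp /polar -/v v0 scaler0 addr0.
  rewrite torus_exp_pi rE; congr (torus_pi (_ + (atan _ / _) *: _)).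
  by rewrite -mulf_div divff ?gt_eqF// mul1r.
apply/val_inj => /=; rewrite rE ger0_norm; last by rewrite mulr_ge0// sqrtr_ge0.
rewrite /radius /modulus -/v.
have -> (y : R) : r%:num * Num.sqrt y = Num.sqrt (r%:num ^+ 2 * y).
  by rewrite sqrtrM ?sqr_ge0// sqrtr_sqr ger0_norm// ltW.
by congr Num.sqrt; ring.
Qed.

Lemma cone_flow_apex F s (c : cone R n) : cone_rad c = 0 -> cone_rad (cone_flow s F c) = 0.
Proof.
move=> c0; rewrite /cone_flow /cone_exp cone_rad_pi/= c0 !(mulr0, mul0r, addr0) expr0n/= mul0r addr0.
by rewrite sqrtr0.
Qed.

Lemma msr_tgrad a s : msr_map (fun u => s *: tgrad a u).
Proof.
move=> p; rewrite (_ : (fun u => _) = fun u => s * teval (tD p a) u).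
  by apply: msrM; [exact: msr_cst|exact: msr_teval].
by apply/funext => u; rewrite !mxE.
Qed.

Lemma msr_amp a s : msr (amp s a).
Proof.
apply: msrD; first exact: msr_cst.
by do 2 (apply: msrM; first exact: msr_cst); exact: msr_teval.
Qed.

Lemma msr_disp a s : msr_map (fun u => u + disp s a u).
Proof.
move=> p; rewrite (_ : (fun u => _) = fun u => u 0 p + atan (enorm (s *: tgrad a u) / amp s a u) / enorm (s *: tgrad a u) * (s *: tgrad a u) 0 p).
  have mv := msr_tgrad a s; have me := msr_enorm mv.
  apply: msrD; first exact: msr_coord.
  apply: msrM; last exact: mv.
  apply: msrM; last exact: msr_inv.
  apply: (@msr_continuous _ _ atan); first exact: continuous_atan.
  by apply: msrM => //; apply: msr_inv; exact: msr_amp.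
by apply/funext => u; rewrite !mxE.
Qed.

Lemma bm_radius a s : bm (radius s a).
Proof.
split.
  apply: msr_sqrt; apply: msrD; apply: msrX; first exact: msr_amp.
  by apply: msr_enorm; exact: msr_tgrad.
have [_ [C aC]] : bm (fun u => amp s a u ^+ 2 + \sum_p (s * teval (tD p a) u) ^+ 2).
  apply: bmD.
    apply: bmX; apply: bmD; first exact: bm_cst.
    by do 2 (apply: bmM; first exact: bm_cst); exact: bm_teval.
  by apply: bm_sum => p; apply: bmX; apply: bmM; [exact: bm_cst|exact: bm_teval].
exists (Num.sqrt C) => u; rewrite ger0_norm ?sqrtr_ge0//; apply: ler_wsqrtr.
apply: le_trans (aC u); apply: le_trans (ler_norm _); rewrite sqr_enorm lerD2l.
by apply: ler_sum => p _; rewrite !mxE.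
Qed.

Lemma disp_period a s u z : disp s a (u + lattice z) = disp s a u.
Proof.
rewrite /disp /amp teval_period (_ : tgrad a (u + lattice z) = tgrad a u)//.
by apply/rowP => p; rewrite !mxE teval_period.
Qed.

Lemma radius_period a s u z : radius s a (u + lattice z) = radius s a u.
Proof.
rewrite /radius /amp teval_period (_ : tgrad a (u + lattice z) = tgrad a u)//.
by apply/rowP => p; rewrite !mxE teval_period.
Qed.

Lemma fine_mu1 : fine (mu setT) = 1.
Proof. by rewrite [X in fine X]probability_setT. Qed.

Lemma hat_muE (B : set (cone R n)) : hat_mu mu B = P [set t | B (cone_pi (torus_of_tuple t) (rmu mu))].
Proof.
by rewrite /hat_mu /= fine_mu1 sqrtr1 expr1n invr1 mul1e.
Qed.

Lemma rmu1 : (rmu mu)%:num = 1.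
Proof. by rewrite /= fine_mu1 sqrtr1. Qed.

Lemma cone_flow_law F a s t : lifts F a ->
  cone_flow 1 (s \*o F) (cone_pi (torus_of_tuple t) (rmu mu)) =
  cone_map (fun u => u + disp s a u) (radius s a) t.
Proof.
move=> Fa; rewrite torus_of_tupleE (cone_flowE 1 _ (lifts_scale s Fa)) rmu1// mul1r /cone_map.
by rewrite /disp /radius /amp teval_scale tgrad_scale scale1r mul1r.
Qed.

Lemma exp_muE F a s (mX : msr_map (fun u => u + disp s a u)) (mr : msr (radius s a)) : lifts F a ->
  exp_mu mu (s \*o F) = Pr (image_measure P (measurable_cone_map mX mr)).
Proof.
move=> Fa; congr Pr; apply/funext => B.
apply: (eq_trans (hat_muE (cone_flow 1 (s \*o F) @^-1` B))).
have E : [set t | (cone_flow 1 (s \*o F) @^-1` B) (cone_pi (torus_of_tuple t) (rmu mu))] =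
    cone_map (fun u => u + disp s a u) (radius s a) @^-1` B.
  by apply/seteqP; split => t /=; rewrite (cone_flow_law _ _ Fa).
by rewrite E.
Qed.

End Lifts.

Section Costs.
Context {R : realType} {n : nat}.
Local Notation M := (torus R n).
Local Notation P := (box_volume R n).
Local Notation mu := (torus_volume R n).
Local Notation tp := (tpoly (R := R) (n := n)).
Implicit Types (a b : tp) (F G : M -> R) (u : 'rV[R]_n).

Lemma hat_mu_law : hat_mu mu =
  image_measure P (measurable_cone_map (@msr_id R n) (@msr_cst R n 1)) :> (set (cone R n) -> \bar R).
Proof.
apply/funext => B; apply: (eq_trans (hat_muE B)).
have E : [set t | B (cone_pi (torus_of_tuple t) (rmu mu))] = cone_map id (fun=> 1) @^-1` B.
  have r1 : rmu mu = nngabs (1 : R) by apply/val_inj; rewrite /= rmu1 normr1.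
  by apply/seteqP; split => t; rewrite /= r1.
by rewrite E.
Qed.

Definition flow_cost a b s t u : R :=
  cone_cost (torus_pi (u + disp s a u)) (torus_pi (u + disp t b u)) (radius s a u) (radius t b u).

Lemma cone_flow_cost F G a b s t u (r : {nonneg R}) : lifts F a -> lifts G b ->
  cone_dist (cone_flow s F (cone_pi (torus_pi u) r)) (cone_flow t G (cone_pi (torus_pi u) r)) ^+ 2 =
  r%:num ^+ 2 * flow_cost a b s t u.
Proof.
move=> Fa Gb; have [r0|r0] := ltrP 0 r%:num.
  rewrite (cone_flowE s u Fa r0) (cone_flowE t u Gb r0) cone_cost_pi /= !ger0_norm;
    try by rewrite mulr_ge0// sqrtr_ge0.
  by rewrite /flow_cost /cone_cost; ring.
have {}r0 : r%:num = 0 by apply/le_anti; rewrite r0/=.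
have c0 : cone_rad (cone_pi (torus_pi u) r) = 0 by rewrite cone_rad_pi.
have := cone_flow_apex G t c0; have := cone_flow_apex F s c0.
move: (cone_flow s F _) (cone_flow t G _) => x y x0 y0.
by rewrite cone_dist_sqr x0 y0 r0 /cone_cost !(expr0n, mul0r, mulr0, addr0, subr0).
Qed.

(** By homogeneity the integrand is r^2 times a function of the base point alone, even at the apex,
    which is the form integrated by [integral_cone_law]. *)
Lemma IcostE F G a b s t : lifts F a -> lifts G b -> bm (flow_cost a b s t) ->
  Icost mu F G s t = mean (flow_cost a b s t).
Proof.
move=> Fa Gb bK.
pose k x := cone_dist (cone_flow s F (cone_pi x (nngabs 1))) (cone_flow t G (cone_pi x (nngabs 1))) ^+ 2.
have kE u : k (torus_pi u) = flow_cost a b s t u.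
  by rewrite /k (cone_flow_cost _ _ _ _ Fa Gb)/= normr1 expr1n mul1r.
have mk : measurable_fun setT k.
  by apply: measurable_on_torus; under eq_fun do rewrite torus_of_tupleE kE; exact: bK.1.
have k0 x : 0 <= k x by exact: sqr_ge0.
have gE c : cone_dist (cone_flow s F c) (cone_flow t G c) ^+ 2 = cone_rad c ^+ 2 * k (cone_base0 c).
  have [x [r <-]] := cone_pi_surj c; have [u <-] := torus_pi_surj x.
  by rewrite rad_base0_pi kE (cone_flow_cost _ _ _ _ Fa Gb).
rewrite /Icost hat_mu_law.
under eq_integral do rewrite gE.
rewrite (integral_cone_law _ mk k0) /mean /Rintegral; congr fine; apply: eq_integral => x _.
by rewrite expr1n mul1r kE.
Qed.

Lemma cone_cost_near (x y : 'rV[R]_n) (r r' : R) : enorm (x - y) <= pi ->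
  cone_cost (torus_pi x) (torus_pi y) r r' = r ^+ 2 + r' ^+ 2 - 2 * r * r' * cos (enorm (x - y)).
Proof.
move=> xy; rewrite /cone_cost torus_dist_pi; first by rewrite min_l.
by move=> p; apply: le_trans (coord_le_enorm _ p) xy.
Qed.

End Costs.

Section Averages.
Context {R : realType} {n : nat}.
Local Notation fam := (R -> R -> 'rV[R]_n -> R).

Lemma bO_mean k (F : fam) : bO k F -> eventually0 (fun s t (_ : 'rV[R]_n) => bm (F s t)) ->
  bO k (fun s t (_ : 'rV[R]_n) => mean (F s t)).
Proof.
move=> [C [d d0 FC]] [e e0 bF]; exists C; exists (Num.min d e); first by rewrite lt_min d0.
move=> s t u s0 t0; rewrite !lt_min => /andP[sd se] /andP[td te].
apply: ler_norm_mean => [|v]; [exact: bF u s0 t0 se te|exact: FC].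
Qed.

End Averages.

Ltac bm_tac := repeat first
  [ exact: bm_cst | exact: bm_teval | exact: bm_radius | apply: bmB | apply: bmD | apply: bmM | apply: bmX
  | (apply: bm_sum => ?) ].

Section Asymptotics.
Context {R : realType} {n : nat}.
Local Notation tp := (tpoly (R := R) (n := n)).

Lemma bm_comp (f : 'rV[R]_n -> R) S : bm f -> msr_map S -> bm (fun u => f (S u)).
Proof. by move=> [mf [C fC]] mS; split; [exact: msr_comp|exists C]. Qed.

Lemma bm_gap_density (phi psi : tp) s t : bm (gap_density phi psi s t).
Proof. by rewrite /gap_density; bm_tac. Qed.

Lemma bm_cost_correction (phi psi D : tp) Z s t : bm (cost_correction phi psi D Z s t).
Proof.
rewrite /cost_correction /hess_Z /=; do 2?[apply: bmD]; bm_tac.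
Qed.

Lemma bm_step_cost (phi psi : tp) s t (X : 'rV[R]_n -> 'rV[R]_n) (l : 'rV[R]_n -> R) :
  msr_map X -> bm l -> bm (fun u => cone_step_cost phi psi s t u (X u) (l u)).
Proof.
move=> mX bl; have br := bm_comp (bm_radius phi s) mX; have br' := bm_radius psi t.
have bc : bm (fun u => cos (enorm (u + disp t psi u - (X u + disp s phi (X u))))).
  split; last by exists 1 => u; exact: cos_max.
  apply: (@msr_continuous _ _ cos); first exact: continuous_cos.
  apply: (@msr_enorm _ _ (fun u => u + disp t psi u - (X u + disp s phi (X u)))) => p.
  rewrite (_ : (fun u => _) = fun u => (u + disp t psi u) 0 p - (X u + disp s phi (X u)) 0 p).
    by apply: msrB; [exact: msr_disp|exact: (msr_comp (msr_disp phi s p) mX)].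
  by apply/funext => u; rewrite !mxE.
apply: bmB; first by apply: bmD; [apply: bmM; exact: bmX|exact: bmX].
by do 4![apply: bmM => //]; exact: bm_cst.
Qed.

Section Transport.
Variables (phi psi chi : tp) (Z : 'I_n -> tp).
Local Notation D := (tsum (fun p => tD p (Z p))).
Let S s t := shears Z (index_enum 'I_n) (s * t).
Let J s t := shears_jac Z (index_enum 'I_n) (s * t).

Let near_shears : exists2 C : R, 0 <= C & eventually0 (fun s t (u : 'rV[R]_n) =>
  vol_pres (S s t) (J s t) /\
  (forall q, `|S s t u 0 q - (u 0 q + s * t * teval (Z q) u)| <= C * (s + t) ^+ 4) /\
   `|J s t u - (1 + s * t * teval D u)| <= C * (s + t) ^+ 4).
Proof.
have [C [d [d0 H]]] := shears_estimate Z (index_enum 'I_n); exists `|C| => //.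
exists (Num.min d 1); first by rewrite lt_min d0 ltr01.
move=> s t u s0 t0; rewrite !lt_min => /andP[sd s1] /andP[td t1].
have st0 : 0 < s * t by rewrite mulr_gt0.
have [|V /(_ u)[H1 H2]] := H (s * t).
  by rewrite gtr0_norm//; apply: lt_trans sd; rewrite -[ltRHS]mulr1 ltr_pM2l.
(* An error quadratic in [delta] = s t has order four, because s t <= (s + t)^2. *)
have le4 : C * (s * t) ^+ 2 <= `|C| * (s + t) ^+ 4.
  apply: (@le_trans _ _ (`|C| * (s * t) ^+ 2)); first by rewrite ler_wpM2r ?sqr_ge0 ?ler_norm.
  rewrite ler_wpM2l// -[4%N]/(2 * 2)%N exprM lerXn2r ?nnegrE ?sqr_ge0 ?(ltW st0)//.
  by rewrite sqrrD; have := sqr_ge0 s; have := sqr_ge0 t; lra.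
split => //; split.
  by move=> q; have := H1 q; rewrite big_pred1_eq => /le_trans; apply.
by move: H2; rewrite -teval_sum => /le_trans; apply.
Qed.

Lemma bO_shears p : bO 4 (fun s t u => S s t u 0 p - (u 0 p + s * t * teval (Z p) u)).
Proof.
have [C _ H] := near_shears; exists C.
by apply: (eventually0_mono H) => s t u _ _ [_ []].
Qed.

Lemma bO_shears_jac : bO 4 (fun s t u => J s t u - (1 + s * t * teval D u)).
Proof.
have [C _ H] := near_shears; exists C.
by apply: (eventually0_mono H) => s t u _ _ [_ []].
Qed.

Lemma shears_vol_pres : eventually0 (fun s t (_ : 'rV[R]_n) => vol_pres (S s t) (J s t)).
Proof.
have [C _ H] := near_shears.
by apply: (eventually0_mono H) => s t u _ _ [].
Qed.

End Transport.
End Asymptotics.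

(** * Expansion of the squared distance *)

Section Transport.
Context {R : realType} {n : nat}.
Local Notation fam := (R -> R -> 'rV[R]_n -> R).
Local Notation vfam := (R -> R -> 'rV[R]_n -> 'rV[R]_n).
Local Notation M := (torus R n).
Local Notation P := (box_volume R n).
Local Notation mu := (torus_volume R n).
Local Notation tp := (tpoly (R := R) (n := n)).
Implicit Types (F G : M -> R).

Lemma eventually0_uniform (Q : R -> R -> 'rV[R]_n -> Prop) : eventually0 Q ->
  eventually0 (fun s t (_ : 'rV[R]_n) => forall u, Q s t u).
Proof. by move=> [d d0 dQ]; exists d => // s t _ s0 t0 sd td u; exact: dQ. Qed.

Variables (phi psi chi D : tp) (Z : 'I_n -> tp).
Variables (S : vfam) (J : fam).
Hypothesis HS : forall p, bO 4 (fun s t u => S s t u 0 p - (u 0 p + s * t * teval (Z p) u)).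
Hypothesis HJ : bO 4 (fun s t u => J s t u - (1 + s * t * teval D u)).
Hypothesis HV : eventually0 (fun s t (_ : 'rV[R]_n) => vol_pres (S s t) (J s t)).

Local Notation lam s t u := (Num.sqrt (J s t u)).
Local Notation step s t u := (cone_step_cost phi psi s t u (S s t u) (lam s t u)).

Let bm_lam : eventually0 (fun s t (_ : 'rV[R]_n) => bm (fun u => lam s t u)).
Proof.
have H : bO 1 (fun s t u => J s t u - 1).
  apply: (@bO_ext _ _ 1 _ (fun s t u => (J s t u - (1 + s * t * teval D u)) + s * t * teval D u)); first by bO_tac.
  by move=> s t u _ _; ring.
apply: (eventually0_mono (eventually0_and HV (eventually0_uniform (bO_small (e := 1) H isT ltr01)))).
move=> s t _ _ _ [[[_ mJ _ _ _] _] J1]; split; first exact: msr_sqrt.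
exists (Num.sqrt 2) => u; rewrite ger0_norm ?sqrtr_ge0//; apply: ler_wsqrtr.
by have := J1 u; rewrite ler_norml => /andP[_]; lra.
Qed.

Let bm_step : eventually0 (fun s t (_ : 'rV[R]_n) => bm (fun u => step s t u)).
Proof.
apply: (eventually0_mono (eventually0_and HV bm_lam)) => s t _ _ _ [[[mS _ _ _ _] _] bl].
exact: bm_step_cost.
Qed.

Lemma bO_mean_cost : bO 5 (fun s t (_ : 'rV[R]_n) => mean (fun u => step s t u)
  - mean (fun u => gap_density phi psi s t u + cost_correction phi psi D Z s t u)).
Proof.
have bg s t : bm (fun u => gap_density phi psi s t u + cost_correction phi psi D Z s t u).
  by apply: bmD; [exact: bm_gap_density|exact: bm_cost_correction].
apply: (bO_eventually_ext (bO_mean (bO_cost phi psi HS HJ) _)).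
  by apply: (eventually0_mono bm_step) => s t _ _ _ bs; exact: bmB.
by apply: (eventually0_mono bm_step) => s t _ _ _ bs; rewrite meanB.
Qed.

Hypothesis DE : forall u, teval D u = - 4 * teval chi u.
Hypothesis ZE : forall p u, teval (Z p) u =
  (\sum_q (teval (tD q (tD p phi)) u * teval (tD q psi) u
          - teval (tD q (tD p psi)) u * teval (tD q phi) u)) / 2 - teval (tD p chi) u.
Variables (F G : M -> R).
Hypotheses (Fphi : lifts F phi) (Gpsi : lifts G psi).

Local Notation pot s t u := (teval (potential phi psi chi s t) u).
Local Notation X0 s u := (u + disp s phi u).
Local Notation X1 t u := (u + disp t psi u).
Local Notation gap s t := (fun u =>
  (lam s t u * radius s phi (S s t u)) ^+ 2 * expR (- pot s t (X0 s (S s t u))) ^+ 2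
  + radius t psi u ^+ 2 * expR (conj (teval (potential phi psi chi s t)) (X1 t u)) ^+ 2
  - 2 * (lam s t u * radius s phi (S s t u)) * radius t psi u
    * cos (enorm (X1 t u - X0 s (S s t u)))).

(** The coupling through S gives the upper bound. For the lower one, volume preservation rewrites
    the means attached to the first measure at S u, with mass J; the dual value then becomes the
    mean cost of the coupling minus the mean of the defect [gap], so that both bounds are compared
    under the same integral. *)
Let HK2_bounds : eventually0 (fun s t (_ : 'rV[R]_n) => bm (gap s t) /\
  mean (fun u => step s t u) - mean (gap s t) <= HK2 mu F G s t <= mean (fun u => step s t u)).
Proof.
have near := eventually0_uniform (bO_small (e := pi) (bO_displacement phi psi HS) isT (pi_gt0 R)).
apply: (eventually0_mono (eventually0_and HV (eventually0_and bm_lam (eventually0_and bm_step near)))).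
move=> s t _ s0 t0 [[[mS mJ J0 SP JP] SJ] [bl [bs nr]]].
have VP : vol_pres (S s t) (J s t) by [].
set f := teval (potential phi psi chi s t).
have [B fB] : exists C, forall u, `|f u| <= C by exact: teval_bounded.
have [L fL] : exists L, forall u v, `|f u - f v| <= L * enorm (u - v).
  have [L H] := teval_lipschitz (potential phi psi chi s t); exists L => u v.
  by have := H v (u - v); rewrite (_ : v + (u - v) = u)// addrC subrK.
have fP u z : f (u + lattice z) = f u by exact: teval_period.
have mf : msr f by exact: msr_teval.
pose r0 := radius s phi; pose r1 := radius t psi.
(* Masses are squared radii, so that the Jacobian J enters through its square root. *)
pose r0' u := lam s t u * r0 (S s t u).
have br0 : bm r0 := bm_radius phi s; have br1 : bm r1 := bm_radius psi t.
have br0S : bm (fun u => r0 (S s t u)) := bm_comp br0 mS.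
have br0' : bm r0' by exact: bmM.
have mX0 : msr_map (fun u => X0 s u) := msr_disp phi s.
have mX1 : msr_map (fun u => X1 t u) := msr_disp psi t.
have mX0' : msr_map (fun u => X0 s (S s t u)) by move=> p; exact: (msr_comp (mX0 p) mS).
have lam2 u : lam s t u ^+ 2 = J s t u by rewrite sqr_sqrtr// ltW.
have X0P u z : X0 s (u + lattice z) = X0 s u + lattice z by rewrite disp_period addrAC.
have r0P u z : r0 (u + lattice z) = r0 u := radius_period phi s u z.
have same_mass (h : M -> R) : measurable_fun setT h -> (forall x, 0 <= h x) ->
  (\int[P]_v (r0' (row_of v) ^+ 2 * h (torus_pi (X0 s (S s t (row_of v)))))%:E =
   \int[P]_v (r0 (row_of v) ^+ 2 * h (torus_pi (X0 s (row_of v))))%:E)%E.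
  move=> mh h0; rewrite -(SJ (fun u => r0 u ^+ 2 * h (torus_pi (X0 s u)))).
  - by apply: eq_integral => v _; rewrite /r0' exprMn lam2 mulrA.
  - by apply: msrM; [apply: msrX; exact: br0.1|exact: (measurable_comp_torus_pi mh mX0)].
  - by move=> u; rewrite mulr_ge0// sqr_ge0.
  - by move=> u z; rewrite r0P X0P torus_pi_shift.
have costE u : cone_costs (fun u => X1 t u) (fun u => X0 s (S s t u)) r1 r0' u = step s t u.
  have e : enorm (X0 s (S s t u) - X1 t u) = enorm (X1 t u - X0 s (S s t u)) by rewrite -enormN opprB.
  rewrite /cone_costs cone_cost_near e; last by apply: le_trans (nr u); exact: ler_norm.
  rewrite /cone_step_cost !ger0_norm ?sqrtr_ge0//; last by rewrite mulr_ge0// sqrtr_ge0.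
  by rewrite /r0' exprMn !mulrA.
have costE' : cone_costs (fun u => X1 t u) (fun u => X0 s (S s t u)) r1 r0' = (fun u => step s t u).
  exact/funext.
have bcost : bm (cone_costs (fun u => X1 t u) (fun u => X0 s (S s t u)) r1 r0') by rewrite costE'.
have /andP[lo hi] := HK_sqr_bounds mX0' br0' (exp_muE mX0 br0.1 Fphi) (exp_muE mX1 br1.1 Gpsi)
  same_mass bcost (measurable_dual0 mf fP) (measurable_dual1 fB fL fP) (dual0_bounded fB)
  (dual1_bounded fB) (dual_admissible fB fP).
pose e0 u := expR (- f u); pose e1 u := expR (conj f u).
have be0 : bm e0.
  split; first by apply: (@msr_continuous _ _ expR); [exact: continuous_expR|apply: (@msr_continuous _ _ -%R) => //; exact: opp_continuous].
  exists (expR B) => u; rewrite ger0_norm ?expR_ge0// ler_expR.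
  by have := fB u; rewrite ler_norml => /andP[h _]; lra.
have be1 : bm e1.
  split; first by apply: (@msr_continuous _ _ expR); [exact: continuous_expR|exact: msr_lipschitz (conj_lipschitz fB fL)].
  exists (expR B) => u; rewrite ger0_norm ?expR_ge0// ler_expR.
  by have := conj_bounded fB u; rewrite ler_norml => /andP[].
have d0E u : dual0 f (torus_pi u) = e0 u by rewrite /dual0 periodic_repr.
have d1E u : dual1 f (torus_pi u) = e1 u.
  by rewrite /dual1 (periodic_repr (fun u z => conj_period (fP^~ z) u)).
have bg0 : bm (fun u => r0' u ^+ 2 * e0 (X0 s (S s t u)) ^+ 2).
  exact: (bmM (bmX 2 br0') (bmX 2 (bm_comp be0 mX0'))).
have bg1 : bm (fun u => r1 u ^+ 2 * e1 (X1 t u) ^+ 2).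
  exact: (bmM (bmX 2 br1) (bmX 2 (bm_comp be1 mX1))).
have br0'2 : bm (fun u => r0' u ^+ 2) by exact: (bmX 2 br0').
have br12 : bm (fun u => r1 u ^+ 2) by exact: (bmX 2 br1).
have bc : bm (fun u => 2 * r0' u * r1 u * cos (enorm (X1 t u - X0 s (S s t u)))).
  have -> : (fun u => 2 * r0' u * r1 u * cos (enorm (X1 t u - X0 s (S s t u)))) =
      fun u => r0' u ^+ 2 + r1 u ^+ 2 - step s t u.
    by apply/funext => u; rewrite /cone_step_cost /r0' /r0 /r1; ring.
  by apply: bmB => //; exact: bmD.
have bgap : bm (gap s t) by apply: bmB => //; exact: bmD.
split => //; apply/andP; split; last by rewrite -costE'.
suff -> : mean (fun u => step s t u) - mean (gap s t) = dual_value (fun u => X0 s u) (fun u => X1 t u) r0 r1 (dual0 f) (dual1 f) by [].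
have transfer (h : 'rV[R]_n -> R) : bm h -> (forall u z, h (u + lattice z) = h u) -> (forall u, 0 <= h u) ->
    mean (fun u => r0 u ^+ 2 * h (X0 s u)) = mean (fun u => r0' u ^+ 2 * h (X0 s (S s t u))).
  move=> bh hP h0; rewrite -(@mean_vol_pres_ge0 _ _ (S s t) (J s t) (fun u => r0 u ^+ 2 * h (X0 s u)) VP).
  - by apply: eq_mean => u; rewrite /r0' exprMn lam2 mulrA.
  - by apply: bmM; [exact: bmX|exact: (bm_comp bh mX0)].
  - rewrite (_ : (fun u => _) = fun u => r0' u ^+ 2 * h (X0 s (S s t u))).
      by apply: bmM => //; exact: (bm_comp bh mX0').
    by apply/funext => u; rewrite /r0' exprMn lam2 mulrA.
  - by move=> u; rewrite mulr_ge0// sqr_ge0.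
  - by move=> u z; rewrite r0P X0P hP.
rewrite /dual_value.
have -> : mean (fun u => r0 u ^+ 2) = mean (fun u => r0' u ^+ 2).
  have := transfer (fun=> 1) (bm_cst 1) (fun _ _ => erefl) (fun=> ler01).
  by under eq_mean do rewrite mulr1; under [in RHS]eq_mean do rewrite mulr1.
have -> : mean (fun u => r0 u ^+ 2 * dual0 f (torus_pi (X0 s u)) ^+ 2) =
    mean (fun u => r0' u ^+ 2 * e0 (X0 s (S s t u)) ^+ 2).
  under eq_mean do rewrite d0E.
  apply: (transfer (fun u => e0 u ^+ 2)).
  - exact: bmX.
  - by move=> u z; rewrite /e0 fP.
  - by move=> u; exact: sqr_ge0.
have -> : mean (fun u => r1 u ^+ 2 * dual1 f (torus_pi (X1 t u)) ^+ 2) =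
    mean (fun u => r1 u ^+ 2 * e1 (X1 t u) ^+ 2).
  by apply: eq_mean => u; rewrite d1E.
have -> : mean (gap s t) = mean (fun u => r0' u ^+ 2 * e0 (X0 s (S s t u)) ^+ 2)
   + mean (fun u => r1 u ^+ 2 * e1 (X1 t u) ^+ 2)
   - mean (fun u => 2 * r0' u * r1 u * cos (enorm (X1 t u - X0 s (S s t u)))).
  by rewrite -meanD// -meanB//; exact: bmD.
have -> : mean (fun u => step s t u) = mean (fun u => r0' u ^+ 2) + mean (fun u => r1 u ^+ 2)
   - mean (fun u => 2 * r0' u * r1 u * cos (enorm (X1 t u - X0 s (S s t u)))).
  rewrite -meanD// -meanB//; last exact: bmD.
  by apply: eq_mean => u; rewrite /cone_step_cost /r0' /r0 /r1; ring.
by ring.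
Qed.

Lemma bO_HK2 : bO 5 (fun s t (_ : 'rV[R]_n) => HK2 mu F G s t - mean (fun u => step s t u)).
Proof.
have bgap : eventually0 (fun s t (_ : 'rV[R]_n) => bm (gap s t)).
  by apply: (eventually0_mono HK2_bounds) => s t _ _ _ [].
apply: (bO_le (bO_mean (bO_duality_gap HS HJ DE ZE) bgap)) => //.
apply: (eventually0_mono HK2_bounds) => s t _ _ _ [_ /andP[lo hi]].
rewrite ler0_norm ?subr_le0// opprB; apply: le_trans (ler_norm _); lra.
Qed.

End Transport.

(** * Means of the fourth-order terms and passage to the limit *)

Section Averages.
Context {R : realType} {n : nat}.
Local Notation tp := (tpoly (R := R) (n := n)).

Section Identity.
Variables (phi psi chi D : tp) (Z : 'I_n -> tp).
Hypothesis DZ : forall u, teval D u = \sum_p teval (tD p (Z p)) u.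
Hypothesis DE : forall u, teval D u = - 4 * teval chi u.
Hypothesis ZE : forall p u, teval (Z p) u =
  (\sum_q (teval (tD q (tD p phi)) u * teval (tD q psi) u
          - teval (tD q (tD p psi)) u * teval (tD q phi) u)) / 2 - teval (tD p chi) u.

Let G11 := tsum (fun p => tmul (tD p phi) (tD p phi)).
Let G12 := tsum (fun p => tmul (tD p phi) (tD p psi)).

(* [D h + Z . grad h] is the divergence of [h Z], of mean zero *)
Let flux h := tsum (fun p => tD p (tmul (Z p) h)).

Let fluxE h u : teval (flux h) u = teval D u * teval h u + \sum_p teval (Z p) u * teval (tD p h) u.
Proof.
rewrite teval_sum DZ mulr_suml -big_split/=; apply: eq_bigr => p _.
by rewrite teval_D_mul.
Qed.

Let mean_flux h : mean (teval (flux h)) = 0.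
Proof.
rewrite (@eq_mean _ _ _ (fun u => \sum_p teval (tD p (tmul (Z p) h)) u)); last by move=> u; rewrite teval_sum.
rewrite mean_sum; last by move=> p; exact: bm_teval.
by apply: big1 => p _; exact: mean_tD.
Qed.

(** Apart from the last, its coefficients are those that multiply D linearly in [cost_correction].
    The last one, in chi, serves to reverse the sign of D^2 / 4 = 4 chi^2: its product with D = - 4
    chi is 8 chi^2. *)
Let H (s t : R) : tp := tscale (2 * s ^+ 2 * t) phi ++ tscale (- 2 * s * t ^+ 2) psi
  ++ tscale (4 * s ^+ 3 * t) (tmul phi phi) ++ tscale (s ^+ 3 * t) G11
  ++ tscale (- 4 * s ^+ 2 * t ^+ 2) (tmul phi psi) ++ tscale (- s ^+ 2 * t ^+ 2) G12
  ++ tscale (- 2 * s ^+ 2 * t ^+ 2) chi.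

Definition gram (phi psi : tp) (u : 'rV[R]_n) : R :=
  (\sum_p teval (tD p phi) u ^+ 2) * (\sum_p teval (tD p psi) u ^+ 2)
  - (\sum_p teval (tD p phi) u * teval (tD p psi) u) ^+ 2.

(** The equation for Z gives 2 |Z|^2 = Z . (Hess phi grad psi - Hess psi grad phi) - 2 Z . grad chi.
    With it, the terms |Z|^2 + D^2 / 4 and the remaining terms linear in Z become - (|Z|^2 + 4
    chi^2) plus a divergence: at the optimum the gain from moving mass is twice its own cost. *)
Lemma cost_correctionE s t u : cost_correction phi psi D Z s t u =
  s ^+ 2 * t ^+ 2 * (gram phi psi u / 3 - (\sum_p teval (Z p) u ^+ 2 + 4 * teval chi u ^+ 2))
  + teval (flux (H s t)) u.
Proof.
rewrite fluxE /cost_correction /gram /=.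
pose g p := teval (tD p phi) u; pose h p := teval (tD p psi) u; pose z p := teval (Z p) u.
pose x p := teval (tD p chi) u.
pose K p q := teval (tD q (tD p phi)) u; pose L p q := teval (tD q (tD p psi)) u.
have KC p q : K p q = K q p by exact: teval_DC.
have LC p q : L p q = L q p by exact: teval_DC.
have eH p : hess_Z phi Z p u = \sum_q K p q * z q by [].
have eG11 p : teval (tD p G11) u = 2 * \sum_q K p q * g q.
  rewrite teval_D_sum mulr_sumr; apply: eq_bigr => q _.
  by rewrite teval_D_mul teval_DC /K /g; ring.
have eG12 p : teval (tD p G12) u = \sum_q (K p q * h q + L p q * g q).
  rewrite teval_D_sum; apply: eq_bigr => q _.
  by rewrite teval_D_mul teval_DC [teval (tD p (tD q psi)) u]teval_DC /K /L /g /h; ring.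
have zE p : z p = (\sum_q K p q * h q - \sum_q L p q * g q) / 2 - x p.
  by rewrite /z ZE -sumrB.
have E11 : teval G11 u = \sum_p g p ^+ 2.
  by rewrite teval_sum; apply: eq_bigr => p _; rewrite teval_mul expr2.
have E12 : teval G12 u = \sum_p g p * h p.
  by rewrite teval_sum; apply: eq_bigr => p _; rewrite teval_mul.
have E : teval (H s t) u = 2 * s ^+ 2 * t * teval phi u - 2 * s * t ^+ 2 * teval psi u
    + 4 * s ^+ 3 * t * teval phi u ^+ 2 + s ^+ 3 * t * (\sum_p g p ^+ 2)
    - 4 * s ^+ 2 * t ^+ 2 * (teval phi u * teval psi u) - s ^+ 2 * t ^+ 2 * (\sum_p g p * h p)
    - 2 * s ^+ 2 * t ^+ 2 * teval chi u.
  rewrite -E11 -E12 /H; move: G11 G12 => a b.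
  by rewrite !teval_cat !teval_scale !teval_mul; ring.
have DH p : teval (tD p (H s t)) u = 2 * s ^+ 2 * t * g p - 2 * s * t ^+ 2 * h p
    + 8 * s ^+ 3 * t * (teval phi u * g p) + s ^+ 3 * t * (2 * \sum_q K p q * g q)
    - 4 * s ^+ 2 * t ^+ 2 * (teval phi u * h p + teval psi u * g p)
    - s ^+ 2 * t ^+ 2 * (\sum_q K p q * h q + \sum_q L p q * g q)
    - 2 * s ^+ 2 * t ^+ 2 * x p.
  rewrite -eG11 -big_split -eG12 /H /g /h /x; move: G11 G12 => a b.
  by rewrite !teval_D_cat !teval_D_scale !teval_D_mul; ring.
have S2 : \sum_p z p * (\sum_q K p q * g q) = \sum_p g p * hess_Z phi Z p u.
  under eq_bigr do rewrite mulr_sumr; rewrite exchange_big/=.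
  apply: eq_bigr => q _; rewrite eH mulr_sumr; apply: eq_bigr => p _; rewrite KC; ring.
have S3 : \sum_p z p * (\sum_q K p q * h q) = \sum_p h p * hess_Z phi Z p u.
  under eq_bigr do rewrite mulr_sumr; rewrite exchange_big/=.
  apply: eq_bigr => q _; rewrite eH mulr_sumr; apply: eq_bigr => p _; rewrite KC; ring.
have S4 : \sum_p z p ^+ 2 = (\sum_p z p * (\sum_q K p q * h q) - \sum_p z p * (\sum_q L p q * g q)) / 2
   - \sum_p z p * x p.
  rewrite -sumrB mulr_suml -sumrB; apply: eq_bigr => p _.
  by rewrite expr2 {2}zE; ring.
have S5 : \sum_p z p * teval (tD p (H s t)) u =
    2 * s ^+ 2 * t * (\sum_p g p * z p) - 2 * s * t ^+ 2 * (\sum_p h p * z p)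
    + 8 * s ^+ 3 * t * teval phi u * (\sum_p g p * z p)
    + 2 * s ^+ 3 * t * (\sum_p z p * \sum_q K p q * g q)
    - 4 * s ^+ 2 * t ^+ 2 * teval phi u * (\sum_p h p * z p)
    - 4 * s ^+ 2 * t ^+ 2 * teval psi u * (\sum_p g p * z p)
    - s ^+ 2 * t ^+ 2 * (\sum_p z p * \sum_q K p q * h q)
    - s ^+ 2 * t ^+ 2 * (\sum_p z p * \sum_q L p q * g q)
    - 2 * s ^+ 2 * t ^+ 2 * (\sum_p z p * x p).
  move: (teval phi u) (teval psi u) DH => a b DH.
  rewrite !mulr_sumr -!sumrN -!big_split/=; apply: eq_bigr => p _.
  by rewrite DH; ring.
rewrite -[\sum_p teval (Z p) u * teval (tD p (H s t)) u]/(\sum_p z p * teval (tD p (H s t)) u) S5 E.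
rewrite -[\sum_p teval (tD p phi) u * hess_Z phi Z p u]/(\sum_p g p * hess_Z phi Z p u) -S2.
rewrite -[\sum_p teval (tD p psi) u * hess_Z phi Z p u]/(\sum_p h p * hess_Z phi Z p u) -S3.
rewrite -[\sum_p teval (tD p phi) u ^+ 2]/(\sum_p g p ^+ 2) -[\sum_p teval (tD p psi) u ^+ 2]/(\sum_p h p ^+ 2).
rewrite -[\sum_p teval (tD p phi) u * teval (tD p psi) u]/(\sum_p g p * h p).
rewrite -[\sum_p teval (tD p phi) u * teval (Z p) u]/(\sum_p g p * z p).
rewrite -[\sum_p teval (tD p psi) u * teval (Z p) u]/(\sum_p h p * z p).
rewrite -[\sum_p teval (Z p) u ^+ 2]/(\sum_p z p ^+ 2).
rewrite S4 DE.
move: (\sum_p z p * (\sum_q K p q * h q)) (\sum_p z p * (\sum_q L p q * g q)) (\sum_p z p * x p) => a b c.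
move: (\sum_p z p * (\sum_q K p q * g q)) (\sum_p g p ^+ 2) (\sum_p h p ^+ 2) (\sum_p g p * h p) (\sum_p g p * z p) (\sum_p h p * z p) => *.
move: (teval phi u) (teval psi u) (teval chi u) => *.
by field.
Qed.

Lemma mean_cost_correction s t : mean (cost_correction phi psi D Z s t) =
  s ^+ 2 * t ^+ 2 * (mean (gram phi psi) / 3
    - mean (fun u => \sum_p teval (Z p) u ^+ 2 + 4 * teval chi u ^+ 2)).
Proof.
have bg : bm (gram phi psi) by rewrite /gram; bm_tac.
have bz : bm (fun u => \sum_p teval (Z p) u ^+ 2 + 4 * teval chi u ^+ 2) by bm_tac.
have bg3 : bm (fun u => gram phi psi u / 3) by apply: bmM => //; exact: bm_cst.
rewrite (eq_mean (cost_correctionE s t)) meanD; last 2 first.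
- by apply: bmM; [exact: bm_cst|exact: bmB].
- exact: bm_teval.
rewrite mean_flux addr0 meanZ; last exact: bmB.
rewrite meanB//; congr (_ * (_ - _)).
under eq_mean do rewrite mulrC.
by rewrite meanZ// mulrC.
Qed.

End Identity.

(** If s / t + t / s <= B, then (s + t)^2 = (s / t + t / s + 2) s t <= (B + 2) s t, so that (s +
    t)^5 / (s t)^2 <= (B + 2)^2 (s + t) tends to 0. *)
Lemma lim_star_bO (Q : R -> R -> R) (K L : R) :
  bO 5 (fun s t (_ : 'rV[R]_n) => Q s t - s ^+ 2 * t ^+ 2 * K) ->
  lim_star (fun s t => 3 / (L * s ^+ 2 * t ^+ 2) * Q s t) (3 * K / L).
Proof.
move=> /bO_boundP[C C0 [d d0 H]] s t s0 t0 sc tc [B stB].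
have sc' : (fun j => s j + t j) @ \oo --> (0 : R) by rewrite -[0]addr0; exact: cvgD.
have B0 : 0 <= B.
  by apply: le_trans (stB _ (ex_intro2 _ _ 0%N I erefl)); rewrite addr_ge0// divr_ge0// ltW.
have key : (fun j => `|3 / L| * C * (B + 2) ^+ 2 * (s j + t j)) @ \oo --> (0 : R).
  by rewrite -(mulr0 (`|3 / L| * C * (B + 2) ^+ 2)); apply: cvgM => //; exact: cvg_cst.
rewrite -[X in _ --> X]add0r.
rewrite (_ : (fun j => _) = fun j => (3 / (L * s j ^+ 2 * t j ^+ 2) * Q (s j) (t j) - 3 * K / L) + 3 * K / L); last first.
  by apply/funext => j; rewrite subrK.
apply: cvgD; last exact: cvg_cst.
apply/cvgr0Pnorm_lt => e e0.
have near0 : \forall j \near \oo, s j + t j < d /\ `|3 / L| * C * (B + 2) ^+ 2 * (s j + t j) < e.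
  have h1 : \forall j \near \oo, `|s j + t j| < d by move/cvgr0Pnorm_lt : sc'; apply.
  have h2 : \forall j \near \oo, `| `|3 / L| * C * (B + 2) ^+ 2 * (s j + t j)| < e by move/cvgr0Pnorm_lt : key; apply.
  near=> j; split.
    by apply: le_lt_trans (ler_norm _) _; near: j.
  by apply: le_lt_trans (ler_norm _) _; near: j.
apply: filterS near0 => j [stj je]; apply: le_lt_trans je.
have sj := s0 j; have tj := t0 j; have st : 0 < s j * t j by rewrite mulr_gt0.
have := H (s j) (t j) 0 sj tj (le_lt_trans _ stj) (le_lt_trans _ stj).
rewrite lerDl lerDr !(ltW sj, ltW tj) => /(_ isT isT) QE.
have ratio : (s j + t j) ^+ 2 <= (B + 2) * (s j * t j).
  have := stB _ (ex_intro2 _ _ j I erefl); rewrite /= => h.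
  have <- : (s j / t j + t j / s j + 2) * (s j * t j) = (s j + t j) ^+ 2.
    by field; rewrite !gt_eqF.
  by rewrite ler_pM2r// lerD2r.
have -> : 3 / (L * s j ^+ 2 * t j ^+ 2) * Q (s j) (t j) - 3 * K / L =
    3 / L * (s j * t j) ^- 2 * (Q (s j) (t j) - s j ^+ 2 * t j ^+ 2 * K).
  rewrite -[L * _ * _]mulrA -exprMn invfM mulrA mulrBr; congr (_ - _).
  by rewrite -[RHS]mulrA [X in _ = _ * X]mulrA mulVf ?mul1r 1?mulrAC// gt_eqF// exprn_gt0.
rewrite 2!normrM -[leLHS]mulrA.
have -> : `|3 / L| * C * (B + 2) ^+ 2 * (s j + t j) = `|3 / L| * (C * (B + 2) ^+ 2 * (s j + t j)).
  by rewrite !mulrA.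
apply: ler_wpM2l => //.
rewrite [`|_ ^- 2|]ger0_norm ?invr_ge0 ?exprn_ge0 ?(ltW st)// [leLHS]mulrC ler_pdivrMr ?exprn_gt0//.
apply: le_trans QE _.
have -> : C * (B + 2) ^+ 2 * (s j + t j) * (s j * t j) ^+ 2 =
  C * (((B + 2) * (s j * t j)) ^+ 2 * (s j + t j)) by ring.
apply: ler_wpM2l => //; rewrite exprSr; apply: ler_wpM2r; first by rewrite addr_ge0// ltW.
rewrite -[4%N]/(2 * 2)%N exprM lerXn2r ?nnegrE ?sqr_ge0//.
by rewrite !mulr_ge0 ?addr_ge0// ltW.
Unshelve. all: by end_near. Qed.

End Averages.

Section Curvature.
Context {R : realType} {n : nat}.
Local Notation M := (torus R n).
Local Notation mu := (torus_volume R n).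
Local Notation tp := (tpoly (R := R) (n := n)).
Variables (phi psi chi : tp) (Z : 'I_n -> tp) (F G : M -> R).
Local Notation D := (tsum (fun p => tD p (Z p))).
Hypotheses (Fphi : lifts F phi) (Gpsi : lifts G psi).

Lemma cost_correction0 s t (u : 'rV[R]_n) :
  cost_correction phi psi [::] (fun=> [::]) s t u = s ^+ 2 * t ^+ 2 * (gram phi psi u / 3).
Proof.
have z (f : 'I_n -> R) : \sum_p f p * teval [::] u = 0.
  by rewrite big1// => p _; rewrite teval_nil mulr0.
have h p : hess_Z phi (fun=> [::]) p u = 0 by exact: z.
have zH (f : 'I_n -> R) : \sum_p f p * hess_Z phi (fun=> [::]) p u = 0.
  by rewrite big1// => p _; rewrite h mulr0.
have zz : \sum_(p < n) teval [::] u ^+ 2 = 0 by rewrite big1// => p _; rewrite teval_nil expr0n.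
by rewrite /cost_correction /gram /= zz !z !zH teval_nil; ring.
Qed.

Let id_shift p : bO 4 (fun s t (u : 'rV[R]_n) => u 0 p - (u 0 p + s * t * teval [::] u)).
Proof.
apply: (@bO_ext _ _ 4 _ (fun s t u => s ^+ 4 * 0)); first by bO_tac.
by move=> s t u _ _; rewrite teval_nil !mulr0 addr0 subrr.
Qed.

Let id_jac : bO 4 (fun s t (u : 'rV[R]_n) => 1 - (1 + s * t * teval [::] u)).
Proof.
apply: (@bO_ext _ _ 4 _ (fun s t u => s ^+ 4 * 0)); first by bO_tac.
by move=> s t u _ _; rewrite teval_nil !mulr0 addr0 subrr.
Qed.

(** The cost I couples the two flows of the same point. It is the case S = id, J = 1 of the general
    expansion, with Z and D empty, where only the Gram determinant survives. *)
Lemma bO_Icost : bO 5 (fun s t (_ : 'rV[R]_n) => Icost mu F G s t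
  - (mean (gap_density phi psi s t) + s ^+ 2 * t ^+ 2 * (mean (gram phi psi) / 3))).
Proof.
have near := eventually0_uniform (bO_small (e := pi) (bO_displacement phi psi id_shift) isT (pi_gt0 R)).
have V : eventually0 (fun s t (_ : 'rV[R]_n) => vol_pres (fun u : 'rV[R]_n => u) (fun=> 1)).
  exists 1 => // *; exact: vol_pres_id.
apply: (bO_eventually_ext (bO_mean_cost phi psi id_shift id_jac V)).
apply: (eventually0_mono near) => s t _ _ _ nr.
have e u : flow_cost phi psi s t u = cone_step_cost phi psi s t u u (Num.sqrt 1).
  have e : enorm (u + disp s phi u - (u + disp t psi u)) = enorm (u + disp t psi u - (u + disp s phi u)).
    by rewrite -enormN opprB.
  rewrite /flow_cost cone_cost_near e; last by apply: le_trans (nr u); exact: ler_norm.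
  by rewrite /cone_step_cost sqrtr1; ring.
have bf : bm (flow_cost phi psi s t).
  rewrite (_ : flow_cost phi psi s t = fun u => cone_step_cost phi psi s t u u (Num.sqrt 1)); last exact/funext.
  by apply: bm_step_cost; [exact: msr_id|exact: bm_cst].
rewrite (IcostE Fphi Gpsi bf) (eq_mean e); congr (_ - _).
have bg : bm (gram phi psi) by rewrite /gram; bm_tac.
rewrite [RHS]meanD; [|exact: bm_gap_density|exact: bm_cost_correction].
congr (_ + _); rewrite (eq_mean (cost_correction0 s t)) mulrA.
under [RHS]eq_mean do rewrite mulrCA -mulrA mulrC mulrA.
rewrite meanZ//; by ring.
Qed.

(* Z + grad chi is half of Hess phi (grad psi) - Hess psi (grad phi), and chi is determined by
   div Z = - 4 chi: this is the first-order optimality condition for the coupling. *)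
Hypothesis DE : forall u, teval D u = - 4 * teval chi u.
Hypothesis ZE : forall p u, teval (Z p) u =
  (\sum_q (teval (tD q (tD p phi)) u * teval (tD q psi) u
          - teval (tD q (tD p psi)) u * teval (tD q phi) u)) / 2 - teval (tD p chi) u.

Local Notation A := (mean (gram phi psi)).
Local Notation B := (mean (fun u => \sum_p teval (Z p) u ^+ 2 + 4 * teval chi u ^+ 2)).

Lemma bO_HK2_expansion : bO 5 (fun s t (_ : 'rV[R]_n) => HK2 mu F G s t
  - (mean (gap_density phi psi s t) + s ^+ 2 * t ^+ 2 * (A / 3 - B))).
Proof.
have HS := bO_shears Z; have HJ := bO_shears_jac Z; have V := shears_vol_pres Z.
have H1 := bO_HK2 HS HJ V DE ZE Fphi Gpsi.
have H2 := bO_mean_cost phi psi HS HJ V.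
apply: (@bO_ext _ _ 5 _ _ (bO_add H1 H2)) => s t u _ _.
rewrite addrA subrK; congr (_ - _).
rewrite meanD; [|exact: bm_gap_density|exact: bm_cost_correction].
congr (_ + _); apply/esym; apply: (mean_cost_correction _ DE ZE) => v; exact: teval_sum.
Qed.

Local Notation L := (Lambda mu F G).

Theorem is_Sec_trig : [/\ is_Sec_up mu F G (- A / L), is_Sec_nabla mu F G (3 * B / L) &
  is_Sec mu F G (- A / L + 3 * B / L)].
Proof.
have HI := bO_Icost; have HH := bO_HK2_expansion.
split.
- rewrite (_ : - A / L = 3 * (- A / 3) / L); last by congr (_ / _); field.
  apply: lim_star_bO.
  apply: (@bO_ext _ _ 5 _ _ (bO_opp HI)) => s t u _ _.
  by rewrite (H1_gap2E s t Fphi Gpsi); move: (Icost _ _ _ _ _) (mean (gap_density _ _ _ _)) A => *; field.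
- apply: lim_star_bO.
  apply: (@bO_ext _ _ 5 _ _ (bO_add HI (bO_opp HH))) => s t u _ _.
  by move: (Icost _ _ _ _ _) (HK2 _ _ _ _ _) (mean (gap_density _ _ _ _)) A B => *; field.
- rewrite (_ : - A / L + 3 * B / L = 3 * (B - A / 3) / L); last by rewrite -mulrDl; congr (_ / _); field.
  apply: lim_star_bO.
  apply: (@bO_ext _ _ 5 _ _ (bO_opp HH)) => s t u _ _.
  by rewrite (H1_gap2E s t Fphi Gpsi); move: (HK2 _ _ _ _ _) (mean (gap_density _ _ _ _)) A B => *; field.
Qed.

End Curvature.

(** * The Fourier basis *)

Section SignSums.
Context {R : realType} {n : nat}.
Local Notation signs := {ffun 'I_n -> bool}.
Implicit Types (sigma tau : signs) (p q : 'I_n).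

Lemma sum_involutive (I : finType) (nu : I -> I) (T : I -> R) : involutive nu ->
  \sum_i T (nu i) = \sum_i T i.
Proof. by move=> nuK; rewrite [RHS](reindex_inj (inv_inj nuK)). Qed.

(** The terms need to agree only after averaging over the involution, which is how the product
    formulas for cosines are used below. *)
Lemma sum_symmetrize (I : finType) (nu : I -> I) (T U : I -> R) : involutive nu ->
  (forall i, T i + T (nu i) = U i + U (nu i)) -> \sum_i T i = \sum_i U i.
Proof.
move=> nuK TU.
have H (V : I -> R) : \sum_i V i = (\sum_i (V i + V (nu i))) / 2.
  by rewrite big_split/= (sum_involutive V nuK); field.
by rewrite H (eq_bigr _ (fun i _ => TU i)) -H.
Qed.

Definition sg sigma p : R := (-1) ^+ sigma p.
Definition flip_at p sigma : signs := [ffun q => (q == p) (+) sigma q].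
Definition sign_opp sigma : signs := [ffun q => ~~ sigma q].
Definition sign_mul tau sigma : signs := [ffun q => tau q (+) sigma q].

Lemma flip_atK p : involutive (flip_at p).
Proof. by move=> s; apply/ffunP => q; rewrite !ffunE addbA addbb. Qed.

Lemma sign_oppK : involutive sign_opp.
Proof. by move=> s; apply/ffunP => q; rewrite !ffunE negbK. Qed.

Lemma sign_mulK tau : involutive (sign_mul tau).
Proof. by move=> s; apply/ffunP => q; rewrite !ffunE addbA addbb. Qed.

Lemma sg_flip_at p sigma q : sg (flip_at p sigma) q = if q == p then - sg sigma q else sg sigma q.
Proof. by rewrite /sg ffunE; case: (q == p); case: (sigma q); rewrite /= ?expr1 ?expr0 ?opprK. Qed.

Lemma sg_opp sigma q : sg (sign_opp sigma) q = - sg sigma q.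
Proof. by rewrite /sg ffunE; case: (sigma q); rewrite /= ?expr1 ?expr0 ?opprK. Qed.

Lemma sg_mul tau sigma q : sg (sign_mul tau sigma) q = sg tau q * sg sigma q.
Proof. by rewrite /sg ffunE -signr_addb. Qed.

Lemma sg_sqr sigma q : sg sigma q ^+ 2 = 1.
Proof. by rewrite sqrr_sign. Qed.

(** Averaging over the sign at p turns cos (b + a) into cos b cos a, because cos (b + a) + cos (b -
    a) = 2 cos b cos a; the induction does this for one coordinate at a time. *)
Lemma sum_cos_signs (alpha : 'I_n -> R) (beta : R) (r : seq 'I_n) : uniq r ->
  \sum_sigma cos (beta + \sum_(p <- r) sg sigma p * alpha p) =
  2 ^+ n * cos beta * \prod_(p <- r) cos (alpha p).
Proof.
elim: r => [_|p r IH /= /andP[pr ur]].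
  rewrite big_nil mulr1; under eq_bigr do rewrite big_nil addr0.
  by rewrite sumr_const card_ffun card_bool card_ord -[LHS]mulr_natl natrX.
rewrite big_cons mulrCA -IH// mulr_sumr.
apply: (sum_symmetrize (@flip_atK p)) => sigma.
have E : \sum_(q <- r) sg (flip_at p sigma) q * alpha q = \sum_(q <- r) sg sigma q * alpha q.
  apply: eq_big_seq => q qr; rewrite sg_flip_at; case: eqVneq => // qp.
  by rewrite qp (negbTE pr) in qr.
rewrite !big_cons E sg_flip_at eqxx; set X := \sum_(q <- r) _.
rewrite (_ : beta + (sg sigma p * alpha p + X) = (beta + X) + sg sigma p * alpha p); last by ring.
rewrite (_ : beta + (- sg sigma p * alpha p + X) = (beta + X) - sg sigma p * alpha p); last by ring.
rewrite cosB cosD (_ : cos (sg sigma p * alpha p) = cos (alpha p)); first by ring.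
by rewrite /sg; case: (sigma p); rewrite ?expr0 ?mul1r// expr1 mulN1r cosN.
Qed.

Lemma sum_sg_sg p q : p != q -> \sum_sigma sg sigma p * sg sigma q = 0.
Proof.
move=> pq; rewrite (@sum_symmetrize _ (flip_at p) _ (fun=> 0) (@flip_atK p)) ?big1// => sigma.
by rewrite !sg_flip_at eqxx eq_sym (negbTE pq); ring.
Qed.

End SignSums.

(** * The basis functions as trigonometric polynomials *)

Section FourierPoly.
Context {R : realType} {n : nat}.
Local Notation signs := {ffun 'I_n -> bool}.
Local Notation tp := (tpoly (R := R) (n := n)).
Implicit Types (k : 'rV[int]_n) (sigma : signs) (p q : 'I_n).

Lemma sign_flipE sigma k p : (sign_flip sigma k 0 p)%:~R = sg sigma p * (k 0 p)%:~R :> R.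
Proof. by rewrite mxE rmorphM/= rmorph_sign. Qed.

Definition phase1 (j : int) : R := if 0 < j then 0 else - (pi / 2).

Lemma fourier1E (j : int) (y : R) : j != 0 ->
  fourier1 j y = Num.sqrt 2 * cos (j%:~R * y + phase1 j).
Proof.
move=> j0; rewrite /fourier1 /phase1; case: ltrP => [_|]; first by rewrite addr0.
rewrite le_eqVlt (negbTE j0)/= => ->; congr (_ * _).
by rewrite -cosN opprD opprK cosDpihalf sinN opprK.
Qed.

Definition phase k sigma : R := \sum_p sg sigma p * phase1 (k 0 p).
(** The n factors sqrt 2 of the basis function, divided by the number 2^n of sign patterns over
    which the product of cosines is an average. *)
Definition coef : R := Num.sqrt 2 ^+ n / 2 ^+ n.

Definition fourier_poly k : tp :=
  [seq (coef, sign_flip sigma k, phase k sigma) | sigma : signs <- index_enum signs].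

Definition angle k sigma u : R := zdot (sign_flip sigma k) u + phase k sigma.

Lemma angleE k sigma u : angle k sigma u = \sum_p sg sigma p * ((k 0 p)%:~R * u 0 p + phase1 (k 0 p)).
Proof.
by rewrite /angle /zdot /phase -big_split/=; apply: eq_bigr => p _; rewrite sign_flipE; ring.
Qed.

Lemma angle_opp k sigma u : angle k (sign_opp sigma) u = - angle k sigma u.
Proof. by rewrite !angleE -sumrN; apply: eq_bigr => p _; rewrite sg_opp mulNr. Qed.

Lemma teval_fourier k u : teval (fourier_poly k) u = coef * \sum_sigma cos (angle k sigma u).
Proof. by rewrite /teval big_map mulr_sumr. Qed.

Lemma teval_D_fourier p k u : teval (tD p (fourier_poly k)) u =
  - (coef * \sum_sigma sg sigma p * (k 0 p)%:~R * sin (angle k sigma u)).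
Proof.
rewrite teval_D big_map mulr_sumr -sumrN; apply: eq_bigr => sigma _ /=.
by rewrite sign_flipE !mulrA.
Qed.

Lemma teval_DD_fourier p q k u : teval (tD q (tD p (fourier_poly k))) u =
  - (coef * \sum_sigma sg sigma p * (k 0 p)%:~R * (sg sigma q * (k 0 q)%:~R) * cos (angle k sigma u)).
Proof.
rewrite teval_D !big_map mulr_sumr -sumrN; apply: eq_bigr => sigma _ /=.
by rewrite !sign_flipE addrA sinDpihalf !mulrA.
Qed.

Lemma lifts_fourier k : (forall p, k 0 p != 0) -> lifts (fourier k) (fourier_poly k).
Proof.
move=> k0 u; have [z zE] := torus_repr_pi u.
rewrite /fourier -(teval_period (fourier_poly k) u z) -zE; move: (torus_repr _) => v.
rewrite teval_fourier.
under eq_bigr do rewrite fourier1E//.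
rewrite big_split/= prodr_const card_ord.
have := sum_cos_signs (fun p => (k 0 p)%:~R * v 0 p + phase1 (k 0 p)) 0 (index_enum_uniq 'I_n).
rewrite cos0 mulr1 => E.
under [in RHS]eq_bigr do rewrite angleE -[X in cos X]add0r.
by rewrite E /coef mulrA divfK// expf_neq0.
Qed.

Lemma coef_sqr : coef ^+ 2 = (2 ^+ n)^-1.
Proof.
rewrite /coef expr_div_n -exprM mulnC exprM sqr_sqrtr//.
have : (2 : R) ^+ n != 0 by rewrite expf_neq0.
by move: (2 ^+ n) => y y0; field.
Qed.

Lemma sum_signs1 : \sum_(sigma : signs) (1 : R) = 2 ^+ n.
Proof. by rewrite sumr_const card_ffun card_bool card_ord natrX. Qed.

End FourierPoly.

(** * The frequencies of a generic pair *)

Section PairModes.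
Context {R : realType} {n : nat}.
Local Notation signs := {ffun 'I_n -> bool}.
Local Notation tp := (tpoly (R := R) (n := n)).
Local Notation modes := (signs * signs)%type.
Local Notation mu := (torus_volume R n).
Implicit Types (sigma tau : signs) (p q : 'I_n) (i : modes) (u : 'rV[R]_n).

Lemma sum_mul_pair (a b : signs -> R) :
  (\sum_sigma a sigma) * (\sum_tau b tau) = \sum_(i : modes) a i.1 * b i.2.
Proof. by rewrite big_distrlr/= pair_big. Qed.

Lemma lagrange_identity (a b : 'I_n -> R) :
  (\sum_p a p ^+ 2) * (\sum_p b p ^+ 2) - (\sum_p a p * b p) ^+ 2 =
  (\sum_p \sum_q (a p * b q - a q * b p) ^+ 2) / 2.
Proof.
have -> : \sum_p \sum_q (a p * b q - a q * b p) ^+ 2 =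
    \sum_p \sum_q a p ^+ 2 * b q ^+ 2 + \sum_p \sum_q a q ^+ 2 * b p ^+ 2
    - 2 * \sum_p \sum_q (a p * b p) * (a q * b q).
  rewrite mulr_sumr -sumrN -!big_split/=; apply: eq_bigr => p _.
  by rewrite mulr_sumr -sumrN -!big_split/=; apply: eq_bigr => q _; ring.
rewrite [X in _ + X - _]exchange_big/= expr2 !big_distrlr/=; by field.
Qed.

Variables k l : 'rV[int]_n.
Hypotheses (hn : (0 < n)%N) (gen : generic k l).

Lemma generic_neq0l p : k 0 p != 0.
Proof. by have [_ _ /eqP] := gen p; rewrite mulf_eq0 negb_or => /andP[]. Qed.

Lemma generic_neq0r p : l 0 p != 0.
Proof. by have [_ _ /eqP] := gen p; rewrite mulf_eq0 negb_or => /andP[]. Qed.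

Lemma sign_flip_inj (m : 'rV[int]_n) : (forall p, m 0 p != 0) ->
  injective (fun sigma => sign_flip sigma m).
Proof.
move=> m0 s s' /rowP E; apply/ffunP => p; have := E p; have := m0 p; rewrite !mxE.
by case: (s p); case: (s' p); rewrite ?expr1 ?expr0 ?mul1r ?mulN1r//; lia.
Qed.

Lemma sign_flip_opp (m : 'rV[int]_n) sigma : sign_flip (sign_opp sigma) m = - sign_flip sigma m.
Proof.
apply/rowP => p; rewrite !mxE ffunE.
by case: (sigma p); rewrite /= ?expr1 ?expr0 ?mul1r ?mulN1r ?opprK.
Qed.

Lemma phase_opp (m : 'rV[int]_n) sigma : phase m (sign_opp sigma) = - phase m sigma :> R.
Proof. by rewrite /phase -sumrN; apply: eq_bigr => p _; rewrite sg_opp mulNr. Qed.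

Definition mode i : 'rV[int]_n := sign_flip i.1 k + sign_flip i.2 l.
Definition mode_phase i : R := phase k i.1 + phase l i.2.
Definition mode_opp i : modes := (sign_opp i.1, sign_opp i.2).
Definition half_opp i : modes := (i.1, sign_opp i.2).
Local Notation Phi i u := (zdot (mode i) u + mode_phase i).

Lemma half_oppK : involutive half_opp.
Proof. by case=> s t; rewrite /half_opp/= sign_oppK. Qed.

Lemma mode_angleE i u : Phi i u = angle k i.1 u + angle l i.2 u.
Proof. by rewrite /mode zdotDl /mode_phase /angle; ring. Qed.

(** Coordinate by coordinate, the four numbers +-k_p +- l_p are distinct exactly because k_p and l_p
    are nonzero and k_p is neither l_p nor - l_p, so that each coordinate of the frequency
    determines both of its signs. *)
Lemma mode_inj : injective mode.
Proof.
move=> [s t] [s' t'] /rowP E; congr pair; apply/ffunP => p; have := E p; rewrite !mxE /=;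
  have := gen p; have := generic_neq0l p; have := generic_neq0r p;
  by case: (s p); case: (s' p); case: (t p); case: (t' p);
    rewrite ?expr1 ?expr0 ?mul1r ?mulN1r// => ? ? [? ? _]; lia.
Qed.

Lemma mode_neq0 i : mode i != 0.
Proof.
apply/eqP => /rowP/(_ (Ordinal hn)); have := gen (Ordinal hn); rewrite !mxE.
by case: (i.1 _); case: (i.2 _); rewrite ?expr1 ?expr0 ?mul1r ?mulN1r => -[? ? _]; lia.
Qed.

Lemma mode_oppE i : mode (mode_opp i) = - mode i.
Proof. by rewrite /mode /= !sign_flip_opp opprD. Qed.

Lemma mode_phase_opp i : mode_phase (mode_opp i) = - mode_phase i.
Proof. by rewrite /mode_phase /= !phase_opp opprD. Qed.

Section HalfOpp.
Variables (W : modes -> R) (u : 'rV[R]_n).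
Local Notation P i := (angle k i.1 u).
Local Notation Q i := (angle l i.2 u).

(** A product of two functions is half the sum of one of the angle P + Q and one of P - Q, and
    [half_opp], which replaces Q by - Q, exchanges them. A weight of the matching parity lets the
    sum be written with P + Q alone, which is the phase of the mode; the three lemmas that follow
    work in the same way. *)
Lemma sum_cos_cos : (forall i, W (half_opp i) = W i) ->
  \sum_i W i * (cos (P i) * cos (Q i)) = \sum_i W i * cos (Phi i u).
Proof.
move=> WE; apply: (sum_symmetrize half_oppK) => i.
rewrite !mode_angleE WE /= angle_opp; move: (angle k i.1 u) (angle l i.2 u) => a b.
by rewrite !cosD cosN sinN; ring.
Qed.

Lemma sum_sin_sin : (forall i, W (half_opp i) = - W i) ->
  \sum_i W i * (sin (P i) * sin (Q i)) = \sum_i - W i * cos (Phi i u).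
Proof.
move=> WE; apply: (sum_symmetrize half_oppK) => i.
rewrite !mode_angleE WE /= angle_opp; move: (angle k i.1 u) (angle l i.2 u) => a b.
by rewrite !cosD cosN sinN; ring.
Qed.

Lemma sum_cos_sin : (forall i, W (half_opp i) = - W i) ->
  \sum_i W i * (cos (P i) * sin (Q i)) = \sum_i W i * sin (Phi i u).
Proof.
move=> WE; apply: (sum_symmetrize half_oppK) => i.
rewrite !mode_angleE WE /= angle_opp; move: (angle k i.1 u) (angle l i.2 u) => a b.
by rewrite !sinD cosN sinN; ring.
Qed.

Lemma sum_sin_cos : (forall i, W (half_opp i) = W i) ->
  \sum_i W i * (sin (P i) * cos (Q i)) = \sum_i W i * sin (Phi i u).
Proof.
move=> WE; apply: (sum_symmetrize half_oppK) => i.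
rewrite !mode_angleE WE /= angle_opp; move: (angle k i.1 u) (angle l i.2 u) => a b.
by rewrite !sinD cosN sinN; ring.
Qed.

End HalfOpp.

Local Notation c := (@coef R n).
Local Notation kk := (fun sigma p => sg sigma p * (k 0 p)%:~R : R).
Local Notation ll := (fun sigma p => sg sigma p * (l 0 p)%:~R : R).
Local Notation phi := (fourier_poly (R := R) k).
Local Notation psi := (fourier_poly (R := R) l).

Definition sqnorm (m : 'rV[int]_n) : R := \sum_p (m 0 p)%:~R ^+ 2.

Lemma sum_sg_sqr (m : 'rV[int]_n) sigma : \sum_p (sg sigma p * (m 0 p)%:~R) ^+ 2 = sqnorm m.
Proof. by apply: eq_bigr => p _; rewrite exprMn sg_sqr mul1r. Qed.

Definition mode_dot i : R := \sum_p kk i.1 p * ll i.2 p.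
Definition mode_sum_sqr i : R := \sum_p (kk i.1 p + ll i.2 p) ^+ 2.
Definition mode_diff_sqr i : R := \sum_p (kk i.1 p - ll i.2 p) ^+ 2.

Lemma mode_dot_half i : mode_dot (half_opp i) = - mode_dot i.
Proof. by rewrite /mode_dot -sumrN; apply: eq_bigr => p _; rewrite /= sg_opp; ring. Qed.

Lemma mode_dot_opp i : mode_dot (mode_opp i) = mode_dot i.
Proof. by apply: eq_bigr => p _; rewrite /= !sg_opp; ring. Qed.

Lemma mode_sum_sqr_opp i : mode_sum_sqr (mode_opp i) = mode_sum_sqr i.
Proof. by apply: eq_bigr => p _; rewrite /= !sg_opp; ring. Qed.

Lemma H1_norm2_fourier (m : 'rV[int]_n) : (forall p, m 0 p != 0) ->
  H1_norm2 mu (fourier m) = 4 + sqnorm m.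
Proof.
move=> m0; rewrite (H1_norm2E (lifts_fourier m0)).
have bs p : bm (fun u => (\sum_sigma c * (sg sigma p * (m 0 p)%:~R) * sin (angle m sigma u)) ^+ 2).
  have := bmX 2 (bm_teval (tD p (fourier_poly (R := R) m))).
  rewrite (_ : (fun u => teval _ u ^+ 2) = fun u => (\sum_sigma c * (sg sigma p * (m 0 p)%:~R) * sin (angle m sigma u)) ^+ 2)//.
  by apply/funext => u; rewrite teval_D_fourier sqrrN mulr_sumr; congr (_ ^+ 2); apply: eq_bigr => s _; ring.
have bc : bm (fun u => (\sum_sigma c * cos (angle m sigma u)) ^+ 2).
  have := bmX 2 (bm_teval (fourier_poly (R := R) m)).
  by under eq_fun do rewrite teval_fourier mulr_sumr.
rewrite (@eq_mean _ _ _ (fun u => \sum_p (\sum_sigma c * (sg sigma p * (m 0 p)%:~R) * sin (angle m sigma u)) ^+ 2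
   + 4 * (\sum_sigma c * cos (angle m sigma u)) ^+ 2)); last first.
  move=> u; rewrite teval_fourier mulr_sumr; congr (_ + _); apply: eq_bigr => p _.
  by rewrite teval_D_fourier sqrrN mulr_sumr; congr (_ ^+ 2); apply: eq_bigr => s _; ring.
have mi := sign_flip_inj m0.
have mo s : sign_flip (sign_opp s) m = - sign_flip s m by exact: sign_flip_opp.
have po s : phase m (sign_opp s) = - phase m s :> R by exact: phase_opp.
rewrite meanD; [|exact: bm_sum|by apply: bmM => //; exact: bm_cst].
rewrite mean_sum// meanZ//.
rewrite (parseval_cos (nu := sign_opp) mi mo po (A := fun=> c))//.
have -> : \sum_p mean (fun u => (\sum_sigma c * (sg sigma p * (m 0 p)%:~R) * sin (angle m sigma u)) ^+ 2) =
    \sum_p \sum_sigma (c * (sg sigma p * (m 0 p)%:~R)) ^+ 2.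
  apply: eq_bigr => p _.
  rewrite (parseval_sin (nu := sign_opp) mi mo po (A := fun s => c * (sg s p * (m 0 p)%:~R)))// => s.
  by rewrite sg_opp; ring.
rewrite exchange_big/= addrC -[sqnorm m]mul1r -[X in X + _ = _]mulr1.
have -> : \sum_sigma \sum_p (c * (sg sigma p * (m 0 p)%:~R)) ^+ 2 = (\sum_(sigma : signs) c ^+ 2) * sqnorm m.
  rewrite mulr_suml; apply: eq_bigr => s _; rewrite -(sum_sg_sqr m s) mulr_sumr.
  by apply: eq_bigr => p _; rewrite exprMn.
have -> : \sum_(sigma : signs) c ^+ 2 = 1.
  rewrite -[RHS](mulVf (x := 2 ^+ n)) ?expf_neq0// -coef_sqr -(@sum_signs1 R) mulr_sumr.
  by apply: eq_bigr => s _; rewrite mulr1.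
by rewrite !mulr1.
Qed.

Lemma mul_D_fourier p q u : teval (tD p phi) u * teval (tD q psi) u =
  \sum_i c ^+ 2 * (kk i.1 p * ll i.2 q) * (sin (angle k i.1 u) * sin (angle l i.2 u)).
Proof.
rewrite !teval_D_fourier mulrNN mulrACA sum_mul_pair mulr_sumr.
by apply: eq_bigr => i _; ring.
Qed.

(** The integrand is a combination of cosines of the modes, none of which has frequency zero. *)
Lemma H1_dot_fourier : H1_dot mu (fourier k) (fourier l) = 0.
Proof.
rewrite (H1_dotE (lifts_fourier generic_neq0l) (lifts_fourier generic_neq0r)).
rewrite -[RHS](mean_cos_sum mode_phase mode_neq0 (fun i => c ^+ 2 * (4 - mode_dot i))).
apply: eq_mean => u.
have -> : \sum_p teval (tD p phi) u * teval (tD p psi) u =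
    \sum_i (c ^+ 2 * mode_dot i) * (sin (angle k i.1 u) * sin (angle l i.2 u)).
  under eq_bigr do rewrite mul_D_fourier.
  rewrite exchange_big/=; apply: eq_bigr => i _.
  by rewrite /mode_dot mulr_sumr mulr_suml.
rewrite sum_sin_sin; last by move=> i; rewrite mode_dot_half mulrN.
rewrite !teval_fourier mulrACA sum_mul_pair mulr_sumr.
rewrite -expr2 (sum_cos_cos _ (W := fun=> c ^+ 2))// mulr_sumr -big_split/=.
by apply: eq_bigr => i _; ring.
Qed.

(** Lagrange's identity writes the Gram determinant as a sum of squares of functions that are linear
    combinations of the modes, to which Parseval applies; the same identity, read backwards on the
    frequencies of each mode, resums the result. *)
Lemma mean_gram_fourier : mean (gram phi psi) = c ^+ 4 * \sum_i (sqnorm k * sqnorm l - mode_dot i ^+ 2).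
Proof.
pose w p q i := kk i.1 p * ll i.2 q - kk i.1 q * ll i.2 p.
have gE u : gram phi psi u =
    2^-1 * \sum_p \sum_q (\sum_i (- (c ^+ 2 * w p q i)) * cos (Phi i u)) ^+ 2.
  rewrite /gram lagrange_identity mulrC; congr (_ * _); apply: eq_bigr => p _; apply: eq_bigr => q _.
  congr (_ ^+ 2); rewrite -sum_sin_sin; last first.
    by move=> i; rewrite /w /= !sg_opp; ring.
  by rewrite !mul_D_fourier -sumrB; apply: eq_bigr => i _; rewrite /w; ring.
have bs p q : bm (fun u => (\sum_i (- (c ^+ 2 * w p q i)) * cos (Phi i u)) ^+ 2).
  by apply: bmX; apply: bm_sum => i; apply: bmM; [exact: bm_cst|exact: bm_cos].
have wE p q : mean (fun u => (\sum_i (- (c ^+ 2 * w p q i)) * cos (Phi i u)) ^+ 2) =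
    \sum_i (- (c ^+ 2 * w p q i)) ^+ 2.
  apply: (parseval_cos mode_inj mode_oppE mode_phase_opp) => i.
  by rewrite /w /= !sg_opp; ring.
rewrite (eq_mean gE) meanZ; last by apply: bm_sum => p; exact: bm_sum.
rewrite mean_sum; last by move=> p; exact: bm_sum.
have -> : \sum_p mean (fun u => \sum_q (\sum_i (- (c ^+ 2 * w p q i)) * cos (Phi i u)) ^+ 2) =
   \sum_p \sum_q \sum_i c ^+ 4 * w p q i ^+ 2.
  apply: eq_bigr => p _; rewrite mean_sum//; apply: eq_bigr => q _; rewrite wE.
  by apply: eq_bigr => i _; ring.
under eq_bigr do rewrite exchange_big/=.
rewrite exchange_big/= [LHS]mulr_sumr [RHS]mulr_sumr; apply: eq_bigr => i _.
rewrite -(sum_sg_sqr k i.1) -(sum_sg_sqr l i.2) /mode_dot lagrange_identity.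
rewrite (_ : \sum_p \sum_q c ^+ 4 * w p q i ^+ 2 = c ^+ 4 * \sum_p \sum_q w p q i ^+ 2); first by rewrite /w; field.
by rewrite mulr_sumr; apply: eq_bigr => p _; rewrite mulr_sumr.
Qed.

(** Solution of the system for Z and chi in one mode, with m = k^sigma + l^tau and d = <k^sigma,
    l^tau>. The prescribed field has coefficient c^2 d (k^sigma - l^tau) / 2 on sin, and - grad chi
    adds m times the coefficient of chi. Since (k^sigma - l^tau) . m = |k|^2 - |l|^2, the condition
    div Z = - 4 chi says that (4 + |m|^2) times the coefficient of chi is - c^2 d (|k|^2 - |l|^2) /
    2. *)
Definition mode_ratio i : R := (sqnorm k - sqnorm l) / (4 + mode_sum_sqr i).
Definition chi_coef i : R := - (c ^+ 2 * mode_dot i * mode_ratio i / 2).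
Definition Z_coef p i : R := c ^+ 2 * mode_dot i * (kk i.1 p - ll i.2 p - mode_ratio i * (kk i.1 p + ll i.2 p)) / 2.

Definition chi_poly : tp := [seq (chi_coef i, mode i, mode_phase i) | i : modes <- index_enum modes].
Definition Z_poly p : tp := [seq (Z_coef p i, mode i, mode_phase i - pi / 2) | i : modes <- index_enum modes].

Lemma mode_sum_sqr4_gt0 i : 0 < 4 + mode_sum_sqr i.
Proof. by rewrite ltr_pwDl// sumr_ge0// => p _; exact: sqr_ge0. Qed.

Lemma modeE i p : (mode i 0 p)%:~R = kk i.1 p + ll i.2 p.
Proof. by rewrite /mode mxE rmorphD/= !sign_flipE. Qed.

Lemma mode_ratio_opp i : mode_ratio (mode_opp i) = mode_ratio i.
Proof. by rewrite /mode_ratio mode_sum_sqr_opp. Qed.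

Lemma teval_chi u : teval chi_poly u = \sum_i chi_coef i * cos (Phi i u).
Proof. by rewrite /teval big_map. Qed.

Lemma cosBpihalf (a : R) : cos (a - pi / 2) = sin a.
Proof. by rewrite -[in RHS](subrK (pi / 2) a) sinDpihalf. Qed.

Lemma teval_Z p u : teval (Z_poly p) u = \sum_i Z_coef p i * sin (Phi i u).
Proof. by rewrite /teval big_map; apply: eq_bigr => i _ /=; rewrite addrA cosBpihalf. Qed.

Lemma teval_D_chi p u : teval (tD p chi_poly) u =
  \sum_i - (chi_coef i * (kk i.1 p + ll i.2 p)) * sin (Phi i u).
Proof. by rewrite teval_D big_map; apply: eq_bigr => i _ /=; rewrite modeE; ring. Qed.

Lemma teval_D_Z p q u : teval (tD q (Z_poly p)) u =
  \sum_i Z_coef p i * (kk i.1 q + ll i.2 q) * cos (Phi i u).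
Proof.
rewrite teval_D big_map; apply: eq_bigr => i _ /=; rewrite modeE addrA.
by rewrite -[X in cos X](subrK (pi / 2)) cosDpihalf mulrN.
Qed.

Lemma chi_div u : teval (tsum (fun p => tD p (Z_poly p))) u = - 4 * teval chi_poly u.
Proof.
rewrite teval_sum teval_chi mulr_sumr; under eq_bigr do rewrite teval_D_Z.
rewrite exchange_big/=; apply: eq_bigr => i _.
rewrite -mulr_suml mulrA; congr (_ * _).
have -> : \sum_p Z_coef p i * (kk i.1 p + ll i.2 p) =
   c ^+ 2 * mode_dot i / 2 * (\sum_p (kk i.1 p) ^+ 2 - \sum_p (ll i.2 p) ^+ 2 - mode_ratio i * mode_sum_sqr i).
  rewrite /Z_coef /mode_sum_sqr; move: (mode_dot i) (mode_ratio i) => d r.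
  by rewrite -sumrB !mulr_sumr -sumrB mulr_sumr; apply: eq_bigr => p _; field.
rewrite !sum_sg_sqr /chi_coef.
have e : sqnorm k - sqnorm l = mode_ratio i * (4 + mode_sum_sqr i) by rewrite /mode_ratio divfK// gt_eqF// mode_sum_sqr4_gt0.
by rewrite e; field.
Qed.

Lemma Z_helmholtz p u : teval (Z_poly p) u =
  (\sum_q (teval (tD q (tD p phi)) u * teval (tD q psi) u
          - teval (tD q (tD p psi)) u * teval (tD q phi) u)) / 2 - teval (tD p chi_poly) u.
Proof.
rewrite teval_Z teval_D_chi.
have -> : \sum_q (teval (tD q (tD p phi)) u * teval (tD q psi) u
    - teval (tD q (tD p psi)) u * teval (tD q phi) u) =
  \sum_i c ^+ 2 * mode_dot i * kk i.1 p * (cos (angle k i.1 u) * sin (angle l i.2 u))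
  - \sum_i c ^+ 2 * mode_dot i * ll i.2 p * (sin (angle k i.1 u) * cos (angle l i.2 u)).
  rewrite sumrB; congr (_ - _).
    under eq_bigr do rewrite teval_DD_fourier teval_D_fourier mulrNN mulrACA sum_mul_pair mulr_sumr.
    rewrite exchange_big/=; apply: eq_bigr => i _.
    rewrite /mode_dot mulr_sumr !mulr_suml; apply: eq_bigr => q _; ring.
  under eq_bigr do rewrite mulrC teval_DD_fourier teval_D_fourier mulrNN mulrACA sum_mul_pair mulr_sumr.
  rewrite exchange_big/=; apply: eq_bigr => i _.
  rewrite /mode_dot mulr_sumr !mulr_suml; apply: eq_bigr => q _; ring.
rewrite sum_cos_sin; last by move=> i; rewrite mode_dot_half /=; ring.
rewrite sum_sin_cos; last by move=> i; rewrite mode_dot_half /= sg_opp; ring.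
rewrite -sumrB mulr_suml -sumrB; apply: eq_bigr => i _.
by rewrite /Z_coef /chi_coef; field.
Qed.

(** After Parseval, with rho for [mode_ratio], m as above and b = k^sigma - l^tau, each mode
    contributes |b - rho m|^2 + 4 rho^2 = |b|^2 - 2 rho (|k|^2 - |l|^2) + rho^2 (4 + |m|^2), up to
    its weight. As rho (4 + |m|^2) = |k|^2 - |l|^2, the last two terms combine into - (|k|^2 -
    |l|^2)^2 / (4 + |m|^2). *)
Lemma mean_Z_fourier : mean (fun u => \sum_p teval (Z_poly p) u ^+ 2 + 4 * teval chi_poly u ^+ 2) =
  c ^+ 4 * \sum_i mode_dot i ^+ 2 * (mode_diff_sqr i - (sqnorm k - sqnorm l) ^+ 2 / (4 + mode_sum_sqr i)) / 4.
Proof.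
rewrite meanD; last 2 first.
- by apply: bm_sum => p; apply: bmX; exact: bm_teval.
- by apply: bmM; [exact: bm_cst|apply: bmX; exact: bm_teval].
rewrite mean_sum; last by move=> p; apply: bmX; exact: bm_teval.
rewrite meanZ; last by apply: bmX; exact: bm_teval.
have -> : mean (fun u => teval chi_poly u ^+ 2) = \sum_i chi_coef i ^+ 2.
  rewrite -(parseval_cos mode_inj mode_oppE mode_phase_opp).
    by apply: eq_mean => u; rewrite teval_chi.
  by move=> i; rewrite /chi_coef mode_dot_opp mode_ratio_opp.
have -> : \sum_p mean (fun u => teval (Z_poly p) u ^+ 2) = \sum_p \sum_i Z_coef p i ^+ 2.
  apply: eq_bigr => p _; rewrite -(parseval_sin mode_inj mode_oppE mode_phase_opp).
    by apply: eq_mean => u; rewrite teval_Z.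
  by move=> i; rewrite /Z_coef mode_dot_opp mode_ratio_opp /= !sg_opp; field.
rewrite exchange_big/= !mulr_sumr -big_split/=; apply: eq_bigr => i _.
have -> : \sum_p Z_coef p i ^+ 2 = c ^+ 4 * mode_dot i ^+ 2 / 4 *
   (mode_diff_sqr i - 2 * mode_ratio i * (\sum_p (kk i.1 p) ^+ 2 - \sum_p (ll i.2 p) ^+ 2) + mode_ratio i ^+ 2 * mode_sum_sqr i).
  rewrite /Z_coef /mode_diff_sqr /mode_sum_sqr; move: (mode_dot i) (mode_ratio i) => d r.
  rewrite -sumrB [2 * r * _]mulr_sumr [r ^+ 2 * _]mulr_sumr -sumrN -!big_split/= mulr_sumr.
  by apply: eq_bigr => p _; field.
rewrite !sum_sg_sqr.
have e : sqnorm k - sqnorm l = mode_ratio i * (4 + mode_sum_sqr i) by rewrite /mode_ratio divfK// gt_eqF// mode_sum_sqr4_gt0.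
have -> : (sqnorm k - sqnorm l) ^+ 2 / (4 + mode_sum_sqr i) = mode_ratio i * (sqnorm k - sqnorm l) by rewrite /mode_ratio; field; rewrite gt_eqF// mode_sum_sqr4_gt0.
by rewrite e /chi_coef; field.
Qed.

End PairModes.

(** * From pairs of sign patterns to a single one *)

Section SignAverage.
Context {R : realType} {n : nat}.
Local Notation signs := {ffun 'I_n -> bool}.
Local Notation modes := (signs * signs)%type.
Variables k l : 'rV[int]_n.
Implicit Types (sigma tau : signs) (i : modes).
Local Notation K p := ((k 0 p)%:~R : R).
Local Notation L p := ((l 0 p)%:~R : R).
Local Notation c := (@coef R n).

Let d sigma : R := \sum_p sg sigma p * K p * L p.
Let Np sigma : R := \sum_p (sg sigma p * K p + L p) ^+ 2.
Let Nm sigma : R := \sum_p (sg sigma p * K p - L p) ^+ 2.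

Let mode_dot_mul i : mode_dot k l i = d (sign_mul i.2 i.1).
Proof. by apply: eq_bigr => p _; rewrite sg_mul; ring. Qed.

Let mode_sum_sqr_mul i : mode_sum_sqr k l i = Np (sign_mul i.2 i.1).
Proof.
apply: eq_bigr => p _; rewrite sg_mul /sg.
by case: (i.2 p); rewrite ?expr1 ?expr0; ring.
Qed.

Let mode_diff_sqr_mul i : mode_diff_sqr k l i = Nm (sign_mul i.2 i.1).
Proof.
apply: eq_bigr => p _; rewrite sg_mul /sg.
by case: (i.2 p); rewrite ?expr1 ?expr0; ring.
Qed.

(** The quantities attached to a mode are unchanged when both sign patterns are multiplied by a
    common one, so that they depend only on the product tau sigma, which takes each value 2^n times.
    This is why the final formula has signs on k only. *)
Lemma sum_sign_mul (f : signs -> R) :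
  \sum_(i : modes) f (sign_mul i.2 i.1) = 2 ^+ n * \sum_sigma f sigma.
Proof.
rewrite -(pair_bigA _ (fun sigma tau => f (sign_mul tau sigma)))/= exchange_big/=.
under eq_bigr do rewrite (sum_involutive f (sign_mulK _)).
by rewrite -(@sum_signs1 R) mulr_suml; under [RHS]eq_bigr do rewrite mul1r.
Qed.

(** The product of the signs at two different coordinates averages to zero, so that only the
    diagonal of <k^sigma, l>^2 survives: this is the origin of the term <k^2, l^2>. *)
Let sum_d_sqr : \sum_sigma d sigma ^+ 2 = \sum_(sigma : signs) \sum_p K p ^+ 2 * L p ^+ 2.
Proof.
have -> : \sum_sigma d sigma ^+ 2 =
    \sum_p \sum_q (K p * L p * (K q * L q)) * \sum_sigma sg sigma p * sg sigma q.
  under eq_bigr do rewrite expr2 big_distrlr/=.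
  rewrite exchange_big/=; apply: eq_bigr => p _; rewrite exchange_big/=; apply: eq_bigr => q _.
  by rewrite mulr_sumr; apply: eq_bigr => s _; ring.
rewrite [RHS]exchange_big/=; apply: eq_bigr => p _.
rewrite (bigD1 p)//= [X in _ + X]big1 ?addr0; last first.
  by move=> q qp; rewrite sum_sg_sg ?mulr0// eq_sym.
rewrite mulr_sumr; apply: eq_bigr => s _.
by rewrite -[sg s p * sg s p]expr2 sg_sqr; ring.
Qed.

Let torus_SE sigma : torus_S (sign_flip sigma k) l = ((4 + sqnorm k) * (4 + sqnorm l))^-1 *
  (- (sqnorm k * sqnorm l) + (\sum_p K p ^+ 2 * L p ^+ 2)
   + 3 / 4 * (Nm sigma - (sqnorm k - sqnorm l) ^+ 2 / (4 + Np sigma)) * d sigma ^+ 2) :> R.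
Proof.
rewrite /torus_S /= !sqr_enorm.
have -> : \sum_p (map_mx intr (sign_flip sigma k) : 'rV[R]_n) 0 p ^+ 2 = sqnorm k.
  by rewrite -(sum_sg_sqr k sigma); apply: eq_bigr => p _; rewrite mxE sign_flipE.
have -> : \sum_p (map_mx intr l : 'rV[R]_n) 0 p ^+ 2 = sqnorm l.
  by apply: eq_bigr => p _; rewrite mxE.
have -> : \sum_p (map_mx intr (sign_flip sigma k) : 'rV[R]_n) 0 p ^+ 2 * (map_mx intr l : 'rV[R]_n) 0 p ^+ 2 = \sum_p K p ^+ 2 * L p ^+ 2.
  by apply: eq_bigr => p _; rewrite !mxE rmorphM/= rmorph_sign exprMn sqrr_sign mul1r.
have -> : \sum_p (map_mx intr (sign_flip sigma k) - map_mx intr l : 'rV[R]_n) 0 p ^+ 2 = Nm sigma.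
  by apply: eq_bigr => p _; rewrite !mxE rmorphM/= rmorph_sign.
have -> : \sum_p (map_mx intr (sign_flip sigma k) + map_mx intr l : 'rV[R]_n) 0 p ^+ 2 = Np sigma.
  by apply: eq_bigr => p _; rewrite !mxE rmorphM/= rmorph_sign.
have -> // : dot (map_mx intr (sign_flip sigma k)) (map_mx intr l) = d sigma.
by apply: eq_bigr => p _; rewrite !mxE rmorphM/= rmorph_sign.
Qed.

Lemma sign_average :
  (- (c ^+ 4 * \sum_i (sqnorm k * sqnorm l - mode_dot k l i ^+ 2))
   + 3 * (c ^+ 4 * \sum_i mode_dot k l i ^+ 2 * (mode_diff_sqr k l i - (sqnorm k - sqnorm l) ^+ 2 / (4 + mode_sum_sqr k l i)) / 4))
  / ((4 + sqnorm k) * (4 + sqnorm l)) =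
  (2 ^+ n)^-1 * \sum_sigma torus_S (sign_flip sigma k) l.
Proof.
have E1 : \sum_i (sqnorm k * sqnorm l - mode_dot k l i ^+ 2) = 2 ^+ n * \sum_sigma (sqnorm k * sqnorm l - d sigma ^+ 2).
  by rewrite -sum_sign_mul; apply: eq_bigr => i _; rewrite mode_dot_mul.
have E2 : \sum_i mode_dot k l i ^+ 2 * (mode_diff_sqr k l i - (sqnorm k - sqnorm l) ^+ 2 / (4 + mode_sum_sqr k l i)) / 4 =
    2 ^+ n * \sum_sigma d sigma ^+ 2 * (Nm sigma - (sqnorm k - sqnorm l) ^+ 2 / (4 + Np sigma)) / 4.
  by rewrite -sum_sign_mul; apply: eq_bigr => i _; rewrite mode_dot_mul mode_diff_sqr_mul mode_sum_sqr_mul.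
have E3 : \sum_sigma (sqnorm k * sqnorm l - d sigma ^+ 2) =
    \sum_(sigma : signs) (sqnorm k * sqnorm l - \sum_p K p ^+ 2 * L p ^+ 2).
  by rewrite !sumrB sum_d_sqr.
rewrite E1 E2 E3 -[4%N]/(2 * 2)%N exprM coef_sqr.
have n0 : (2 : R) ^+ n != 0 by rewrite expf_neq0.
under [in RHS]eq_bigr do rewrite torus_SE.
rewrite -[in RHS]mulr_sumr [RHS]mulrCA mulrC; congr (_ * _).
have -> (x y : R) : - ((2 ^+ n)^-1 ^+ 2 * (2 ^+ n * x)) + 3 * ((2 ^+ n)^-1 ^+ 2 * (2 ^+ n * y))
   = (2 ^+ n)^-1 * (- x + 3 * y) by move: (2 ^+ n) n0 => z z0; field.
congr (_ * _); rewrite mulr_sumr -sumrN -big_split/=; apply: eq_bigr => sigma _.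
by move: (_ / (4 + _)) => z; field.
Qed.

End SignAverage.

Theorem theorem6p10 (R : realType) (n : nat) (hn : (0 < n)%N)
    (k l : 'rV[int]_n) (hkl : generic k l) :
  let mu := torus_volume R n in
  let ek : torus R n -> R := fourier k in
  let el : torus R n -> R := fourier l in
  exists Sup Snabla : R,
    [/\ is_Sec_up mu ek el Sup,
        is_Sec_nabla mu ek el Snabla,
        is_Sec mu ek el (Sup + Snabla) &
        Sup + Snabla =
          (2 ^+ n)^-1 * \sum_(sigma : {ffun 'I_n -> bool})
                          torus_S (sign_flip sigma k) l].
Proof.
move=> mu ek el.
have k0 := generic_neq0l hkl; have l0 := generic_neq0r hkl.
have [S1 S2 S3] := is_Sec_trig (lifts_fourier (R := R) k0) (lifts_fourier (R := R) l0)
  (chi_div (R := R) k l) (Z_helmholtz (R := R) k l).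
set A := mean _ in S1 S3; set B := mean _ in S2 S3; set La := Lambda _ _ _ in S1 S2 S3.
exists (- A / La), (3 * B / La); split => //.
rewrite -sign_average /A /B mean_gram_fourier// mean_Z_fourier// -mulrDl; congr (_ / _).
by rewrite /La /Lambda H1_dot_fourier// !H1_norm2_fourier// expr0n subr0.
Qed.
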